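(* Let $M=\mathbb P^n$ be complex projective space endowed with the Fubini–Study metric. Then $d=n^2+2n$ and $m_0\le 2n(n+1)$.
   Context: For a compact connected constant scalar curvature Kähler manifold $(M,\omega_M)$ let $\mathbb L_M:=-\frac12\Delta_M^2-\mathrm{Ric}_M\cdot\nabla_M^2$, acting on real valued functions, where $\Delta_M$ is the Laplace–Beltrami operator, $\mathrm{Ric}_M$ the Ricci tensor, $\nabla_M^2$ the Hessian and $\cdot$ the full metric contraction, all with respect to the metric induced by $\omega_M$. Let $\xi_0\equiv 1,\xi_1,\dots,\xi_d$ be a basis of $\ker\mathbb L_M$ with $\xi_1,\dots,\xi_d$ of mean $0$ (so $d+1=\dim\ker\mathbb L_M$). Let $\mathfrak M(p_1,\dots,p_m)$ be the $d\times m$ real matrix with entries $\xi_i(p_j)$. Set $\mathfrak C_1:=\mathrm{Rank}\,\mathfrak M$ and $\mathfrak C_2:=\dim(K^m_+\cap\mathrm{Ker}\,\mathfrak M)$, where $K^m_+\subset\mathbb R^m$ is the cone of vectors with (strictly) positive entries; $\mathfrak C_2\neq0$ means that $\mathrm{Ker}\,\mathfrak M$ contains a vector all of whose entries are positive. The integer $m_0\ge d+1$ is the least number $m\geq d+1$ of points for which there exist $p_1,\dots,p_m\in M$ with $\mathfrak C_1(p_1,\dots,p_m)=d$ and $\mathfrak C_2(p_1,\dots,p_m)\neq0$. *)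

(* Defs.v *)
From HB Require Import structures.
From mathcomp Require Import all_boot all_order all_algebra.
From mathcomp Require Import all_classical all_reals all_analysis.
From mathcomp Require Import complex.

Set Implicit Arguments.
Unset Strict Implicit.
Unset Printing Implicit Defensive.

Import Order.TTheory GRing.Theory Num.Theory.
Import numFieldNormedType.Exports.

Local Open Scope ring_scope.
Local Open Scope complex_scope.

Section Calculus.
Variables (R : realType) (N : nat).
Implicit Types (f : 'rV[R]_N -> R).

Definition partial (i : 'I_N) f : 'rV[R]_N -> R :=
  fun x => 'D_(delta_mx 0 i) f x.

Fixpoint Ck (k : nat) f : Prop :=
  if k is k'.+1 then
    continuous f /\
    forall i, (forall x, derivable f x (delta_mx 0 i)) /\ Ck k' (partial i f)
  else continuous f.

Definition smooth f := forall k, Ck k f.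

End Calculus.

(* Integration over R^N against Lebesgue measure, as an iterated integral
   (this agrees with the integral against the product measure for integrable
   functions, by Fubini). *)
Fixpoint iterated_integral (R : realType) (N : nat) :
    ('rV[R]_N -> R) -> R :=
  match N with
  | 0 => fun f => f 0
  | N'.+1 => fun f =>
      \int[lebesgue_measure]_t
        iterated_integral (fun y : 'rV[R]_N' => f (row_mx (t%:M : 'rV[R]_1) y))
  end.

(* Riemannian geometry of a metric [g] given in global coordinates on R^N. *)
Section RiemannianMetric.
Variables (R : realType) (N : nat) (g : 'rV[R]_N -> 'M[R]_N).
Implicit Types (f : 'rV[R]_N -> R) (x : 'rV[R]_N).

Definition ginv (i j : 'I_N) x : R := invmx (g x) i j.

Definition vol_density x : R := Num.sqrt (\det (g x)).

(* Christoffel symbol Gamma^k_ij *)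
Definition christoffel (k i j : 'I_N) x : R :=
  2^-1 * \sum_l ginv k l x *
    (partial i (fun y => g y j l) x + partial j (fun y => g y i l) x
     - partial l (fun y => g y i j) x).

Definition hessian f (i j : 'I_N) x : R :=
  partial i (partial j f) x - \sum_k christoffel k i j x * partial k f x.

(* The Laplace-Beltrami operator div grad, hence a nonpositive operator. *)
Definition laplace_beltrami f x : R :=
  (vol_density x)^-1 *
  \sum_i partial i
    (fun y => vol_density y * \sum_j ginv i j y * partial j f y) x.

Definition ricci (i j : 'I_N) x : R :=
  \sum_k (partial k (christoffel k i j) x - partial j (christoffel k i k) x)
  + \sum_k \sum_l (christoffel k k l x * christoffel l i j x
                   - christoffel k j l x * christoffel l i k x).

Definition ricci_dot_hessian f x : R :=
  \sum_i \sum_j \sum_k \sum_l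
    ginv i k x * ginv j l x * ricci i j x * hessian f k l x.

Definition LL f x : R :=
  - 2^-1 * laplace_beltrami (laplace_beltrami f) x - ricci_dot_hessian f x.

End RiemannianMetric.

(* Complex projective space: the complex lines through 0 in C^(n+1). *)
Definition projective_space (R : realType) (n : nat) : Type :=
  {L : {vspace 'rV[R[i]]_n.+1} | \dim L == 1%N}.

Section ProjectiveSpace.
Variables (R : realType) (n : nat).
Local Notation Pn := (projective_space R n).

(* C^n is identified with R^(n+n) by z_j = x_j + i x_(n+j). *)
Definition to_complex (x : 'rV[R]_(n + n)) : 'rV[R[i]]_n :=
  \row_j (x 0 (lshift n j) +i* x 0 (rshift n j)).

(* The point (z_0, .., 1, .., z_(n-1)) of C^(n+1), with 1 in position i. *)
Definition homogeneous_coord (i : 'I_n.+1) (x : 'rV[R]_(n + n)) :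
    'rV[R[i]]_n.+1 :=
  \row_k (if unlift i k is Some j then to_complex x 0 j else 1).

Lemma dim_homogeneous_coord i x : \dim <[homogeneous_coord i x]>%VS == 1%N.
Proof.
rewrite dim_vline; suff -> : homogeneous_coord i x != 0 by [].
apply/eqP => /matrixP /(_ 0 i) /eqP.
by rewrite !mxE unlift_none oner_eq0.
Qed.

(* Inverse of the i-th affine chart; its image is {Z_i <> 0}. *)
Definition affine_chart (i : 'I_n.+1) (x : 'rV[R]_(n + n)) : Pn :=
  exist _ <[homogeneous_coord i x]>%VS (dim_homogeneous_coord i x).

Definition hermitian_norm2 (Z : 'rV[R[i]]_n.+1) : R :=
  \sum_k (complex.Re (Z 0 k) ^+ 2 + complex.Im (Z 0 k) ^+ 2).

Definition FS_potential (i : 'I_n.+1) (x : 'rV[R]_(n + n)) : R :=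
  ln (hermitian_norm2 (homogeneous_coord i x)).

(* Right multiplication by [Jmx] on row vectors is multiplication by sqrt(-1). *)
Definition Jmx : 'M[R]_(n + n) := block_mx 0 1%:M (- 1%:M) 0.

(* The Riemannian metric, in the i-th affine chart, of the Fubini-Study form
   omega = sqrt(-1) d dbar log |Z|^2. For omega = sqrt(-1) d dbar K, the metric
   g(X, Y) = omega(X, J Y) equals (D^2 K(X, Y) + D^2 K(J X, J Y)) / 2, where D^2
   is the matrix of second partial derivatives. *)
Definition FS_metric (i : 'I_n.+1) (x : 'rV[R]_(n + n)) : 'M[R]_(n + n) :=
  let H := \matrix_(a, b) partial a (partial b (FS_potential i)) x in
  2^-1 *: (H + Jmx *m H *m Jmx^T).

Definition smooth_on_Pn (f : Pn -> R) : Prop :=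
  forall i, smooth (f \o affine_chart i).

Definition ker_LL (f : Pn -> R) : Prop :=
  smooth_on_Pn f /\
  forall i x, LL (FS_metric i) (f \o affine_chart i) x = 0.

(* Integral against the Riemannian volume, computed in the chart {Z_0 <> 0},
   whose complement is a null set. *)
Definition Pn_integral (f : Pn -> R) : R :=
  iterated_integral
    (fun x => f (affine_chart ord0 x) * vol_density (FS_metric ord0) x).

Definition mean (f : Pn -> R) : R := Pn_integral f / Pn_integral (fun=> 1).

Section Basis.
Variables (d : nat) (xi : 'I_d.+1 -> Pn -> R).

Definition is_basis_ker_LL : Prop :=
  [/\ forall i, ker_LL (xi i),
      forall c : 'I_d.+1 -> R,
        (forall p, \sum_i c i * xi i p = 0) -> forall i, c i = 0
    & forall f, ker_LL f ->
        exists c : 'I_d.+1 -> R, forall p, f p = \sum_i c i * xi i p].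

Definition is_adapted_basis : Prop :=
  [/\ is_basis_ker_LL,
      forall p, xi ord0 p = 1
    & forall i : 'I_d, mean (xi (lift ord0 i)) = 0].

Definition evaluation_mx (m : nat) (p : 'I_m -> Pn) : 'M[R]_(d, m) :=
  \matrix_(i < d, j < m) xi (lift ord0 i) (p j).

Definition frakC1 (m : nat) (p : 'I_m -> Pn) : nat := \rank (evaluation_mx p).

Definition positive_kernel (m : nat) (p : 'I_m -> Pn) (v : 'rV[R]_m) : Prop :=
  (forall j, 0 < v 0 j) /\ evaluation_mx p *m v^T = 0.

(* The dimension of the convex cone of positive vectors of the kernel, i.e. the
   dimension of its linear span: the largest number of linearly independent
   vectors that it contains. *)
Definition frakC2 (m : nat) (p : 'I_m -> Pn) : nat :=
  \max_(k < m.+1 |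
        `[< exists2 V : 'M[R]_(k, m),
              row_free V & forall i, positive_kernel p (row i V) >]) k.

Definition admissible (m : nat) : Prop :=
  (d.+1 <= m)%N /\
  exists p : 'I_m -> Pn, frakC1 p = d /\ frakC2 p <> 0%N.

Definition is_m0 (m0 : nat) : Prop :=
  admissible m0 /\ forall m, admissible m -> (m0 <= m)%N.

End Basis.

End ProjectiveSpace.

(* Main.v *)
Require Import Defs.
From mathcomp Require Import all_boot all_order all_algebra.
From mathcomp Require Import all_classical all_reals all_analysis.
From mathcomp Require Import complex measurable_realfun.
From mathcomp Require Import perm.
From mathcomp Require Import ring lra zify.

(** Functions in the kernel of LL on projective space are exactly the quotients
    of Hermitian forms by $|Z|^2$, so the kernel has dimension $(n+1)^2$ and
    $d = n^2+2n$; the bound on $m_0$ then comes from an explicit configuration of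
    points.

    _The kernel._ In an affine chart the Fubini-Study metric is
    $2\rho^{-1} - 2\rho^{-2}(x^T x + y^T y)$ with $\rho = 1+|x|^2$ and $y$ the image
    of $x$ under the complex structure. It is Einstein ([ricciE]) and its Laplacian
    L is explicit ([laplace_beltramiE]), which gives
    $LL = -\frac12 L^2 - (n+1) L$ ([LLE]). On a function lifted to the nonzero
    vectors of $C^{n+1} = R^N$, with $N = 2n+2$, the operator $W = |Z|^2\Delta$ is
    $2L$ ([lap_lift]), so that the kernel consists of the functions $F$ with
    $W(W+2N)F = 0$ ([lifted_LL]).

    Such an $F$ has degree 0. A harmonic function of degree -1 on the punctured
    space vanishes when $N > 3$, by the maximum principle for $|Z|^2G^2$
    ([harmonic_deg_opp1]). Differentiating, harmonic functions of degree 0 are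
    constant and those of degree 2 are quadratic forms. Applied to
    $F + WF/2N$ and to $|Z|^2 WF$, this shows that $|Z|^2F$ is a quadratic form
    ([classification]); invariance under multiplication by $\sqrt{-1}$ makes it
    Hermitian ([ker_LL_span]). The converse is a direct computation
    ([ker_LL_quadratic]).

    _Means._ On average the matrix $Z^* Z/|Z|^2$ is scalar, so the mean of the
    function of a Hermitian form is its trace divided by $n+1$ ([mean_herm]). The
    averages are obtained by integrating derivatives of $x_b\rho^{-m}$: the iterated
    integral of a partial derivative of a function that decays fast enough is zero
    ([iterated_integral_partial]). This rests on the linearity of the iterated
    integral, its continuity under domination and its invariance under translation.

    _Points._ On the projective line through two coordinate points, a round sphere,
    choose a tetrahedron that contains the centre. Its four points determine the
    restricted Hermitian form ([config_detects]), and a positive combination of them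
    kills the forms of trace zero ([config_sum]). All lines together give
    $4\binom{n+1}{2} = 2n(n+1)$ points that separate the kernel, whence
    $\mathfrak C_1 = d$, and whose evaluations at functions of mean zero satisfy a
    linear relation with positive weights, whence $\mathfrak C_2 \neq 0$
    ([admissible_config]). *)

Set Implicit Arguments.
Unset Strict Implicit.
Unset Printing Implicit Defensive.

Import Order.TTheory GRing.Theory Num.Theory.
Import numFieldNormedType.Exports.

Local Open Scope classical_set_scope.
Local Open Scope ring_scope.

(** * Directional derivatives on row vectors *)

Section FiniteSums.
Variables (R : realType).

Lemma cvg_sumF (T : Type) (F : set_system T) {FF : Filter F} (I : finType)
    (h : I -> T -> R) (l : I -> R) :
  (forall i, h i @ F --> l i) ->
  (fun t => \sum_i h i t) @ F --> \sum_i l i.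
Proof.
move=> H; elim: index_enum => [|i s IH].
  rewrite big_nil (_ : (fun t => _) = fun=> 0); first exact: cvg_cst.
  by apply/funext => y; rewrite big_nil.
rewrite big_cons (_ : (fun t => _) =
  fun t => h i t + \sum_(j <- s) h j t); first exact: cvgD.
by apply/funext => y; rewrite big_cons.
Qed.

End FiniteSums.

Section DirectionalDerivatives.
Variables (R : realType) (V : normedModType R).
Implicit Types (f g : V -> R) (x v : V).

Lemma derivable_is_derive f x v :
  derivable f x v -> is_derive x v f ('D_v f x).
Proof. by move=> ?; apply: DeriveDef. Qed.

Lemma is_derive_eqF f x v a b :
  is_derive x v f a -> a = b -> is_derive x v f b.
Proof. by move=> H <-. Qed.

Lemma is_derive_cstF x v (c : R) : is_derive x v (fun=> c) 0.
Proof. exact: is_derive_cst. Qed.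

Lemma is_deriveDF f g x v a b : is_derive x v f a -> is_derive x v g b ->
  is_derive x v (fun y => f y + g y) (a + b).
Proof. exact: is_deriveD. Qed.

Lemma is_deriveNF f x v a : is_derive x v f a ->
  is_derive x v (fun y => - f y) (- a).
Proof. exact: is_deriveN. Qed.

Lemma is_deriveBF f g x v a b : is_derive x v f a -> is_derive x v g b ->
  is_derive x v (fun y => f y - g y) (a - b).
Proof. exact: is_deriveB. Qed.

Lemma is_deriveMF f g x v a b : is_derive x v f a -> is_derive x v g b ->
  is_derive x v (fun y => f y * g y) (a * g x + f x * b).
Proof.
move=> fa gb; have := is_deriveM fa gb; rewrite /GRing.scale/= => H.
by rewrite addrC [a * _]mulrC.
Qed.

Lemma is_derive_sumF (I : finType) (F : I -> V -> R) (d : I -> R) x v :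
  (forall i, is_derive x v (F i) (d i)) ->
  is_derive x v (fun y => \sum_i F i y) (\sum_i d i).
Proof.
move=> H; suff : forall s : seq I,
  is_derive x v (fun y => \sum_(i <- s) F i y) (\sum_(i <- s) d i) by exact.
elim=> [|i s IH].
  rewrite big_nil (_ : (fun y => _) = fun=> 0); first exact: is_derive_cst.
  by apply/funext => y; rewrite big_nil.
rewrite big_cons (_ : (fun y => _) = fun y => F i y + \sum_(j <- s) F j y).
  exact: is_deriveDF.
by apply/funext => y; rewrite big_cons.
Qed.

(** Directional derivatives are one-variable derivatives along lines, which is
    how the one-variable mean value theorem becomes available. *)
Lemma is_derive_line f x v (s : R) d :
  is_derive (x + s *: v) v f d <-> is_derive s 1 (fun t => f (x + t *: v)) d.
Proof.
have E : (fun h => h^-1 *: ((f \o shift (x + s *: v)) (h *: v) - f (x + s *: v)))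
    = (fun h => h^-1 *: (((fun t => f (x + t *: v)) \o shift s) (h *: 1)
        - (fun t => f (x + t *: v)) s)).
  apply/funext => h /=; congr (_ *: (f _ - _)).
  by rewrite [h *: 1]mulr1 scalerDl addrCA.
split=> -[H1 <-]; apply: DeriveDef.
- by move: H1; rewrite /derivable E.
- by rewrite /derive E.
- by move: H1; rewrite /derivable E.
- by rewrite /derive E.
Qed.

Lemma is_derive_line0 f x v d :
  is_derive x v f d <-> is_derive (0 : R) 1 (fun t => f (x + t *: v)) d.
Proof. by rewrite -is_derive_line scale0r addr0. Qed.

Lemma is_derive_comp1 f (h : R -> R) x v a b :
  is_derive x v f a -> is_derive (f x) 1 h b ->
  is_derive x v (fun y => h (f y)) (b * a).
Proof.
move=> /is_derive_line0 fa hb; apply/is_derive_line0.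
apply: (@is_derive1_comp _ h (fun t => f (x + t *: v))).
by rewrite scale0r addr0.
Qed.

Lemma is_deriveVF f x v a : f x != 0 -> is_derive x v f a ->
  is_derive x v (fun y => (f y)^-1) (- a / f x ^+ 2).
Proof.
move=> fx0 [fa <-]; apply: DeriveDef; first exact: derivableV.
rewrite deriveV //= /GRing.scale/= mulNr mulNr; congr (- _).
by rewrite mulrC.
Qed.

End DirectionalDerivatives.

Section Partials.
Variables (R : realType) (N : nat).
Implicit Types (f g : 'rV[R]_N -> R) (x v : 'rV[R]_N) (U : set 'rV[R]_N).
Local Notation e_ i := (delta_mx 0 i : 'rV[R]_N).

Lemma is_derive_coord x v j : is_derive x v (fun y : 'rV[R]_N => y 0 j) (v 0 j).
Proof.
apply/is_derive_line0.
rewrite (_ : (fun t => _) = fun t => x 0 j + t * v 0 j); last first.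
  by apply/funext => t; rewrite !mxE.
apply: (is_derive_eqF (a := 0 + (1 * v 0 j + 0 * 0))); last first.
  by rewrite add0r mul1r mul0r addr0.
by apply: is_deriveDF; apply: is_deriveMF.
Qed.

Lemma is_partial f x i d : is_derive x (e_ i) f d -> partial i f x = d.
Proof. by move=> H; rewrite /partial derive_val. Qed.

Lemma is_derive_partial f x i : derivable f x (e_ i) ->
  is_derive x (e_ i) f (partial i f x).
Proof. exact: derivable_is_derive. Qed.

(** Boxes rather than balls, because the mean value arguments below move one
    coordinate at a time. *)
Lemma nbhs_rV_box (x : 'rV[R]_N) (A : set 'rV[R]_N) : nbhs x A <->
  exists2 e : R, 0 < e & forall y : 'rV[R]_N, (forall j, `|y 0 j - x 0 j| < e) -> A y.
Proof.
split=> [/nbhs_ballP[e /= e0 H]|[e e0 H]].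
  exists e => // y yx; apply: H; split=> // i j.
  by rewrite /ball/= (ord1 i) distrC; exact: yx.
apply/nbhs_ballP; exists e => //= y yx; apply: H => j.
by have [_ /(_ 0 j)] := yx; rewrite /ball/= distrC.
Qed.

Lemma cvg_rV (T : Type) (F : set_system T) {FF : Filter F} (h : T -> 'rV[R]_N)
    (x : 'rV[R]_N) :
  (forall j, (fun t => h t 0 j) @ F --> x 0 j) -> h @ F --> x.
Proof.
move=> H A /nbhs_rV_box[e e0 HA]; rewrite /nbhs/=.
have : \forall t \near F, forall j, `|h t 0 j - x 0 j| < e.
  apply: filter_forall => j; move/cvgrPdist_lt : (H j) => /(_ e e0).
  by apply: filterS => t; rewrite distrC.
by apply: filterS => t /HA.
Qed.

Lemma partial_MVT f x i (h : R) :
  (forall s : R, `|s| <= `|h| -> derivable f (x + s *: e_ i) (e_ i)) ->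
  exists2 s : R, `|s| <= `|h| &
    f (x + h *: e_ i) - f x = h * partial i f (x + s *: e_ i).
Proof.
move=> H.
pose g t := f (x + t *: e_ i).
have dg (s : R) : `|s| <= `|h| -> is_derive s 1 g (partial i f (x + s *: e_ i)).
  by move=> /H /is_derive_partial; exact: (proj1 (is_derive_line f x _ s _)).
have cg (s : R) : `|s| <= `|h| -> {for s, continuous g}.
  by move=> /dg[/derivable1_diffP/differentiable_continuous].
have [h0|h0] := leP 0 h.
  have le (s : R) : s \in `[0, h]%R -> `|s| <= `|h|.
    by rewrite in_itv/= => /andP[s0 sh]; rewrite !ger0_norm.
  have [|||s sh] := @MVT_segment R g (fun s => partial i f (x + s *: e_ i)) 0 h.
  - by [].
  - by move=> s sh; apply/dg/le/subset_itv_oo_cc.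
  - apply: continuous_in_subspaceT => s; rewrite inE/= => sh.
    exact/cg/le.
  rewrite /g scale0r addr0 subr0 mulrC => ->; exists s => //; exact: le.
have le (s : R) : s \in `[h, 0]%R -> `|s| <= `|h|.
  by rewrite in_itv/= => /andP[s0 sh]; rewrite !ler0_norm ?lerN2 // ltW.
have [|||s sh] := @MVT_segment R g (fun s => partial i f (x + s *: e_ i)) h 0.
- exact: ltW.
- by move=> s sh; apply/dg/le/subset_itv_oo_cc.
- apply: continuous_in_subspaceT => s; rewrite inE/= => sh.
  exact/cg/le.
rewrite /g scale0r addr0 sub0r mulrC => E; exists s; first exact: le.
by apply/eqP; rewrite -eqr_opp opprB E mulNr.
Qed.

Definition mix (a b : 'rV[R]_N) (k : nat) : 'rV[R]_N :=
  \row_j if (j < k)%N then b 0 j else a 0 j.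

(** Walk from [a] to [b] along the points [mix a b k], one coordinate at a time,
    and apply the mean value theorem to each step. *)
Lemma increment_partials f (a b : 'rV[R]_N) :
  (forall y : 'rV[R]_N, (forall j, `|y 0 j - a 0 j| <= `|b 0 j - a 0 j|) ->
     forall i, derivable f y (e_ i)) ->
  exists c : 'I_N -> 'rV[R]_N,
    (forall i j, `|c i 0 j - a 0 j| <= `|b 0 j - a 0 j|) /\
    f b - f a = \sum_i (b 0 i - a 0 i) * partial i f (c i).
Proof.
move=> H.
have step (i : 'I_N) : mix a b i.+1 = mix a b i + (b 0 i - a 0 i) *: e_ i.
  apply/rowP => j; rewrite !mxE eqxx/= ltnS leq_eqVlt.
  have [->|ji] := eqVneq j i; first by rewrite eqxx ltnn mulr1 addrC subrK.
  by rewrite (_ : (j == i :> nat) = false) ?mulr0 ?addr0 //; exact/negbTE.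
have box (i : 'I_N) (s : R) : `|s| <= `|b 0 i - a 0 i| ->
    forall j, `|(mix a b i + s *: e_ i) 0 j - a 0 j| <= `|b 0 j - a 0 j|.
  move=> sb j; rewrite !mxE eqxx/=.
  have [->|ji] := eqVneq j i; first by rewrite ltnn mulr1 addrAC subrr add0r.
  by case: ifP => _; rewrite mulr0 addr0 ?subrr ?normr0.
have ex (i : 'I_N) : exists c : 'rV[R]_N,
    (forall j, `|c 0 j - a 0 j| <= `|b 0 j - a 0 j|) /\
    f (mix a b i.+1) - f (mix a b i) = (b 0 i - a 0 i) * partial i f c.
  have [|s sb E] := @partial_MVT f (mix a b i) i (b 0 i - a 0 i).
    by move=> s sb; apply: H => j; exact: box.
  exists (mix a b i + s *: e_ i); split; first exact: box.
  by rewrite step E.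
have [c Hc] := choice ex.
exists c; split=> [i j|]; first by case: (Hc i).
rewrite (_ : f b = f (mix a b N)); last first.
  by congr f; apply/rowP => j; rewrite mxE ltn_ord.
rewrite (_ : f a = f (mix a b 0)); last first.
  by congr f; apply/rowP => j; rewrite mxE.
rewrite -(@telescope_sumr _ 0 N (fun k => f (mix a b k))) // big_mkord.
by apply: eq_bigr => i _; case: (Hc i).
Qed.

(** Only partial derivatives are at hand: [increment_partials] expresses each
    difference quotient with partial derivatives of [f] at points that tend to
    [c t], where they are continuous. *)
Lemma chain_rule f (c : R -> 'rV[R]_N) (dc : 'I_N -> R) (t : R) :
  (\forall y \near c t, forall i, derivable f y (e_ i)) ->
  (forall i, {for c t, continuous (partial i f)}) ->
  (forall j, is_derive t 1 (fun s => c s 0 j) (dc j)) ->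
  is_derive t 1 (fun s => f (c s)) (\sum_j partial j f (c t) * dc j).
Proof.
move=> Hd Hc Hdc.
have /nbhs_rV_box[e e0 He] := Hd.
have cc j : {for t, continuous (fun s => c s 0 j)}.
  by have [/derivable1_diffP/differentiable_continuous] := Hdc j.
have sh j (d : R) : 0 < d -> \forall h \near (0 : R), `|c (h + t) 0 j - c t 0 j| < d.
  move=> d0.
  have : ((fun s => c s 0 j) \o shift t) @ (0 : R) --> c t 0 j.
    by rewrite cvg_comp_shift add0r; exact: cc.
  by move=> /cvgrPdist_lt/(_ d d0); apply: filterS => h; rewrite distrC.
have nbox : \forall h \near (0:R), forall j, `|c (h + t) 0 j - c t 0 j| < e.
  have := @filter_forall R 'I_N (fun j h => `|c (h + t) 0 j - c t 0 j| < e)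
    (nbhs (0 : R)) _ (fun j => sh j e e0).
  exact.
pose P h (p : 'I_N -> 'rV[R]_N) :=
  (forall j, `|c (h + t) 0 j - c t 0 j| < e) ->
  (forall i j, `|p i 0 j - c t 0 j| <= `|c (h + t) 0 j - c t 0 j|) /\
    f (c (h + t)) - f (c t) =
    \sum_i (c (h + t) 0 i - c t 0 i) * partial i f (p i).
have [p Hp] : {p & forall h, P h (p h)}.
  apply: (@boolp.choice _ _ P) => h.
  have [nb|nb] := pselect (forall j, `|c (h + t) 0 j - c t 0 j| < e); last first.
    by exists (fun=> 0) => /nb.
  have [|p Ep] := @increment_partials f (c t) (c (h + t)).
    by move=> y yb i; apply: He => j; apply: le_lt_trans (nb j).
  by exists p => _.
have cp i : p h i @[h --> (0:R)] --> c t.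
  apply: cvg_rV => j; apply/cvgrPdist_lt => d d0.
  near=> h.
  rewrite distrC; apply: (@le_lt_trans _ _ `|c (h + t) 0 j - c t 0 j|).
    by have [|+ _] := Hp h; [near: h|apply].
  by near: h; exact: sh.
suff cv : h^-1 *: (((fun s => f (c s)) \o shift t) (h *: 1) - f (c t))
    @[h --> 0^'] --> (\sum_j partial j f (c t) * dc j).
  by apply: DeriveDef; [apply/cvg_ex; eexists; exact: cv|exact/cvg_lim].
have cv' : \sum_j partial j f (p h j) *
      (h^-1 *: (((fun s => c s 0 j) \o shift t) (h *: 1) - c t 0 j))
    @[h --> 0^'] --> (\sum_j partial j f (c t) * dc j).
  apply: cvg_sumF => j; apply: cvgM.
    have cpj : (fun h => p h j) @ (0 : R)^' --> c t.
      by move=> A /(cp j) H; exact: (nbhs_dnbhs H).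
    exact: (cvg_comp _ _ cpj (Hc j)).
  by have [+ <-] := Hdc j.
apply: cvg_trans cv'; apply: near_eq_cvg.
near=> h; rewrite /= [h *: 1]mulr1.
have [|_ ->] := Hp h; first by near: h; exact: (nbhs_dnbhs nbox).
rewrite scaler_sumr; apply: eq_bigr => j _.
by rewrite /GRing.scale/= ?mulr1; ring.
Unshelve. all: by end_near. Qed.

End Partials.

(** * Functions of class C^k on open sets of row vectors *)

Section SmoothOn.
Variables (R : realType) (N : nat).
Implicit Types (f g : 'rV[R]_N -> R) (x v : 'rV[R]_N) (U : set 'rV[R]_N).
Local Notation e_ i := (delta_mx 0 i : 'rV[R]_N).

(** Being of class C^k on [U]; for [U = setT] and all [k] at once this is [smooth],
    see [smoothE]. *)
Fixpoint Ck_on U (k : nat) f : Prop :=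
  (forall x, U x -> {for x, continuous f}) /\
  if k is k'.+1 then
    forall i, (forall x, U x -> derivable f x (e_ i)) /\ Ck_on U k' (partial i f)
  else True.

Definition smooth_on U f := forall k, Ck_on U k f.

Lemma Ck_on_continuous U k f x : Ck_on U k f -> U x -> {for x, continuous f}.
Proof. by case: k => [|k] [+ _]; apply. Qed.

Lemma Ck_on_derivable U k f x i :
  Ck_on U k.+1 f -> U x -> derivable f x (e_ i).
Proof. by move=> [_ /(_ i)[+ _]]; apply. Qed.

Lemma Ck_on_is_derive U k f x i : Ck_on U k.+1 f -> U x ->
  is_derive x (e_ i) f (partial i f x).
Proof. by move=> Cf Ux; apply: is_derive_partial; exact: Ck_on_derivable Cf Ux. Qed.

Lemma Ck_on_partial U k f i : Ck_on U k.+1 f -> Ck_on U k (partial i f).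
Proof. by move=> [_ /(_ i)[_ +]]; apply. Qed.

Lemma Ck_onW U k f : Ck_on U k.+1 f -> Ck_on U k f.
Proof.
elim: k f => [|k IH] f; first by move=> [? _].
move=> [cf df]; split=> // i; have [dfi Cf] := df i; split=> //.
exact: IH.
Qed.

Lemma Ck_on_le U k l f : (l <= k)%N -> Ck_on U k f -> Ck_on U l f.
Proof.
move=> /subnKC <-; elim: (k - l)%N => [|m IH]; first by rewrite addn0.
by rewrite addnS => /Ck_onW.
Qed.

Lemma smooth_on_partial U f i : smooth_on U f -> smooth_on U (partial i f).
Proof. by move=> H k; apply: Ck_on_partial. Qed.

Lemma smooth_on_continuous U f x :
  smooth_on U f -> U x -> {for x, continuous f}.
Proof. by move=> /(_ 0%N) /Ck_on_continuous; apply. Qed.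

Lemma smooth_on_is_derive U f x i : smooth_on U f -> U x ->
  is_derive x (e_ i) f (partial i f x).
Proof. by move=> /(_ 1%N)/Ck_on_derivable fU /fU ?; apply: is_derive_partial. Qed.

Lemma open_near_eq U f g x : open U -> (forall y, U y -> f y = g y) -> U x ->
  \near x, f x = g x.
Proof.
by move=> oU fg Ux; apply: filterS (open_nbhs_nbhs (conj oU Ux)) => y; exact: fg.
Qed.

Lemma partial_eq_on U f g i : open U -> (forall y, U y -> f y = g y) ->
  forall y, U y -> partial i f y = partial i g y.
Proof.
by move=> oU fg y Uy; apply: near_eq_derive; exact: (open_near_eq oU fg Uy).
Qed.

Lemma derivable_eq_on U f g x v : open U -> (forall y, U y -> f y = g y) ->
  U x -> derivable f x v -> derivable g x v.
Proof.
by move=> oU fg Ux; apply: near_eq_derivable; exact: (open_near_eq oU fg Ux).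
Qed.

Lemma continuous_eq_on U f g x : open U -> (forall y, U y -> f y = g y) ->
  U x -> {for x, continuous f} -> {for x, continuous g}.
Proof.
move=> oU fg Ux; rewrite /prop_for /continuous_at -(fg x Ux) => cf.
by apply: cvg_trans cf; exact: (near_eq_cvg (open_near_eq oU fg Ux)).
Qed.

Lemma Ck_on_ext U k f g : open U -> (forall y, U y -> f y = g y) ->
  Ck_on U k f -> Ck_on U k g.
Proof.
move=> oU; elim: k f g => [|k IH] f g fg [cf Cf]; split=> //.
- by move=> x Ux; exact: (continuous_eq_on oU fg Ux (cf x Ux)).
- by move=> x Ux; exact: (continuous_eq_on oU fg Ux (cf x Ux)).
- move=> i; have [dfi Cfi] := Cf i; split.
    by move=> x Ux; exact: (derivable_eq_on oU fg Ux (dfi x Ux)).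
  by apply: IH Cfi; exact: partial_eq_on.
Qed.

(** Introduction rule: [partial i f] is rarely syntactically the function whose
    regularity is known, and the two agree only on [U]. *)
Lemma Ck_on_rec U k f (d : 'I_N -> 'rV[R]_N -> R) : open U ->
  (forall x, U x -> {for x, continuous f}) ->
  (forall i x, U x -> is_derive x (e_ i) f (d i x)) ->
  (forall i, Ck_on U k (d i)) -> Ck_on U k.+1 f.
Proof.
move=> oU cf fd Cd; split=> // i; split.
  by move=> x /(fd i)[].
by apply: Ck_on_ext (Cd i) => // x /(fd i)/is_partial.
Qed.

Lemma Ck_on_cst U k (c : R) : open U -> Ck_on U k (fun=> c).
Proof.
move=> oU; elim: k c => [|k IH] c.
  by split=> // x _; exact: cst_continuous.
apply: (@Ck_on_rec U k _ (fun _ _ => 0)) => // x _.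
exact: cst_continuous.
Qed.

Lemma Ck_on_coord U k j : open U -> Ck_on U k (fun x : 'rV[R]_N => x 0 j).
Proof.
move=> oU; case: k => [|k].
  by split=> // x _; exact: coord_continuous.
apply: (@Ck_on_rec U k _ (fun i _ => (e_ i) 0 j)) => //.
- by move=> x _; exact: coord_continuous.
- by move=> i x _; exact: is_derive_coord.
- by move=> i; exact: Ck_on_cst.
Qed.

Lemma Ck_onD U k f g : open U ->
  Ck_on U k f -> Ck_on U k g -> Ck_on U k (fun x => f x + g x).
Proof.
move=> oU; elim: k f g => [|k IH] f g Cf Cg.
  by split=> // x Ux; exact: (cvgD (Ck_on_continuous Cf Ux) (Ck_on_continuous Cg Ux)).
apply: (@Ck_on_rec U k _ (fun i x => partial i f x + partial i g x)) => //.
- by move=> x Ux; exact: (cvgD (Ck_on_continuous Cf Ux) (Ck_on_continuous Cg Ux)).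
- move=> i x Ux; exact: (is_deriveDF (Ck_on_is_derive i Cf Ux) (Ck_on_is_derive i Cg Ux)).
- by move=> i; apply: IH; exact: Ck_on_partial.
Qed.

Lemma Ck_onM U k f g : open U ->
  Ck_on U k f -> Ck_on U k g -> Ck_on U k (fun x => f x * g x).
Proof.
move=> oU; elim: k f g => [|k IH] f g Cf Cg.
  by split=> // x Ux; exact: (cvgM (Ck_on_continuous Cf Ux) (Ck_on_continuous Cg Ux)).
apply: (@Ck_on_rec U k _
    (fun i x => partial i f x * g x + f x * partial i g x)) => //.
- by move=> x Ux; exact: (cvgM (Ck_on_continuous Cf Ux) (Ck_on_continuous Cg Ux)).
- move=> i x Ux; exact: (is_deriveMF (Ck_on_is_derive i Cf Ux) (Ck_on_is_derive i Cg Ux)).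
- move=> i; apply: Ck_onD => //; apply: IH.
  + exact: Ck_on_partial.
  + exact: Ck_onW.
  + exact: Ck_onW.
  + exact: Ck_on_partial.
Qed.

Lemma Ck_onZ U k (c : R) f : open U ->
  Ck_on U k f -> Ck_on U k (fun x => c * f x).
Proof. by move=> oU Cf; apply: Ck_onM => //; exact: Ck_on_cst. Qed.

Lemma Ck_onN U k f : open U -> Ck_on U k f -> Ck_on U k (fun x => - f x).
Proof.
move=> oU Cf; rewrite (_ : (fun x => - f x) = fun x => -1 * f x).
  exact: Ck_onZ.
by apply/funext => x; rewrite mulN1r.
Qed.

Lemma Ck_onB U k f g : open U ->
  Ck_on U k f -> Ck_on U k g -> Ck_on U k (fun x => f x - g x).
Proof. by move=> oU Cf Cg; apply: Ck_onD => //; exact: Ck_onN. Qed.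

Lemma Ck_on_sum U k (I : finType) (F : I -> 'rV[R]_N -> R) : open U ->
  (forall i, Ck_on U k (F i)) -> Ck_on U k (fun x => \sum_i F i x).
Proof.
move=> oU H; elim: (index_enum I) => [|i s IH].
  rewrite (_ : (fun x => _) = fun=> 0); first exact: Ck_on_cst.
  by apply/funext => x; rewrite big_nil.
rewrite (_ : (fun x => _) = fun x => F i x + \sum_(j <- s) F j x).
  exact: Ck_onD.
by apply/funext => x; rewrite big_cons.
Qed.

Lemma Ck_onV U k f : open U -> (forall x, U x -> f x != 0) ->
  Ck_on U k f -> Ck_on U k (fun x => (f x)^-1).
Proof.
move=> oU f0; elim: k => [|k IH] Cf.
  by split=> // x Ux; exact: (cvgV (f0 x Ux) (Ck_on_continuous Cf Ux)).
apply: (@Ck_on_rec U k _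
    (fun i x => - partial i f x * ((f x)^-1 * (f x)^-1))) => //.
- by move=> x Ux; exact: (cvgV (f0 x Ux) (Ck_on_continuous Cf Ux)).
- move=> i x Ux; apply: (is_derive_eqF (a := - partial i f x / f x ^+ 2)).
    exact: (is_deriveVF (f0 x Ux) (Ck_on_is_derive i Cf Ux)).
  by rewrite expr2 invfM.
- have CV := IH (Ck_onW Cf).
  move=> i; apply: Ck_onM => //; last exact: Ck_onM.
  by apply: Ck_onN => //; exact: Ck_on_partial.
Qed.

Lemma smooth_on_cst U c : open U -> smooth_on U (fun=> c).
Proof. by move=> oU k; exact: Ck_on_cst. Qed.

Lemma smooth_on_coord U j : open U -> smooth_on U (fun x : 'rV[R]_N => x 0 j).
Proof. by move=> oU k; exact: Ck_on_coord. Qed.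

Lemma smooth_onD U f g : open U ->
  smooth_on U f -> smooth_on U g -> smooth_on U (fun x => f x + g x).
Proof. by move=> oU Cf Cg k; exact: Ck_onD. Qed.

Lemma smooth_onM U f g : open U ->
  smooth_on U f -> smooth_on U g -> smooth_on U (fun x => f x * g x).
Proof. by move=> oU Cf Cg k; exact: Ck_onM. Qed.

Lemma smooth_onX U f m : open U -> smooth_on U f -> smooth_on U (fun x => f x ^+ m).
Proof.
move=> oU Cf; elim: m => [|m IH]; first exact: smooth_on_cst oU.
rewrite (_ : (fun x => _) = fun x => f x * f x ^+ m); first exact: smooth_onM.
by apply/funext => x; rewrite exprS.
Qed.

Lemma smooth_onZ U (c : R) f : open U ->
  smooth_on U f -> smooth_on U (fun x => c * f x).
Proof. by move=> oU Cf k; exact: Ck_onZ. Qed.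

Lemma smooth_onB U f g : open U ->
  smooth_on U f -> smooth_on U g -> smooth_on U (fun x => f x - g x).
Proof. by move=> oU Cf Cg k; exact: Ck_onB. Qed.

Lemma smooth_onV U f : open U -> (forall x, U x -> f x != 0) ->
  smooth_on U f -> smooth_on U (fun x => (f x)^-1).
Proof. by move=> oU f0 Cf k; exact: Ck_onV. Qed.

Lemma smooth_on_sum U (I : finType) (F : I -> 'rV[R]_N -> R) : open U ->
  (forall i, smooth_on U (F i)) -> smooth_on U (fun x => \sum_i F i x).
Proof. by move=> oU CF k; apply: Ck_on_sum => // i; exact: CF. Qed.

Lemma smooth_on_ext U f g : open U -> (forall y, U y -> f y = g y) ->
  smooth_on U f -> smooth_on U g.
Proof. by move=> oU fg Cf k; exact: (Ck_on_ext oU fg (Cf k)). Qed.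

Lemma smoothE f : smooth f <-> smooth_on setT f.
Proof.
split=> Cf k; move: {Cf}(Cf k); elim: k f => [|k IH] f.
- by move=> cf; split=> // x _; exact: cf.
- move=> [cf df]; split=> [x _|i]; first exact: cf.
  have [dfi Cfi] := df i; split=> [x _|]; first exact: dfi.
  exact: IH.
- by move=> [cf _] x; exact: cf.
- move=> [cf df]; split=> [x|i]; first exact: cf.
  have [dfi Cfi] := df i; split=> [x|]; first exact: dfi.
  exact: IH.
Qed.

End SmoothOn.

Section Composition.
Variables (R : realType) (N M : nat).
Variables (U : set 'rV[R]_N) (V : set 'rV[R]_M).
Variable phi : 'rV[R]_N -> 'rV[R]_M.
Hypothesis UV : forall x, U x -> V (phi x).

Lemma is_derive_comp_rV (f : 'rV[R]_M -> R) x v (dphi : 'I_M -> R) : open V ->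
  Ck_on V 1 f -> U x -> (forall j, is_derive x v (fun y => phi y 0 j) (dphi j)) ->
  is_derive x v (fun y => f (phi y)) (\sum_j partial j f (phi x) * dphi j).
Proof.
move=> oV Cf Ux dp; apply/is_derive_line0.
have -> : \sum_j partial j f (phi x) * dphi j =
    \sum_j partial j f (phi (x + 0 *: v)) * dphi j.
  by rewrite scale0r addr0.
apply: (@chain_rule _ _ f (fun t => phi (x + t *: v))).
- rewrite scale0r addr0; apply: filterS (open_nbhs_nbhs (conj oV (UV Ux))).
  by move=> y Vy i; exact: (Ck_on_derivable Cf Vy).
- move=> i; rewrite scale0r addr0.
  exact: (Ck_on_continuous (Ck_on_partial i Cf) (UV Ux)).
- by move=> j; exact: (proj1 (is_derive_line0 _ x v _) (dp j)).
Qed.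

Lemma Ck_on_comp k (f : 'rV[R]_M -> R) : open U -> open V -> Ck_on V k f ->
  (forall j, Ck_on U k (fun x => phi x 0 j)) -> Ck_on U k (fun x => f (phi x)).
Proof.
move=> oU oV; elim: k f => [|k IH] f Cf Cphi.
  split=> // x Ux; apply: continuous_comp; last exact: (Ck_on_continuous Cf (UV Ux)).
  apply: (@cvg_rV _ _ _ (nbhs x) _ phi) => j; exact: (Ck_on_continuous (Cphi j) Ux).
apply: (@Ck_on_rec _ _ U k _
  (fun i x => \sum_j partial j f (phi x) * partial i (fun y => phi y 0 j) x)) => //.
- move=> x Ux; apply: continuous_comp; last exact: (Ck_on_continuous Cf (UV Ux)).
  apply: (@cvg_rV _ _ _ (nbhs x) _ phi) => j; exact: (Ck_on_continuous (Cphi j) Ux).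
- move=> i x Ux; apply: is_derive_comp_rV => //.
    exact: Ck_on_le Cf.
  by move=> j; apply: is_derive_partial; exact: (Ck_on_derivable (Cphi j) Ux).
- move=> i; apply: Ck_on_sum => // j; apply: Ck_onM => //.
    by apply: IH; [exact: Ck_on_partial|move=> l; exact: Ck_onW].
  exact: Ck_on_partial.
Qed.

End Composition.

Section SecondDifferences.
Variables (R : realType) (N : nat).
Implicit Types (f g : 'rV[R]_N -> R) (x v : 'rV[R]_N) (U : set 'rV[R]_N).
Local Notation e_ i := (delta_mx 0 i : 'rV[R]_N).

Lemma is_derive_translate f x v w d : is_derive (x + w) v f d ->
  is_derive x v (fun y => f (y + w)) d.
Proof.
move=> /is_derive_line0 H; apply/is_derive_line0.
rewrite (_ : (fun t : R => f (x + t *: v + w)) = fun t => f (x + w + t *: v)) //.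
by apply/funext => t; rewrite addrAC.
Qed.

(** The mean value theorem in direction [i] for a difference in direction [j], then
    in direction [j] for [partial i f]; the left hand side is symmetric in [i] and
    [j]. *)
Lemma second_difference f x i j (h : R) :
  (forall y : 'rV[R]_N, (forall l, `|y 0 l - x 0 l| <= `|h| + `|h|) ->
     derivable f y (e_ i) /\ derivable (partial i f) y (e_ j)) ->
  exists2 y : 'rV[R]_N, (forall l, `|y 0 l - x 0 l| <= `|h| + `|h|) &
    f (x + h *: e_ i + h *: e_ j) - f (x + h *: e_ i) - f (x + h *: e_ j) + f x
      = h * h * partial j (partial i f) y.
Proof.
move=> H.
have box (s t : R) : `|s| <= `|h| -> `|t| <= `|h| ->
    forall l, `|(x + s *: e_ i + t *: e_ j) 0 l - x 0 l| <= `|h| + `|h|.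
  move=> sh th l; rewrite !mxE eqxx/=.
  rewrite (_ : _ - _ = s * (l == i)%:R + t * (l == j)%:R); last by ring.
  have le1 (r : R) (b : bool) : `|r| <= `|h| -> `|r * b%:R| <= `|h|.
    by case: b => rh; rewrite ?mulr1 // mulr0 normr0.
  by apply: le_trans (ler_normD _ _) _; apply: lerD; exact: le1.
have box0 (s : R) : `|s| <= `|h| ->
    forall l, `|(x + s *: e_ i) 0 l - x 0 l| <= `|h| + `|h|.
  by move=> sh l; have := box s 0 sh _ l; rewrite scale0r addr0 normr0; exact.
pose g y := f (y + h *: e_ j) - f y.
have dg (s : R) : `|s| <= `|h| -> is_derive (x + s *: e_ i) (e_ i) g
    (partial i f (x + s *: e_ i + h *: e_ j) - partial i f (x + s *: e_ i)).
  move=> sh; apply: is_deriveBF.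
    apply: is_derive_translate; apply: is_derive_partial.
    by have [] := H _ (box s h sh (lexx _)).
  by apply: is_derive_partial; have [] := H _ (box0 s sh).
have [s sh E] := @partial_MVT _ _ g x i h
  (fun s sh => @ex_derive _ _ _ _ _ _ _ (dg s sh)).
have [|t th E2] := @partial_MVT _ _ (partial i f) (x + s *: e_ i) j h.
  by move=> t th; have [] := H _ (box s t sh th).
exists (x + s *: e_ i + t *: e_ j); first exact: box.
move: E; rewrite (is_partial (dg s sh)) E2 /g => E.
by rewrite -mulrA -E; ring.
Qed.

(** Both mixed derivatives are limits of the same second difference. *)
Lemma partialC U f i j x : open U -> Ck_on U 2 f -> U x ->
  partial i (partial j f) x = partial j (partial i f) x.
Proof.
move=> oU Cf Ux; apply/eqP; rewrite -subr_eq0 -normr_le0.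
apply/ler_addgt0Pl => e e0; rewrite addr0.
have cont a b : {for x, continuous (partial a (partial b f))}.
  exact: (Ck_on_continuous (Ck_on_partial a (Ck_on_partial b Cf)) Ux).
have e20 : 0 < e / 2 by rewrite divr_gt0.
have near1 a b : \forall y \near x, U y /\
    `|partial a (partial b f) x - partial a (partial b f) y| < e / 2.
  apply: filterI; first exact: open_nbhs_nbhs.
  by have /cvgrPdist_lt := cont a b; apply.
have /nbhs_rV_box[d1 d10 H1] := near1 i j.
have /nbhs_rV_box[d2 d20 H2] := near1 j i.
pose h := Num.min d1 d2 / 4.
have m0 : 0 < Num.min d1 d2 by rewrite lt_min d10.
have h0 : 0 < h by rewrite divr_gt0.
have hm : h + h < Num.min d1 d2 by rewrite /h; lra.
have hd1 : `|h| + `|h| < d1 by rewrite gtr0_norm // (lt_le_trans hm) // ge_min lexx.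
have hd2 : `|h| + `|h| < d2 by rewrite gtr0_norm // (lt_le_trans hm) // ge_min lexx orbT.
have [|y1 y1h E1] := @second_difference f x i j h.
  move=> y yh; have [|Uy _] := H1 y; first by move=> l; apply: le_lt_trans (yh l) _.
  split; first exact: (Ck_on_derivable Cf Uy).
  exact: (Ck_on_derivable (Ck_on_partial i Cf) Uy).
have [|y2 y2h E2] := @second_difference f x j i h.
  move=> y yh; have [|Uy _] := H1 y; first by move=> l; apply: le_lt_trans (yh l) _.
  split; first exact: (Ck_on_derivable Cf Uy).
  exact: (Ck_on_derivable (Ck_on_partial j Cf) Uy).
have E : partial j (partial i f) y1 = partial i (partial j f) y2.
  have hh : h * h != 0 by rewrite mulf_neq0 ?gt_eqF.
  suff /(mulfI hh) : h * h * partial j (partial i f) y1 =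
    h * h * partial i (partial j f) y2 by [].
  apply: etrans (esym E1) (etrans _ E2); congr (_ + _).
  by rewrite addrAC; congr (f _ - _ - _); exact: addrAC.
have [|_ B1] := H1 y2; first by move=> l; apply: le_lt_trans (y2h l) _.
have [|_ B2] := H2 y1; first by move=> l; apply: le_lt_trans (y1h l) _.
rewrite E distrC in B2.
rewrite [leRHS]splitr.
exact: le_trans (ler_distD _ _ _) (lerD (ltW B1) (ltW B2)).
Qed.

(** Were the second derivative positive, it would be so in a box around [x], and
    the second difference of [f] centred at [x] would be positive as well, so that
    [f] would exceed [f x] at one of its two outer points. *)
Lemma partial2_max U f i x : open U -> Ck_on U 2 f -> U x ->
  (forall y, U y -> f y <= f x) -> partial i (partial i f) x <= 0.
Proof.
move=> oU Cf Ux fmax; rewrite leNgt; apply/negP => D0.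
have cD : {for x, continuous (partial i (partial i f))}.
  exact: (Ck_on_continuous (Ck_on_partial i (Ck_on_partial i Cf)) Ux).
have : \forall y \near x, U y /\ 0 < partial i (partial i f) y.
  apply: filterI; first exact: open_nbhs_nbhs.
  have /cvgrPdist_lt/(_ _ D0) := cD; apply: filterS => y.
  by rewrite ltr_norml => /andP[_]; rewrite ltrBlDr ltrDl.
move=> /nbhs_rV_box[d d0 Hd].
pose h := d / 4; have h0 : 0 < h by rewrite divr_gt0.
have box (y : 'rV[R]_N) : (forall l, `|y 0 l - (x - h *: e_ i) 0 l| <= `|h| + `|h|) ->
    forall l, `|y 0 l - x 0 l| < d.
  move=> H l; apply: (@le_lt_trans _ _ (`|h| + `|h| + `|h|)).
    rewrite (_ : y 0 l - x 0 l = (y 0 l - (x - h *: e_ i) 0 l) - (h *: e_ i) 0 l).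
      apply: le_trans (ler_normB _ _) _; apply: lerD; first exact: H.
      by rewrite !mxE normrM; case: (_ && _); rewrite ?normr1 ?mulr1 // normr0 mulr0.
    rewrite !mxE; ring.
  by rewrite gtr0_norm // /h; clear -d0; lra.
have [y /box yx|y /box yx E] := @second_difference f (x - h *: e_ i) i i h.
  have [Uy _] := Hd y yx; split; first exact: (Ck_on_derivable Cf Uy).
  exact: (Ck_on_derivable (Ck_on_partial i Cf) Uy).
have [_ Dy] := Hd y yx.
have Ub (s : R) : `|s| <= h -> U (x + s *: e_ i).
  move=> sh.
  suff [] : U (x + s *: e_ i) /\ 0 < partial i (partial i f) (x + s *: e_ i) by [].
  apply: Hd => l; rewrite !mxE addrAC subrr add0r normrM.
  apply: (@le_lt_trans _ _ h); last by rewrite /h; clear -d0; lra.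
  by case: (_ && _); rewrite ?normr1 ?mulr1 // normr0 mulr0 ltW.
have h2 : 0 < h * h * partial i (partial i f) y by rewrite !mulr_gt0.
move: h2; rewrite -E subrK.
have M1 := fmax _ (Ub h (eq_ind_r (fun z => z <= h) (lexx h) (gtr0_norm h0))).
have hN : `|- h| <= h by rewrite normrN gtr0_norm.
have := fmax _ (Ub _ hN); rewrite scaleNr.
by move: M1; clear; move: (f _) (f _) (f _) => a b c; lra.
Qed.

End SecondDifferences.

(** * The Fubini-Study metric in an affine chart *)

Section FubiniStudyChart.
Variables (R : realType) (n : nat).
Local Notation N := (n + n)%N.
Implicit Types (x : 'rV[R]_N) (f : 'rV[R]_N -> R).
Local Notation e_ i := (delta_mx 0 i : 'rV[R]_N).
Local Notation K := ((Jmx R n)^T).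
Local Notation d_ i j := ((i == j)%:R : R).

Definition rho (x : 'rV[R]_N) : R := 1 + \sum_k x 0 k ^+ 2.
(** Multiplication by $-\sqrt{-1}$ in complex coordinates. *)
Definition rotate (x : 'rV[R]_N) : 'rV[R]_N := x *m K.

Lemma rho_gt0 x : 0 < rho x.
Proof. by rewrite ltr_wpDr // sumr_ge0 // => k _; exact: sqr_ge0. Qed.

Lemma rho_neq0 x : rho x != 0.
Proof. by rewrite gt_eqF // rho_gt0. Qed.

Lemma tr_Jmx : K = - Jmx R n.
Proof.
by rewrite /Jmx tr_block_mx linearN/= !trmx0 trmx1 opp_block_mx opprK oppr0.
Qed.

Lemma JmxJmx : Jmx R n *m Jmx R n = - 1%:M.
Proof.
rewrite /Jmx mulmx_block !mul0mx !mulmx0 !mulmxN !mulNmx !mulmx1 !add0r !addr0.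
by rewrite scalar_mx_block opp_block_mx oppr0.
Qed.

Lemma JKmx : Jmx R n *m K = 1%:M.
Proof. by rewrite tr_Jmx mulmxN JmxJmx opprK. Qed.

Lemma KK : K *m K = - 1%:M.
Proof. by rewrite tr_Jmx mulNmx mulmxN JmxJmx opprK. Qed.

Lemma K_anti i j : K j i = - K i j.
Proof. by rewrite [in RHS]tr_Jmx !mxE opprK. Qed.

Lemma sum_KK i j : \sum_k K i k * K k j = - d_ i j.
Proof.
by have /matrixP/(_ i j) := KK; rewrite !mxE => <-.
Qed.

Lemma trace_K : \sum_k K k k = 0.
Proof.
rewrite big1 // => k _; have := K_anti k k => /eqP.
by rewrite -addr_eq0 -mulr2n mulrn_eq0/= => /eqP.
Qed.

Lemma rotateE x j : rotate x 0 j = \sum_k x 0 k * K k j.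
Proof. by rewrite mxE. Qed.

Lemma sum_Kx x i : \sum_k K i k * x 0 k = - rotate x 0 i.
Proof.
rewrite rotateE -sumrN; apply: eq_bigr => k _.
by rewrite K_anti mulNr mulrC.
Qed.

Lemma rotate_rotate x : rotate (rotate x) = - x.
Proof. by rewrite /rotate -mulmxA KK mulmxN mulmx1. Qed.

Lemma sum_Ky x i : \sum_k K i k * rotate x 0 k = x 0 i.
Proof. by rewrite sum_Kx rotate_rotate mxE opprK. Qed.

Lemma sum_yK x i : \sum_k rotate x 0 k * K k i = - x 0 i.
Proof. by rewrite -rotateE rotate_rotate mxE. Qed.

Lemma sum_xx x : \sum_k x 0 k * x 0 k = rho x - 1.
Proof. by rewrite /rho addrAC subrr add0r; apply: eq_bigr => k _; rewrite expr2. Qed.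

Lemma sum_yy x : \sum_k rotate x 0 k * rotate x 0 k = rho x - 1.
Proof.
rewrite -sum_xx.
have -> (z : 'rV[R]_N) : \sum_k z 0 k * z 0 k = (z *m z^T) 0 0.
  by rewrite mxE; apply: eq_bigr => k _; rewrite [z^T _ _]mxE.
have -> (z : 'rV[R]_N) : \sum_k z 0 k * z 0 k = (z *m z^T) 0 0.
  by rewrite mxE; apply: eq_bigr => k _; rewrite [z^T _ _]mxE.
by rewrite /rotate trmx_mul trmxK mulmxA -(mulmxA x) [K *m _]mulmx1C ?JKmx // mulmx1.
Qed.

Lemma sum_xy x : \sum_k x 0 k * rotate x 0 k = 0.
Proof.
have : \sum_k x 0 k * rotate x 0 k = - \sum_k x 0 k * rotate x 0 k.
  rewrite -sumrN; under eq_bigr do rewrite rotateE mulr_sumr.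
  rewrite exchange_big/=; apply: eq_bigr => k _.
  rewrite -mulrN -(sum_Kx x k) mulr_sumr; apply: eq_bigr => l _; ring.
move=> /eqP; rewrite -addr_eq0 -mulr2n mulrn_eq0/= => /eqP //.
Qed.

Lemma sum_yx x : \sum_k rotate x 0 k * x 0 k = 0.
Proof. by under eq_bigr do rewrite mulrC; exact: sum_xy. Qed.

Lemma sum_dl (i : 'I_N) (F : 'I_N -> R) : \sum_k d_ i k * F k = F i.
Proof.
rewrite (bigD1 i)//= eqxx mul1r big1 ?addr0 // => k ki.
by rewrite eq_sym (negbTE ki) mul0r.
Qed.

Lemma sum_dr (i : 'I_N) (F : 'I_N -> R) : \sum_k d_ k i * F k = F i.
Proof. by under eq_bigr do rewrite eq_sym; exact: sum_dl. Qed.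

Lemma sum_dd : \sum_(k < N) d_ k k = 2 * n%:R.
Proof.
under eq_bigr do rewrite eqxx.
by rewrite sumr_const card_ord natrD mulr_natl mulr2n.
Qed.

(** ** First derivatives of the building blocks *)

Lemma is_derive_x x i j : is_derive x (e_ i) (fun y : 'rV[R]_N => y 0 j) (d_ i j).
Proof.
by apply: (is_derive_eqF (is_derive_coord _ _ _)); rewrite mxE eqxx eq_sym.
Qed.

Lemma is_derive_y x i j : is_derive x (e_ i) (fun y => rotate y 0 j) (K i j).
Proof.
rewrite (_ : (fun y => _) = fun y : 'rV[R]_N => \sum_k y 0 k * K k j); last first.
  by apply/funext => y; rewrite rotateE.
apply: (is_derive_eqF (a := \sum_k (d_ i k * K k j + x 0 k * 0))).
  apply: is_derive_sumF => k.
  exact: (is_deriveMF (is_derive_x x i k) (is_derive_cstF _ _ _)).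
by rewrite -(sum_dl i (fun k => K k j)); apply: eq_bigr => k _; rewrite mulr0 addr0.
Qed.

Lemma is_derive_rho x i : is_derive x (e_ i) rho (2 * x 0 i).
Proof.
apply: (is_derive_eqF (a := 0 + \sum_k (d_ i k * x 0 k + x 0 k * d_ i k))).
  rewrite (_ : rho = fun y => 1 + \sum_k y 0 k * y 0 k); last first.
    by apply/funext => y; rewrite sum_xx addrC subrK.
  apply: is_deriveDF; apply: is_derive_sumF => k.
  exact: (is_deriveMF (is_derive_x x i k) (is_derive_x x i k)).
rewrite add0r -(sum_dl i (x 0)) mulr_sumr; apply: eq_bigr => k _; ring.
Qed.

Lemma is_derive_rhoV x i :
  is_derive x (e_ i) (fun y => (rho y)^-1) (- (2 * x 0 i) / rho x ^+ 2).
Proof. exact: (is_deriveVF (rho_neq0 x) (is_derive_rho x i)). Qed.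

End FubiniStudyChart.

(** ** The metric, its inverse and its volume density *)

Section FubiniStudyMetric.
Variables (R : realType) (n : nat).
Local Notation N := (n + n)%N.
Implicit Types (x : 'rV[R]_N) (f : 'rV[R]_N -> R).
Local Notation e_ i := (delta_mx 0 i : 'rV[R]_N).
Local Notation K := ((Jmx R n)^T).
Local Notation d_ i j := ((i == j)%:R : R).
Local Notation y_ x i := (rotate x 0 i).

Lemma hermitian_norm2_coord i (x : 'rV[R]_N) :
  hermitian_norm2 (homogeneous_coord i x) = rho x.
Proof.
rewrite /hermitian_norm2 (bigD1_ord i)//= mxE unlift_none /= expr1n expr0n addr0.
congr (1 + _); rewrite big_split_ord/= -big_split/=.
by apply: eq_bigr => j _; rewrite !mxE liftK mxE.
Qed.

Lemma FS_potentialE i : @FS_potential R n i = fun x => ln (rho x).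
Proof. by apply/funext => x; rewrite /FS_potential hermitian_norm2_coord. Qed.

Lemma partial_FS_potential i b :
  partial b (@FS_potential R n i) = fun x => 2 * x 0 b * (rho x)^-1.
Proof.
apply/funext => x; rewrite FS_potentialE; apply: is_partial.
apply: (is_derive_eqF (is_derive_comp1 (is_derive_rho x b)
  (is_derive1_ln (rho_gt0 x)))).
by rewrite mulrC.
Qed.

Lemma partial2_FS_potential i a b x :
  partial a (partial b (@FS_potential R n i)) x =
  2 * d_ a b / rho x - 4 * (x 0 a * x 0 b) / rho x ^+ 2.
Proof.
rewrite partial_FS_potential; apply: is_partial.
apply: (is_derive_eqF (is_deriveMF (is_deriveMF (is_derive_cstF _ _ _)
  (is_derive_x x a b)) (is_derive_rhoV x a))).
by have := rho_neq0 x => ?; field.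
Qed.

(** The complex rank one term of the Fubini-Study metric appears as the sum of the
    two real ones spanned by $x$ and its rotate. *)
Definition FSmx x : 'M[R]_N :=
  (2 / rho x)%:M - (2 / rho x ^+ 2) *: (x^T *m x + (rotate x)^T *m rotate x).

Lemma FSmxE x a b : FSmx x a b =
  2 / rho x * d_ a b - 2 / rho x ^+ 2 * (x 0 a * x 0 b + y_ x a * y_ x b).
Proof.
rewrite /FSmx !mxE !big_ord1 ![_^T _ _]mxE -!rotateE; congr (_ - _).
by rewrite mulr_natr.
Qed.

Lemma FS_metricE i : @FS_metric R n i = FSmx.
Proof.
apply/funext => x; rewrite /FS_metric.
set H := \matrix_(a, b) _.
have -> : H = (2 / rho x)%:M - (4 / rho x ^+ 2) *: (x^T *m x).
  apply/matrixP => a b; rewrite [LHS]mxE partial2_FS_potential !mxE big_ord1 mxE.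
  by rewrite -[_ *+ (a == b)]mulr_natr; have := rho_neq0 x => ?; field.
rewrite mulmxBr mulmxBl -[X in _ + (X - _)]mulmxA.
rewrite mul_scalar_mx -scalemxAr JKmx -!scalemxAr -!scalemxAl.
have -> : Jmx R n *m (x^T *m x) *m K = (rotate x)^T *m rotate x.
  by rewrite /rotate trmx_mul trmxK !mulmxA.
rewrite /FSmx scalemx1.
apply/matrixP => a b; rewrite !mxE; set s1 := \sum_j _; set s2 := \sum_j _.
by move: (_ *+ (a == b)) => s3; field; exact: rho_neq0.
Qed.

Definition FSinv x : 'M[R]_N :=
  (rho x / 2) *: (1%:M + x^T *m x + (rotate x)^T *m rotate x).

Lemma FSinvE x a b : FSinv x a b =
  rho x / 2 * (d_ a b + x 0 a * x 0 b + y_ x a * y_ x b).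
Proof. by rewrite /FSinv !mxE !big_ord1 ![_^T _ _]mxE -!rotateE. Qed.

Lemma sum_FSmx x (v : 'I_N -> R) a : \sum_b FSmx x a b * v b =
  2 / rho x * v a - 2 / rho x ^+ 2 *
    (x 0 a * (\sum_b x 0 b * v b) + y_ x a * \sum_b y_ x b * v b).
Proof.
rewrite -(sum_dl a v) mulr_sumr !mulr_sumr -big_split/= mulr_sumr -sumrB.
by apply: eq_bigr => b _; rewrite FSmxE; ring.
Qed.

Lemma sum_FSinv x (v : 'I_N -> R) a : \sum_b FSinv x a b * v b =
  rho x / 2 *
    (v a + x 0 a * (\sum_b x 0 b * v b) + y_ x a * \sum_b y_ x b * v b).
Proof.
rewrite -[v a](sum_dl a v) !mulr_sumr -!big_split/= mulr_sumr.
by apply: eq_bigr => b _; rewrite FSinvE; ring.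
Qed.

Lemma FSinvK x : FSinv x *m FSmx x = 1%:M.
Proof.
apply/matrixP => a c; rewrite [LHS]mxE sum_FSinv [RHS]mxE FSmxE.
have Ex (w : 'I_N -> R) : \sum_b w b * FSmx x b c =
   2 / rho x * w c - 2 / rho x ^+ 2 *
    (x 0 c * (\sum_b x 0 b * w b) + y_ x c * \sum_b y_ x b * w b).
  rewrite -sum_FSmx; apply: eq_bigr => b _.
  by rewrite mulrC; congr (_ * _); rewrite !FSmxE eq_sym; ring.
rewrite !Ex sum_xx sum_yy sum_xy sum_yx.
by have := rho_neq0 x => ?; move: (d_ a c) => ?; field.
Qed.

Lemma FSmx_unit x : FSmx x \in unitmx.
Proof. by have /mulmx1_unit[] := FSinvK x. Qed.

Lemma invmx_FSmx x : invmx (FSmx x) = FSinv x.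
Proof.
by rewrite -[FSinv x]mulmx1 -(mulmxV (FSmx_unit x)) mulmxA FSinvK mul1mx.
Qed.

(** Sylvester's identity, from the two block triangular factorisations of the
    same matrix. *)
Lemma det_1B_mulmx (p q : nat) (A : 'M[R]_(p, q)) (B : 'M[R]_(q, p)) :
  \det (1%:M - A *m B) = \det (1%:M - B *m A).
Proof.
pose T := block_mx 1%:M A B 1%:M.
have E1 : T = block_mx 1%:M A 0 1%:M *m block_mx (1%:M - A *m B) 0 B 1%:M.
  by rewrite mulmx_block !mul1mx !mul0mx !mulmx1 !add0r subrK.
have E2 : T = block_mx 1%:M 0 B 1%:M *m block_mx 1%:M A 0 (1%:M - B *m A).
  by rewrite mulmx_block !mul1mx !mul0mx !mulmx1 !addr0 addrC subrK.
have : \det T = \det (1%:M - A *m B).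
  by rewrite E1 det_mulmx det_ublock det_lblock !det1 !mul1r mulr1.
by rewrite E2 det_mulmx det_ublock det_lblock !det1 !mul1r.
Qed.

(** The metric is scalar up to a perturbation of rank 2, on which Sylvester's
    identity leaves a 2 by 2 determinant. *)
Lemma det_FSmx x : \det (FSmx x) = 2 ^+ N / rho x ^+ (N + 2).
Proof.
have r0 := rho_neq0 x.
pose B := col_mx x (rotate x).
have -> : FSmx x = (2 / rho x) *: (1%:M - B^T *m ((rho x)^-1 *: B)).
  rewrite /FSmx scalerBr scalemx1; congr (_ - _).
  rewrite -scalemxAr scalerA /B tr_col_mx mul_row_col.
  by congr (_ *: _); field.
rewrite detZ det_1B_mulmx.
have -> : 1%:M - (rho x)^-1 *: B *m B^T = (rho x)^-1%:M :> 'M[R]_(1 + 1).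
  rewrite -scalemxAl /B tr_col_mx mul_col_row.
  have E (u v : 'rV[R]_N) : u *m v^T = (\sum_k u 0 k * v 0 k)%:M.
    apply/matrixP => a b; rewrite !ord1 !mxE eqxx mulr1n.
    by apply: eq_bigr => k _; rewrite mxE.
  rewrite !E sum_xx sum_yy sum_xy sum_yx raddf0 -scalar_mx_block.
  apply/matrixP => a b; rewrite !mxE.
  by case: (a == b); rewrite ?mulr1n ?mulr0n; field.
by rewrite det_scalar expr_div_n exprVn (exprD _ N 2) -mulrA -invfM.
Qed.

Lemma vol_densityE i x :
  vol_density (@FS_metric R n i) x = 2 ^+ n / rho x ^+ n.+1.
Proof.
rewrite /vol_density FS_metricE det_FSmx.
have -> : 2 ^+ N / rho x ^+ (N + 2) = (2 ^+ n / rho x ^+ n.+1) ^+ 2 :> R.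
  rewrite expr_div_n -!exprM; congr (_ ^+ _ / _ ^+ _); lia.
rewrite sqrtr_sqr ger0_norm // divr_ge0 ?exprn_ge0 //.
exact/ltW/rho_gt0.
Qed.

Lemma ginvE i a b x : ginv (@FS_metric R n i) a b x = FSinv x a b.
Proof. by rewrite /ginv FS_metricE invmx_FSmx. Qed.

End FubiniStudyMetric.

(** ** Christoffel symbols and Ricci curvature *)

Section FubiniStudyCurvature.
Variables (R : realType) (n : nat) (c : 'I_n.+1).
Local Notation N := (n + n)%N.
Implicit Types (x : 'rV[R]_N) (f : 'rV[R]_N -> R).
Local Notation e_ i := (delta_mx 0 i : 'rV[R]_N).
Local Notation K := ((Jmx R n)^T).
Local Notation d_ i j := ((i == j)%:R : R).
Local Notation y_ x i := (rotate x 0 i).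
Local Notation g := (@FS_metric R n c).

Lemma is_derive_FSmx x i a b : is_derive x (e_ i) (fun y => FSmx y a b)
  (- (4 * x 0 i / rho x ^+ 2) * d_ a b
   + 8 * x 0 i / rho x ^+ 3 * (x 0 a * x 0 b + y_ x a * y_ x b)
   - 2 / rho x ^+ 2 * (d_ i a * x 0 b + x 0 a * d_ i b
                       + K i a * y_ x b + y_ x a * K i b)).
Proof.
rewrite (_ : (fun y => _) = fun y => 2 * d_ a b * (rho y)^-1
   - 2 * ((rho y)^-1 * (rho y)^-1) * (y 0 a * y 0 b + y_ y a * y_ y b)).
  apply: (is_derive_eqF (is_deriveBF
    (is_deriveMF (is_derive_cstF _ _ _) (is_derive_rhoV x i))
    (is_deriveMF
       (is_deriveMF (is_derive_cstF _ _ _)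
          (is_deriveMF (is_derive_rhoV x i) (is_derive_rhoV x i)))
       (is_deriveDF
         (is_deriveMF (is_derive_x x i a) (is_derive_x x i b))
         (is_deriveMF (is_derive_y x i a) (is_derive_y x i b)))))).
  by have := rho_neq0 x => ?; move: (K i a) (K i b) (y_ x a) (y_ x b) => *; field.
apply/funext => y; rewrite FSmxE.
by have := rho_neq0 y => ?; move: (y_ y a) (y_ y b) => *; field.
Qed.

Definition Gam (k i j : 'I_N) x : R := - (rho x)^-1 *
  (d_ k i * x 0 j + d_ k j * x 0 i + K i k * y_ x j + K j k * y_ x i).

Lemma GamC k i j x : Gam k i j x = Gam k j i x.
Proof. by rewrite /Gam; ring. Qed.

Lemma sum_Gam_up x (w : 'I_N -> R) i j : \sum_k w k * Gam k i j x =
  - (rho x)^-1 * (w i * x 0 j + w j * x 0 i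
    + (\sum_k K i k * w k) * y_ x j + (\sum_k K j k * w k) * y_ x i).
Proof.
rewrite -(sum_dr i w) -(sum_dr j w) !mulr_suml -!big_split/= mulr_sumr.
by apply: eq_bigr => k _; rewrite /Gam; ring.
Qed.

Lemma sum_Gam_low x (w : 'I_N -> R) k i : \sum_j w j * Gam k i j x =
  - (rho x)^-1 * (d_ k i * (\sum_j w j * x 0 j) + w k * x 0 i
    + K i k * (\sum_j w j * y_ x j) + (\sum_j w j * K j k) * y_ x i).
Proof.
rewrite -(sum_dl k w) !mulr_suml !mulr_sumr -!big_split/= mulr_sumr.
by apply: eq_bigr => j _; rewrite /Gam; ring.
Qed.

(** The formula for the Christoffel symbols multiplied by the metric, which is
    easier to check than its contraction with the inverse. *)
Lemma FSmx_Gam x l i j : 2 * \sum_m FSmx x l m * Gam m i j x =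
  partial i (fun y => g y j l) x + partial j (fun y => g y i l) x
  - partial l (fun y => g y i j) x.
Proof.
rewrite FS_metricE !(is_partial (is_derive_FSmx _ _ _ _)).
rewrite sum_FSmx !sum_Gam_up !sum_Ky !sum_Kx /Gam.
rewrite (K_anti _ i l) (K_anti _ j l) (K_anti _ i j).
rewrite (eq_sym j l) (eq_sym i l) (eq_sym j i).
have := rho_neq0 x => ?.
by move: (K _ _) (K _ _) (K _ _) (y_ x i) (y_ x j) (y_ x l) => *; field.
Qed.

Lemma christoffelE k i j : christoffel g k i j = Gam k i j.
Proof.
apply/funext => x; rewrite /christoffel.
under eq_bigr => l _ do rewrite -FSmx_Gam ginvE mulrCA mulr_sumr.
rewrite -mulr_sumr mulKf ?pnatr_eq0 // exchange_big/=.
under eq_bigr => m _.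
  under eq_bigr => l _ do rewrite mulrA.
  rewrite -mulr_suml.
  have -> : \sum_l FSinv x k l * FSmx x l m = d_ k m.
    by have /matrixP/(_ k m) := FSinvK x; rewrite !mxE.
  over.
exact: sum_dl.
Qed.

Lemma is_derive_Gam x l k i j : is_derive x (e_ l) (Gam k i j)
  (- (2 * x 0 l / rho x) * Gam k i j x - (rho x)^-1 *
   (d_ k i * d_ l j + d_ k j * d_ l i + K i k * K l j + K j k * K l i)).
Proof.
apply: (is_derive_eqF (is_deriveMF (is_deriveNF (is_derive_rhoV x l))
  (is_deriveDF (is_deriveDF (is_deriveDF
     (is_deriveMF (is_derive_cstF _ _ _) (is_derive_x x l j))
     (is_deriveMF (is_derive_cstF _ _ _) (is_derive_x x l i)))
     (is_deriveMF (is_derive_cstF _ _ _) (is_derive_y x l j)))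
     (is_deriveMF (is_derive_cstF _ _ _) (is_derive_y x l i))))).
rewrite /Gam; have := rho_neq0 x => ?.
by move: (K _ _) (K _ _) (K _ _) (K _ _) (y_ x i) (y_ x j) => *; field.
Qed.

Lemma trace_Gam x i : \sum_k Gam k i k x = - (2 * n%:R + 2) * x 0 i / rho x.
Proof.
have -> : \sum_k Gam k i k x = - (rho x)^-1 * ((\sum_k d_ k i * x 0 k)
   + (\sum_(k < N) d_ k k) * x 0 i + (\sum_k K i k * y_ x k)
   + (\sum_k K k k) * y_ x i).
  rewrite !mulr_suml -!big_split/= mulr_sumr.
  by apply: eq_bigr => k _; rewrite /Gam.
rewrite sum_dr sum_dd sum_Ky trace_K.
by have := rho_neq0 x => ?; field.
Qed.

Lemma divergence_Gam x i j : \sum_k partial k (Gam k i j) x =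
  4 / rho x ^+ 2 * (x 0 i * x 0 j - y_ x i * y_ x j).
Proof.
under eq_bigr do rewrite (is_partial (is_derive_Gam _ _ _ _ _)).
have -> : \sum_k (- (2 * x 0 k / rho x) * Gam k i j x - (rho x)^-1 *
   (d_ k i * d_ k j + d_ k j * d_ k i + K i k * K k j + K j k * K k i)) =
  - (2 / rho x) * (\sum_k x 0 k * Gam k i j x) - (rho x)^-1 *
  ((\sum_k d_ k i * d_ k j) + (\sum_k d_ k j * d_ k i) +
   (\sum_k K i k * K k j) + (\sum_k K j k * K k i)).
  by rewrite -!big_split/= !mulr_sumr -sumrB; apply: eq_bigr => k _; ring.
rewrite sum_Gam_up !sum_Kx !sum_dr !sum_KK (eq_sym j i).
by have := rho_neq0 x => ?; move: (y_ x i) (y_ x j) (d_ i j) => *; field.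
Qed.

Lemma partial_trace_Gam x i j : \sum_k partial j (Gam k i k) x =
  - (2 * n%:R + 2) * (d_ i j / rho x - 2 * x 0 i * x 0 j / rho x ^+ 2).
Proof.
under eq_bigr do rewrite (is_partial (is_derive_Gam _ _ _ _ _)).
have -> : \sum_k (- (2 * x 0 j / rho x) * Gam k i k x - (rho x)^-1 *
   (d_ k i * d_ j k + d_ k k * d_ j i + K i k * K j k + K k k * K j i)) =
  - (2 * x 0 j / rho x) * (\sum_k Gam k i k x) - (rho x)^-1 *
  ((\sum_k d_ k i * d_ j k) + (\sum_(k < N) d_ k k) * d_ j i +
   - (\sum_k K i k * K k j) + (\sum_k K k k) * K j i).
  rewrite !mulr_suml -sumrN -!big_split/= !mulr_sumr -sumrB; apply: eq_bigr => k _.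
  by rewrite (K_anti _ j k); ring.
rewrite trace_Gam sum_dr sum_dd sum_KK trace_K (eq_sym j i).
by have := rho_neq0 x => ?; move: (d_ i j) => *; field.
Qed.

Lemma Gam_rotate x i j k : \sum_m K i m * Gam k j m x = - (rho x)^-1 *
  (- (d_ k j * y_ x i) + K i k * x 0 j + K j k * x 0 i - d_ i k * y_ x j).
Proof. by rewrite sum_Gam_low sum_Ky sum_Kx sum_KK; ring. Qed.

Lemma Gam_Gam x i j : \sum_k \sum_l Gam k j l x * Gam l i k x =
  (rho x)^-2 * ((2 * n%:R + 6) * (x 0 i * x 0 j - y_ x i * y_ x j)).
Proof.
under eq_bigr do rewrite sum_Gam_up.
have -> : \sum_k (- (rho x)^-1 * (Gam k j i x * x 0 k + Gam k j k x * x 0 i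
     + (\sum_m K i m * Gam k j m x) * y_ x k
     + (\sum_m K k m * Gam k j m x) * y_ x i)) =
   - (rho x)^-1 * ((\sum_k x 0 k * Gam k j i x) + (\sum_k Gam k j k x) * x 0 i
     + (\sum_k (\sum_m K i m * Gam k j m x) * y_ x k)
     + (\sum_k \sum_m K k m * Gam k j m x) * y_ x i).
  rewrite !mulr_suml -!big_split/= mulr_sumr; apply: eq_bigr => k _.
  by congr (_ * (_ + _ + _ + _)); rewrite mulrC.
have -> : \sum_k (\sum_m K i m * Gam k j m x) * y_ x k = - (rho x)^-1 *
   (- (\sum_k d_ k j * y_ x k) * y_ x i + (\sum_k K i k * y_ x k) * x 0 j
    + (\sum_k K j k * y_ x k) * x 0 i - (\sum_k d_ i k * y_ x k) * y_ x j).
  rewrite -!mulNr -!sumrN !mulr_suml -!big_split/= mulr_sumr.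
  by apply: eq_bigr => k _; rewrite Gam_rotate; ring.
have -> : \sum_k \sum_m K k m * Gam k j m x = - (rho x)^-1 *
   (- (\sum_k d_ k j * y_ x k) + (\sum_k K k k) * x 0 j
    + (\sum_k K j k * x 0 k) - (\sum_(k < N) d_ k k) * y_ x j).
  rewrite -!sumrN -!mulNr -!sumrN !mulr_suml -!big_split/= mulr_sumr.
  by apply: eq_bigr => k _; rewrite Gam_rotate; ring.
rewrite sum_Gam_up trace_Gam !sum_Ky !sum_Kx !sum_dr !sum_dl sum_dd trace_K.
by have := rho_neq0 x => ?; move: (y_ x i) (y_ x j) => *; field.
Qed.

(** The metric is Einstein; the Ricci term of LL is therefore $n+1$ times the
    Laplacian, and LL is a polynomial in the Laplacian. *)
Lemma ricciE i j x : ricci g i j x = (n%:R + 1) * FSmx x i j.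
Proof.
rewrite /ricci; under eq_bigr do rewrite !christoffelE.
under [X in _ + X]eq_bigr do under eq_bigr do rewrite !christoffelE.
rewrite sumrB divergence_Gam partial_trace_Gam.
under [X in _ + X]eq_bigr do rewrite sumrB.
rewrite sumrB Gam_Gam exchange_big/=.
under [X in _ + (X - _)]eq_bigr => l _.
  rewrite -mulr_suml; under eq_bigr do rewrite GamC.
  rewrite trace_Gam (_ : _ * _ = - (2 * n%:R + 2) / rho x * (x 0 l * Gam l i j x)).
    over.
  by ring.
rewrite -mulr_sumr sum_Gam_up !sum_Kx FSmxE.
by have := rho_neq0 x => ?; move: (y_ x i) (y_ x j) (d_ i j) => *; field.
Qed.

(** ** The Laplacian, and the operator LL *)

Definition FSlap f x : R := rho x / 2 *
  \sum_i \sum_j (d_ i j + x 0 i * x 0 j + y_ x i * y_ x j) *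
     partial i (partial j f) x.

Lemma is_derive_rhoVX x i m : is_derive x (e_ i) (fun y => (rho y)^-1 ^+ m)
  (- (2 * m%:R * x 0 i) * (rho x)^-1 ^+ m.+1).
Proof.
elim: m => [|m IH].
  apply: (is_derive_eqF (is_derive_cstF _ _ 1)); ring.
rewrite (_ : (fun y => _) = fun y => (rho y)^-1 * (rho y)^-1 ^+ m).
  apply: (is_derive_eqF (is_deriveMF (is_derive_rhoV x i) IH)).
  by rewrite -exprVn !exprS -natr1; ring.
by apply/funext => y; rewrite exprS.
Qed.

Lemma sum_yxK x j : \sum_i y_ x i * K i j = - x 0 j.
Proof. exact: sum_yK. Qed.

(** The metric is Kaehler, so that its Laplacian has no first order term in
    holomorphic coordinates. *)
Lemma laplace_beltramiE f : Ck_on setT 2 f -> laplace_beltrami g f = FSlap f.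
Proof.
move=> Cf; apply/funext => x; rewrite /laplace_beltrami.
pose A i j (y : 'rV[R]_N) : R := d_ i j + y 0 i * y 0 j + y_ y i * y_ y j.
pose c0 : R := 2 ^+ n / 2.
have fE i : (fun y => vol_density g y * \sum_j ginv g i j y * partial j f y) =
    fun y => c0 * \sum_j (rho y)^-1 ^+ n * A i j y * partial j f y.
  apply/funext => y; rewrite vol_densityE !mulr_sumr; apply: eq_bigr => j _.
  rewrite ginvE FSinvE /A /c0 exprS invfM -exprVn.
  have := rho_neq0 y => ?.
  by move: (_^-1 ^+ n) (y_ y i) (y_ y j) (partial j f y) => *; field.
have dA i j k : is_derive x (e_ k) (A i j)
    (d_ k i * x 0 j + x 0 i * d_ k j + K k i * y_ x j + y_ x i * K k j).
  apply: (is_derive_eqF (is_deriveDF (is_deriveDF (is_derive_cstF _ _ _)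
    (is_deriveMF (is_derive_x x k i) (is_derive_x x k j)))
    (is_deriveMF (is_derive_y x k i) (is_derive_y x k j)))).
  by ring.
have df j i : is_derive x (e_ i) (partial j f) (partial i (partial j f) x).
  exact: (Ck_on_is_derive i (Ck_on_partial j Cf)).
under eq_bigr => i _.
  rewrite fE.
  rewrite (is_partial (is_deriveMF (is_derive_cstF _ _ c0) (is_derive_sumF
    (fun j => is_deriveMF (is_deriveMF (is_derive_rhoVX x i n) (dA i j i)) (df j i))))).
  rewrite mul0r add0r.
  over.
rewrite -mulr_sumr vol_densityE /FSlap.
have -> : \sum_i \sum_j ((- (2 * n%:R * x 0 i) * (rho x)^-1 ^+ n.+1 * A i j x +
     (rho x)^-1 ^+ n * (d_ i i * x 0 j + x 0 i * d_ i j + K i i * y_ x j +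
       y_ x i * K i j)) * partial j f x +
     (rho x)^-1 ^+ n * A i j x * partial i (partial j f) x) =
   (rho x)^-1 ^+ n * (\sum_i \sum_j A i j x * partial i (partial j f) x)
   + \sum_j (\sum_i (- (2 * n%:R * x 0 i) * (rho x)^-1 ^+ n.+1 * A i j x +
     (rho x)^-1 ^+ n * (d_ i i * x 0 j + x 0 i * d_ i j + K i i * y_ x j +
       y_ x i * K i j))) * partial j f x.
  rewrite mulr_sumr.
  under [X in _ + X]eq_bigr do rewrite mulr_suml.
  rewrite [X in _ + X]exchange_big/= -big_split/=; apply: eq_bigr => i _.
  rewrite mulr_sumr -big_split/=; apply: eq_bigr => j _.
  by rewrite addrC mulrA.
(* What remains are the first order terms, which cancel. *)
rewrite [X in _ * (_ * (_ + X))]big1 ?addr0; last first.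
  move=> j _.
  have -> : \sum_i (- (2 * n%:R * x 0 i) * (rho x)^-1 ^+ n.+1 * A i j x +
     (rho x)^-1 ^+ n * (d_ i i * x 0 j + x 0 i * d_ i j + K i i * y_ x j +
       y_ x i * K i j)) =
    - (2 * n%:R) * (rho x)^-1 ^+ n.+1 * ((\sum_i d_ i j * x 0 i)
      + (\sum_i x 0 i * x 0 i) * x 0 j + (\sum_i x 0 i * y_ x i) * y_ x j)
    + (rho x)^-1 ^+ n * ((\sum_(i < N) d_ i i) * x 0 j + (\sum_i d_ i j * x 0 i)
      + (\sum_i K i i) * y_ x j + \sum_i y_ x i * K i j).
    rewrite !mulr_suml -!big_split/= !mulr_sumr -big_split/=.
    by apply: eq_bigr => i _; rewrite /A; ring.
  rewrite !sum_dr sum_xx sum_xy sum_dd trace_K sum_yxK exprS.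
  have := rho_neq0 x => ?.
  by move: (_^-1 ^+ n) => *; field.
have := rho_neq0 x => ?; have : rho x ^+ n != 0 by rewrite expf_neq0.
have : (2 : R) ^+ n != 0 by rewrite expf_neq0 // pnatr_eq0.
rewrite /c0 exprS exprVn; move: (rho x ^+ n) (2 ^+ n) (\sum_i _) => *.
by field; do ?[apply/andP; split].
Qed.

Lemma trace_inv_Gam k x : \sum_i \sum_j FSinv x i j * Gam k i j x = 0.
Proof.
under eq_bigr => i _.
  rewrite sum_FSinv !sum_Gam_low sum_xx sum_yy sum_xy sum_yx -rotateE sum_yK.
  over.
have -> : \sum_i rho x / 2 * (Gam k i i x +
     x 0 i * (- (rho x)^-1 * (d_ k i * (rho x - 1) + x 0 k * x 0 i
       + K i k * 0 + y_ x k * y_ x i)) +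
     y_ x i * (- (rho x)^-1 * (d_ k i * 0 + y_ x k * x 0 i
       + K i k * (rho x - 1) + - x 0 k * y_ x i))) =
  - 2^-1 * (2 * (\sum_i d_ k i * x 0 i) + 2 * (\sum_i y_ x i * K i k)
     + (rho x - 1) * (\sum_i d_ k i * x 0 i) + x 0 k * (\sum_i x 0 i * x 0 i)
     + y_ x k * (\sum_i x 0 i * y_ x i)
     + y_ x k * (\sum_i x 0 i * y_ x i)
     + (rho x - 1) * (\sum_i y_ x i * K i k) - x 0 k * (\sum_i y_ x i * y_ x i)).
  rewrite !mulr_sumr -!sumrN -!big_split/= mulr_sumr; apply: eq_bigr => i _.
  rewrite /Gam; have := rho_neq0 x => ?.
  by move: (K i k) (y_ x i) (y_ x k) (d_ k i) => *; field.
rewrite sum_dl sum_yK sum_xx sum_xy sum_yy; ring.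
Qed.

Lemma ricci_dot_hessianE f : ricci_dot_hessian g f = fun x => (n%:R + 1) * FSlap f x.
Proof.
apply/funext => x; rewrite /ricci_dot_hessian.
have E k l : \sum_i \sum_j ginv g i k x * ginv g j l x * ricci g i j x =
    (n%:R + 1) * FSinv x k l.
  under eq_bigr => i _.
    under eq_bigr => j _.
      rewrite !ginvE ricciE (_ : _ * _ = (n%:R + 1) * FSinv x i k *
        (FSmx x i j * FSinv x j l)); last by ring.
      over.
    rewrite -mulr_sumr.
    have -> : \sum_j FSmx x i j * FSinv x j l = d_ i l.
      by have /matrixP/(_ i l) := mulmx1C (FSinvK x); rewrite !mxE.
    rewrite mulrC.
    over.
  by rewrite sum_dr !FSinvE eq_sym; ring.
transitivity (\sum_k \sum_l (n%:R + 1) * FSinv x k l * hessian g f k l x).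
  under eq_bigr do rewrite exchange_big/=.
  rewrite exchange_big/=; apply: eq_bigr => k _.
  under eq_bigr do rewrite exchange_big/=.
  rewrite exchange_big/=; apply: eq_bigr => l _.
  by rewrite -E mulr_suml; apply: eq_bigr => i _; rewrite mulr_suml.
transitivity ((n%:R + 1) * ((\sum_k \sum_l FSinv x k l * partial k (partial l f) x) -
   \sum_m (\sum_k \sum_l FSinv x k l * Gam m k l x) * partial m f x)).
  under [X in _ - X]eq_bigr do rewrite mulr_suml.
  rewrite [X in _ - X]exchange_big/= -sumrB mulr_sumr; apply: eq_bigr => k _.
  under [X in _ - X]eq_bigr do rewrite mulr_suml.
  rewrite [X in _ - X]exchange_big/= -sumrB mulr_sumr; apply: eq_bigr => l _.
  rewrite /hessian -mulrA mulrBr mulr_sumr; congr (_ * (_ - _)).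
  by apply: eq_bigr => m _; rewrite christoffelE mulrA.
rewrite [X in _ - X]big1 ?subr0; last by move=> m _; rewrite trace_inv_Gam mul0r.
rewrite /FSlap; congr (_ * _); rewrite mulr_sumr; apply: eq_bigr => k _.
by rewrite mulr_sumr; apply: eq_bigr => l _; rewrite FSinvE mulrA.
Qed.

Lemma smooth_on_FSlap f : smooth_on setT f -> smooth_on setT (FSlap f).
Proof.
move=> Cf; have oT := @openT 'rV[R]_N.
have cc j := @smooth_on_coord R N setT j oT.
have cy j : smooth_on setT (fun x => y_ x j).
  rewrite (_ : (fun x => _) = fun x : 'rV[R]_N => \sum_k x 0 k * K k j).
    by apply: smooth_on_sum => // k; apply: smooth_onM => //; exact: smooth_on_cst.
  by apply/funext => x; rewrite rotateE.
apply: smooth_onM => //; last first.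
  apply: smooth_on_sum => // i; apply: smooth_on_sum => // j.
  apply: smooth_onM => //; last by do 2 apply: smooth_on_partial.
  apply: smooth_onD => //; last exact: smooth_onM.
  by apply: smooth_onD => //; [exact: smooth_on_cst|exact: smooth_onM].
apply: smooth_onM => //; last exact: smooth_on_cst.
apply: smooth_onD => //; first exact: smooth_on_cst.
by apply: smooth_on_sum => // k; exact: smooth_onM.
Qed.

Lemma LLE f x : smooth_on setT f ->
  LL g f x = - 2^-1 * FSlap (FSlap f) x - (n%:R + 1) * FSlap f x.
Proof.
move=> Cf; rewrite /LL ricci_dot_hessianE (laplace_beltramiE (Cf 2%N)).
by rewrite (laplace_beltramiE (smooth_on_FSlap Cf 2%N)).
Qed.

End FubiniStudyCurvature.

(** * The Laplacian on R^N and holomorphic changes of variables *)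

Section Laplacian.
Variables (R : realType) (N : nat).
Implicit Types (f g : 'rV[R]_N -> R) (x : 'rV[R]_N) (U : set 'rV[R]_N).
Local Notation e_ i := (delta_mx 0 i : 'rV[R]_N).

Definition lap f x : R := \sum_k partial k (partial k f) x.

Lemma partial_cst (c : R) k : partial k (fun=> c) = (fun=> 0) :> ('rV[R]_N -> R).
Proof. by apply/funext => y; apply: is_partial; exact: is_derive_cstF. Qed.

Lemma partial_coord j k :
  partial k (fun x => x 0 j) = (fun=> (j == k)%:R) :> ('rV[R]_N -> R).
Proof.
apply/funext => y; apply: is_partial.
by apply: (is_derive_eqF (is_derive_coord _ _ _)); rewrite mxE eqxx.
Qed.

Lemma lap_cst (c : R) x : lap (fun=> c) x = 0.
Proof. by rewrite /lap big1 // => k _; rewrite !partial_cst. Qed.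

Lemma lap_coord j x : lap (fun x => x 0 j) x = 0.
Proof. by rewrite /lap big1 // => k _; rewrite partial_coord partial_cst. Qed.

Lemma smooth_on_lap U f : open U -> smooth_on U f -> smooth_on U (lap f).
Proof.
by move=> oU Cf; apply: smooth_on_sum => // k; do 2 apply: smooth_on_partial.
Qed.

Lemma lap_eq_on U f g : open U -> (forall y, U y -> f y = g y) ->
  forall x, U x -> lap f x = lap g x.
Proof.
move=> oU fg x Ux; apply: eq_bigr => k _.
exact: (partial_eq_on k oU (partial_eq_on k oU fg)).
Qed.

Lemma partialD U f g i x : smooth_on U f -> smooth_on U g -> U x ->
  partial i (fun y => f y + g y) x = partial i f x + partial i g x.
Proof.
move=> Cf Cg Ux; apply: is_partial.
exact: (is_deriveDF (smooth_on_is_derive i Cf Ux) (smooth_on_is_derive i Cg Ux)).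
Qed.

Lemma partialZ U (a : R) f i x : smooth_on U f -> U x ->
  partial i (fun y => a * f y) x = a * partial i f x.
Proof.
move=> Cf Ux; apply: is_partial.
apply: (is_derive_eqF (is_deriveMF (is_derive_cstF _ _ a)
  (smooth_on_is_derive i Cf Ux))).
by rewrite mul0r add0r.
Qed.

Lemma lapD U f g x : open U -> smooth_on U f -> smooth_on U g -> U x ->
  lap (fun y => f y + g y) x = lap f x + lap g x.
Proof.
move=> oU Cf Cg Ux; rewrite /lap -big_split/=; apply: eq_bigr => k _.
rewrite -(partialD k (smooth_on_partial k Cf) (smooth_on_partial k Cg) Ux).
exact: (partial_eq_on k oU (fun y Uy => partialD k Cf Cg Uy) Ux).
Qed.

Lemma lapZ U (a : R) f x : open U -> smooth_on U f -> U x ->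
  lap (fun y => a * f y) x = a * lap f x.
Proof.
move=> oU Cf Ux; rewrite /lap mulr_sumr; apply: eq_bigr => k _.
rewrite -(partialZ a k (smooth_on_partial k Cf) Ux).
exact: (partial_eq_on k oU (fun y Uy => partialZ a k Cf Uy) Ux).
Qed.

Lemma lapM U f g x : open U -> smooth_on U f -> smooth_on U g -> U x ->
  lap (fun y => f y * g y) x = f x * lap g x + g x * lap f x
    + 2 * \sum_k partial k f x * partial k g x.
Proof.
move=> oU Cf Cg Ux; rewrite /lap !mulr_sumr -!big_split/=; apply: eq_bigr => k _.
rewrite (partial_eq_on k oU
  (g := fun y => partial k f y * g y + f y * partial k g y)) //; last first.
  move=> y Uy; apply: is_partial.
  exact: (is_deriveMF (smooth_on_is_derive k Cf Uy) (smooth_on_is_derive k Cg Uy)).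
have dk h (Ch : smooth_on U h) := smooth_on_is_derive k Ch Ux.
rewrite (is_partial (is_deriveDF
  (is_deriveMF (dk _ (smooth_on_partial k Cf)) (dk _ Cg))
  (is_deriveMF (dk _ Cf) (dk _ (smooth_on_partial k Cg))))).
move: (partial k _ x) (partial k _ x) => a b.
move: (partial k (partial k f) x) => c; move: (partial k f x) => d.
by ring.
Qed.

Lemma partial_lap U f i x : open U -> smooth_on U f -> U x ->
  partial i (lap f) x = lap (partial i f) x.
Proof.
move=> oU Cf Ux; apply: is_partial.
have Cff k := smooth_on_partial k (smooth_on_partial k Cf).
have -> : lap (partial i f) x = \sum_k partial i (partial k (partial k f)) x.
  apply: eq_bigr => k _.
  rewrite (partialC i k oU (smooth_on_partial k Cf 2%N) Ux).
  exact: (partial_eq_on k oU (fun y Uy => partialC k i oU (Cf 2%N) Uy) Ux).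
by apply: is_derive_sumF => k; exact: (smooth_on_is_derive i (Cff k) Ux).
Qed.

End Laplacian.

Section LaplacianComposition.
Variables (R : realType) (N M : nat) (U : set 'rV[R]_N).
Variable phi : 'rV[R]_N -> 'rV[R]_M.
Hypothesis oU : open U.
Hypothesis Cphi : forall j, smooth_on U (fun x => phi x 0 j).

Lemma smooth_on_comp (f : 'rV[R]_M -> R) :
  smooth_on setT f -> smooth_on U (fun x => f (phi x)).
Proof.
move=> Cf k; apply: (@Ck_on_comp _ _ _ U setT phi) => //; first exact: openT.
by move=> j; exact: Cphi.
Qed.

Lemma partial_comp (f : 'rV[R]_M -> R) k x : smooth_on setT f -> U x ->
  partial k (fun y => f (phi y)) x =
  \sum_a partial a f (phi x) * partial k (fun y => phi y 0 a) x.
Proof.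
move=> Cf Ux; apply: is_partial.
apply: (@is_derive_comp_rV _ _ _ U setT phi) => //; first exact: openT.
by move=> j; exact: smooth_on_is_derive (Cphi j) Ux.
Qed.

Lemma lap_comp (f : 'rV[R]_M -> R) x : smooth_on setT f -> U x ->
  lap (fun y => f (phi y)) x =
  \sum_a \sum_b (\sum_k partial k (fun y => phi y 0 a) x
                       * partial k (fun y => phi y 0 b) x)
         * partial a (partial b f) (phi x)
  + \sum_b lap (fun y => phi y 0 b) x * partial b f (phi x).
Proof.
move=> Cf Ux.
have E k : partial k (partial k (fun y => f (phi y))) x =
  \sum_b ((\sum_a partial a (partial b f) (phi x) * partial k (fun y => phi y 0 a) x)
          * partial k (fun y => phi y 0 b) x
          + partial b f (phi x) * partial k (partial k (fun y => phi y 0 b)) x).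
  rewrite (partial_eq_on k oU (fun y Uy => partial_comp k Cf Uy) Ux).
  apply: is_partial; apply: is_derive_sumF => b.
  have Cb := smooth_on_partial b Cf.
  have H := smooth_on_is_derive k (smooth_on_comp Cb) Ux.
  have H2 := smooth_on_is_derive k (smooth_on_partial k (Cphi b)) Ux.
  by apply: (is_derive_eqF (is_deriveMF H H2)); rewrite partial_comp.
rewrite {1}/lap (eq_bigr _ (fun k _ => E k)).
under eq_bigr do rewrite big_split/=.
rewrite big_split/=; congr (_ + _); last first.
  rewrite exchange_big/=; apply: eq_bigr => b _.
  by rewrite mulr_suml; apply: eq_bigr => k _; rewrite mulrC.
rewrite exchange_big/= [RHS]exchange_big/=; apply: eq_bigr => b _.
under eq_bigr do rewrite mulr_suml.
rewrite exchange_big/=; apply: eq_bigr => a _.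
rewrite mulr_suml; apply: eq_bigr => k _.
by rewrite -mulrA mulrC.
Qed.

End LaplacianComposition.

(** * Homogeneous coordinates *)

Section HomogeneousCoordinates.
Variables (R : realType) (n : nat).
Local Notation Pn := (projective_space R n).
Local Notation M := (n.+1 + n.+1)%N.
Local Open Scope complex_scope.
Implicit Types (Z W : 'rV[R]_M) (i k l : 'I_n.+1) (j : 'I_n) (x : 'rV[R]_(n + n)).

(** Vectors of $C^{n+1}$ are real row vectors of size $2n+2$, real parts first, so
    that real differential calculus applies to them. *)
Definition zre Z k : R := Z 0 (lshift n.+1 k).
Definition zim Z k : R := Z 0 (rshift n.+1 k).
Definition cvec Z : 'rV[R[i]]_n.+1 := to_complex Z.
(** The point $[Z]$ of projective space; the default value serves $Z = 0$. *)
Definition class Z : Pn := insubd (affine_chart ord0 0 : Pn) <[cvec Z]>%VS.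

Lemma cvecE Z k : cvec Z 0 k = zre Z k +i* zim Z k.
Proof. by rewrite mxE. Qed.

Lemma rV_reim_eq Z W : (forall k, zre Z k = zre W k) ->
  (forall k, zim Z k = zim W k) -> Z = W.
Proof.
move=> H1 H2; apply/rowP => k.
by case: (split_ordP k) => l ->; [exact: H1|exact: H2].
Qed.

Lemma zre0 k : zre 0 k = 0. Proof. by rewrite /zre mxE. Qed.
Lemma zim0 k : zim 0 k = 0. Proof. by rewrite /zim mxE. Qed.

Lemma cvec_neq0 Z : Z != 0 -> cvec Z != 0.
Proof.
apply: contra => /eqP/rowP Z0; apply/eqP; apply: rV_reim_eq => k.
  by have := Z0 k; rewrite cvecE mxE zre0 => -[].
by have := Z0 k; rewrite cvecE mxE zim0 => -[].
Qed.

Lemma val_class Z : Z != 0 -> \val (class Z) = <[cvec Z]>%VS.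
Proof.
move=> Z0; rewrite /class insubdK //.
by rewrite unfold_in dim_vline cvec_neq0.
Qed.

Lemma vlineZ (v : 'rV[R[i]]_n.+1) (c : R[i]) : c != 0 -> <[c *: v]>%VS = <[v]>%VS.
Proof.
move=> c0; apply/eqP; rewrite eqEsubv; apply/andP; split.
  by apply/vlineP; exists c.
by apply/vlineP; exists c^-1; rewrite scalerA mulVf // scale1r.
Qed.

Lemma class_scale Z W (c : R[i]) :
  c != 0 -> cvec Z = c *: cvec W -> class Z = class W.
Proof. by move=> c0 E; rewrite /class E vlineZ. Qed.

Lemma class_surj (p : Pn) : exists2 Z, Z != 0 & p = class Z.
Proof.
case: p => L dL.
have v0 : vpick L != 0 by rewrite vpick0 -dimv_eq0 (eqP dL).
have LE : L = <[vpick L]>%VS.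
  apply/eqP; rewrite eq_sym eqEdim dim_vline v0 (eqP dL) andbT.
  exact: memv_pick.
pose Z : 'rV[R]_M := \row_k match fintype.split k with
  | inl l => complex.Re (vpick L 0 l) | inr l => complex.Im (vpick L 0 l) end.
have ZE : cvec Z = vpick L.
  apply/rowP => k; rewrite cvecE /zre /zim !mxE.
  rewrite (unsplitK (inl k)) (unsplitK (inr k)).
  by case: (vpick L 0 k).
have Z0 : Z != 0.
  apply: contra v0 => /eqP Z0; rewrite -ZE Z0; apply/eqP/rowP => k.
  by rewrite cvecE zre0 zim0 mxE.
by exists Z => //; apply: val_inj; rewrite val_class // ZE.
Qed.

Lemma lift_class_eq (f g : Pn -> R) :
  (forall Z, Z != 0 -> f (class Z) = g (class Z)) -> forall p, f p = g p.
Proof. by move=> H p; have [Z Z0 ->] := class_surj p; exact: H. Qed.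

(** Homogeneous coordinates, in real form, of the point of an affine chart. *)
Definition hom i x : 'rV[R]_M := \row_k match fintype.split k with
  | inl l => if unlift i l is Some j then x 0 (lshift n j) else 1
  | inr l => if unlift i l is Some j then x 0 (rshift n j) else 0 end.

Lemma zre_hom i x l :
  zre (hom i x) l = if unlift i l is Some j then x 0 (lshift n j) else 1.
Proof. by rewrite /zre mxE (unsplitK (inl l)). Qed.

Lemma zim_hom i x l :
  zim (hom i x) l = if unlift i l is Some j then x 0 (rshift n j) else 0.
Proof. by rewrite /zim mxE (unsplitK (inr l)). Qed.

Lemma cvec_hom i x : cvec (hom i x) = homogeneous_coord i x.
Proof.
apply/rowP => k; rewrite cvecE zre_hom zim_hom !mxE.
by case: (unlift i k) => [j|//]; rewrite mxE.
Qed.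

Lemma hom_neq0 i x : hom i x != 0.
Proof.
apply/eqP => H; have := zre_hom i x i; rewrite H zre0 unlift_none.
by move=> /esym/eqP; rewrite oner_eq0.
Qed.

Lemma affine_chartE i x : affine_chart i x = class (hom i x).
Proof. by apply: val_inj; rewrite val_class ?hom_neq0 // cvec_hom. Qed.

Definition zabs2 i Z : R := zre Z i ^+ 2 + zim Z i ^+ 2.
Definition norm2 (N : nat) (Z : 'rV[R]_N) : R := \sum_k Z 0 k ^+ 2.

(** The affine coordinates $Z_j/Z_i$ of $[Z]$. *)
Definition aff i Z : 'rV[R]_(n + n) := \row_k match fintype.split k with
  | inl j => (zre Z i * zre Z (lift i j) + zim Z i * zim Z (lift i j)) / zabs2 i Z
  | inr j => (zre Z i * zim Z (lift i j) - zim Z i * zre Z (lift i j)) / zabs2 i Z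
  end.

Lemma aff_re i Z j : aff i Z 0 (lshift n j) =
  (zre Z i * zre Z (lift i j) + zim Z i * zim Z (lift i j)) / zabs2 i Z.
Proof. by rewrite mxE (unsplitK (inl j)). Qed.

Lemma aff_im i Z j : aff i Z 0 (rshift n j) =
  (zre Z i * zim Z (lift i j) - zim Z i * zre Z (lift i j)) / zabs2 i Z.
Proof. by rewrite mxE (unsplitK (inr j)). Qed.

Lemma norm2E Z : norm2 Z = \sum_k zabs2 k Z.
Proof. by rewrite /norm2 big_split_ord/= -big_split. Qed.

Lemma norm2_ge0 (N : nat) (Z : 'rV[R]_N) : 0 <= norm2 Z.
Proof. by rewrite sumr_ge0 // => k _; exact: sqr_ge0. Qed.

Lemma norm2_eq0 (N : nat) (Z : 'rV[R]_N) : (norm2 Z == 0) = (Z == 0).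
Proof.
apply/idP/eqP => [|->]; last first.
  by apply/eqP; rewrite /norm2 big1 // => k _; rewrite mxE expr0n.
rewrite psumr_eq0 => [/allP H|k _]; last exact: sqr_ge0.
apply/rowP => k; have := H k (mem_index_enum k).
by rewrite sqrf_eq0 mxE => /eqP.
Qed.

Lemma norm2_gt0 (N : nat) (Z : 'rV[R]_N) : (0 < norm2 Z) = (Z != 0).
Proof. by rewrite lt_def norm2_eq0 norm2_ge0 andbT. Qed.

Lemma ex_zabs2 Z : Z != 0 -> exists i, zabs2 i Z != 0.
Proof.
move=> Z0; apply/existsP; move: Z0; apply: contraR.
rewrite negb_exists => /forallP H; rewrite -norm2_eq0 norm2E.
by apply/eqP; rewrite big1 // => i _; apply/eqP; have := H i; rewrite negbK.
Qed.

Lemma zabs2_neq0 i Z : zabs2 i Z != 0 -> Z != 0.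
Proof.
apply: contra => /eqP ->.
by rewrite /zabs2 zre0 zim0 expr0n addr0.
Qed.

Lemma class_aff i Z : zabs2 i Z != 0 -> class Z = affine_chart i (aff i Z).
Proof.
move=> Zi; rewrite affine_chartE.
apply: (@class_scale _ _ (zre Z i +i* zim Z i)).
  apply: contra Zi; rewrite eq_complex/= => /andP[/eqP Z1 /eqP Z2].
  by rewrite /zabs2 Z1 Z2 expr0n addr0.
apply/rowP => k; rewrite cvecE [RHS]mxE cvecE zre_hom zim_hom.
apply/eqP; rewrite eq_complex/=; move: Zi; rewrite /zabs2 => Zi.
case: unliftP => [j ->|->]; last by apply/andP; split; apply/eqP; ring.
rewrite aff_re aff_im /zabs2.
by apply/andP; split; apply/eqP; field.
Qed.

Lemma zabs2_hom i x : zabs2 i (hom i x) = 1.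
Proof. by rewrite /zabs2 zre_hom zim_hom unlift_none expr1n expr0n addr0. Qed.

Lemma aff_hom i x : aff i (hom i x) = x.
Proof.
apply/rowP => k; case: (split_ordP k) => j ->.
  by rewrite aff_re zabs2_hom !zre_hom !zim_hom liftK unlift_none; field.
by rewrite aff_im zabs2_hom !zre_hom !zim_hom liftK unlift_none; field.
Qed.

Lemma norm2_aff i Z : zabs2 i Z != 0 ->
  norm2 Z = zabs2 i Z * rho (aff i Z).
Proof.
move=> Zi; rewrite norm2E (bigD1_ord i)//= /rho mulrDr mulr1; congr (_ + _).
rewrite big_split_ord/= -big_split/= mulr_sumr; apply: eq_bigr => j _.
by rewrite aff_re aff_im; move: Zi; rewrite /zabs2 => Zi; field.
Qed.

(** Multiplication by $\sqrt{-1}$, which together with the real scalars accounts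
    for the invariance used below. *)
Definition rot90 Z : 'rV[R]_M := \row_k match fintype.split k with
  | inl l => - zim Z l | inr l => zre Z l end.

Lemma zre_rot90 Z k : zre (rot90 Z) k = - zim Z k.
Proof. by rewrite /zre mxE (unsplitK (inl k)). Qed.

Lemma zim_rot90 Z k : zim (rot90 Z) k = zre Z k.
Proof. by rewrite /zim mxE (unsplitK (inr k)). Qed.

Lemma class_rot90 Z : class (rot90 Z) = class Z.
Proof.
apply: (@class_scale _ _ 'i); first by rewrite eq_complex/= oner_eq0 andbF.
apply/rowP => k; rewrite cvecE [RHS]mxE cvecE zre_rot90 zim_rot90.
by apply/eqP; rewrite eq_complex/=; apply/andP; split; apply/eqP; ring.
Qed.

Lemma class_scaleR Z (t : R) : t != 0 -> class (t *: Z) = class Z.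
Proof.
move=> t0; apply: (@class_scale _ _ t%:C).
  by rewrite eq_complex/= negb_and t0.
apply/rowP => k; rewrite cvecE [RHS]mxE cvecE /zre /zim !mxE.
by apply/eqP; rewrite eq_complex/=; apply/andP; split; apply/eqP; ring.
Qed.

End HomogeneousCoordinates.

(** * Lifting functions from projective space to R^(2n+2) *)

Section ChartLaplacian.
Variables (R : realType) (n : nat) (i : 'I_n.+1).
Local Notation M := (n.+1 + n.+1)%N.
Implicit Types (Z : 'rV[R]_M) (k : 'I_M) (m : 'I_n.+1) (j l : 'I_n).
Local Notation e_ k := (delta_mx 0 k : 'rV[R]_M).
Local Notation u_ Z j := (aff i Z 0 (lshift n j)).
Local Notation v_ Z j := (aff i Z 0 (rshift n j)).
Local Notation s_ Z := (zre Z i).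
Local Notation t_ Z := (zim Z i).

Definition chart_dom : set 'rV[R]_M := [set Z | zabs2 i Z != 0].

Lemma smooth_zre (U : set 'rV[R]_M) m :
  open U -> smooth_on U (fun Z => zre Z m).
Proof. exact: smooth_on_coord. Qed.

Lemma smooth_zim (U : set 'rV[R]_M) m :
  open U -> smooth_on U (fun Z => zim Z m).
Proof. exact: smooth_on_coord. Qed.

Lemma smooth_zabs2 (U : set 'rV[R]_M) m :
  open U -> smooth_on U (zabs2 m : 'rV[R]_M -> R).
Proof.
move=> oU; apply: smooth_onD => //; rewrite /= /zabs2.
  under eq_fun do rewrite expr2.
  by apply: smooth_onM => //; exact: smooth_zre.
under eq_fun do rewrite expr2.
by apply: smooth_onM => //; exact: smooth_zim.
Qed.

Lemma open_chart_dom : open chart_dom.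
Proof.
have c : continuous (zabs2 i : 'rV[R]_M -> R).
  by move=> Z; exact: (smooth_on_continuous (smooth_zabs2 i openT) I).
rewrite (_ : chart_dom = zabs2 i @^-1` [set r | r != 0]) //.
by apply: open_comp => // Z _; exact: c.
Qed.

Lemma smooth_aff a : smooth_on chart_dom (fun Z => aff i Z 0 a).
Proof.
have oU := open_chart_dom.
have sV : smooth_on chart_dom (fun Z => (zabs2 i Z)^-1).
  by apply: smooth_onV => //; exact: smooth_zabs2.
have sr m := smooth_zre m oU; have si m := smooth_zim m oU.
case: (split_ordP a) => j ->.
  under eq_fun do rewrite aff_re.
  by apply: smooth_onM => //; apply: smooth_onD => //; exact: smooth_onM.
under eq_fun do rewrite aff_im.
by apply: smooth_onM => //; apply: smooth_onB => //; exact: smooth_onM.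
Qed.

Lemma is_derive_zre Z k m :
  is_derive Z (e_ k) (fun Z => zre Z m) (k == lshift n.+1 m)%:R.
Proof.
by apply: (is_derive_eqF (is_derive_coord _ _ _)); rewrite mxE eqxx eq_sym.
Qed.

Lemma is_derive_zim Z k m :
  is_derive Z (e_ k) (fun Z => zim Z m) (k == rshift n.+1 m)%:R.
Proof.
by apply: (is_derive_eqF (is_derive_coord _ _ _)); rewrite mxE eqxx eq_sym.
Qed.

Lemma is_derive_zabs2 Z k : is_derive Z (e_ k) (zabs2 i)
  (2 * s_ Z * (k == lshift n.+1 i)%:R + 2 * t_ Z * (k == rshift n.+1 i)%:R).
Proof.
rewrite (_ : zabs2 i = fun Z => s_ Z * s_ Z + t_ Z * t_ Z); last first.
  by apply/funext => W; rewrite /zabs2 !expr2.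
apply: (is_derive_eqF (is_deriveDF
  (is_deriveMF (is_derive_zre Z k i) (is_derive_zre Z k i))
  (is_deriveMF (is_derive_zim Z k i) (is_derive_zim Z k i)))).
by ring.
Qed.

Lemma is_derive_aff_re Z k j : chart_dom Z ->
  is_derive Z (e_ k) (fun Z => u_ Z j)
  ((s_ Z * (k == lshift n.+1 (lift i j))%:R + t_ Z * (k == rshift n.+1 (lift i j))%:R
   - (s_ Z * u_ Z j + t_ Z * v_ Z j) * (k == lshift n.+1 i)%:R
   + (s_ Z * v_ Z j - t_ Z * u_ Z j) * (k == rshift n.+1 i)%:R) / zabs2 i Z).
Proof.
move=> Zi; rewrite (_ : (fun Z => _) = fun Z =>
   (s_ Z * zre Z (lift i j) + t_ Z * zim Z (lift i j)) * (zabs2 i Z)^-1); last first.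
  by apply/funext => W; rewrite aff_re.
apply: (is_derive_eqF (is_deriveMF (is_deriveDF
  (is_deriveMF (is_derive_zre Z k i) (is_derive_zre Z k (lift i j)))
  (is_deriveMF (is_derive_zim Z k i) (is_derive_zim Z k (lift i j))))
  (is_deriveVF Zi (is_derive_zabs2 Z k)))).
move: Zi; rewrite /chart_dom/= aff_re aff_im /zabs2.
move: (k == _)%:R (k == _)%:R (k == _)%:R (k == _)%:R => a b c d.
by move: (zre Z _) (zre Z _) (zim Z _) (zim Z _) => A B C D ?; field.
Qed.

Lemma is_derive_aff_im Z k j : chart_dom Z ->
  is_derive Z (e_ k) (fun Z => v_ Z j)
  ((s_ Z * (k == rshift n.+1 (lift i j))%:R - t_ Z * (k == lshift n.+1 (lift i j))%:R
   - (s_ Z * v_ Z j - t_ Z * u_ Z j) * (k == lshift n.+1 i)%:R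
   - (s_ Z * u_ Z j + t_ Z * v_ Z j) * (k == rshift n.+1 i)%:R) / zabs2 i Z).
Proof.
move=> Zi; rewrite (_ : (fun Z => _) = fun Z =>
   (s_ Z * zim Z (lift i j) - t_ Z * zre Z (lift i j)) * (zabs2 i Z)^-1); last first.
  by apply/funext => W; rewrite aff_im.
apply: (is_derive_eqF (is_deriveMF (is_deriveBF
  (is_deriveMF (is_derive_zre Z k i) (is_derive_zim Z k (lift i j)))
  (is_deriveMF (is_derive_zim Z k i) (is_derive_zre Z k (lift i j))))
  (is_deriveVF Zi (is_derive_zabs2 Z k)))).
move: Zi; rewrite /chart_dom/= aff_re aff_im /zabs2.
move: (k == _)%:R (k == _)%:R (k == _)%:R (k == _)%:R => a b c d.
by move: (zre Z _) (zre Z _) (zim Z _) (zim Z _) => A B C D ?; field.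
Qed.

(** The complex derivative of the $j$-th affine coordinate in the $m$-th
    homogeneous coordinate is [grad_re - i grad_im]; the four lemmas below are
    the Cauchy-Riemann equations. *)
Definition grad_re Z j m : R := (s_ Z * (m == lift i j)%:R
  - (s_ Z * u_ Z j + t_ Z * v_ Z j) * (m == i)%:R) / zabs2 i Z.
Definition grad_im Z j m : R := (t_ Z * (m == lift i j)%:R
  + (s_ Z * v_ Z j - t_ Z * u_ Z j) * (m == i)%:R) / zabs2 i Z.

Lemma partial_re_aff_re Z j m : chart_dom Z ->
  partial (lshift n.+1 m) (fun Z => u_ Z j) Z = grad_re Z j m.
Proof.
move=> Zi; rewrite (is_partial (is_derive_aff_re _ _ Zi)) !eq_lshift !eq_lrshift.
by rewrite !mulr0 !addr0.
Qed.

Lemma partial_im_aff_re Z j m : chart_dom Z ->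
  partial (rshift n.+1 m) (fun Z => u_ Z j) Z = grad_im Z j m.
Proof.
move=> Zi; rewrite (is_partial (is_derive_aff_re _ _ Zi)) !eq_rshift !eq_rlshift.
by rewrite !mulr0 !add0r subr0.
Qed.

Lemma partial_re_aff_im Z j m : chart_dom Z ->
  partial (lshift n.+1 m) (fun Z => v_ Z j) Z = - grad_im Z j m.
Proof.
move=> Zi; rewrite (is_partial (is_derive_aff_im _ _ Zi)) !eq_lshift !eq_lrshift.
by rewrite !mulr0 /grad_im; ring.
Qed.

Lemma partial_im_aff_im Z j m : chart_dom Z ->
  partial (rshift n.+1 m) (fun Z => v_ Z j) Z = grad_re Z j m.
Proof.
move=> Zi; rewrite (is_partial (is_derive_aff_im _ _ Zi)) !eq_rshift !eq_rlshift.
by rewrite !mulr0 /grad_re; ring.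
Qed.

(** By the Cauchy-Riemann equations and the symmetry of second derivatives. *)
Lemma lap_aff Z a : chart_dom Z -> lap (fun Z => aff i Z 0 a) Z = 0.
Proof.
move=> Zi; have oU := open_chart_dom.
rewrite /lap big_split_ord/= -big_split/= big1 // => m _.
case: (split_ordP a) => j ->.
  rewrite (partial_eq_on (lshift n.+1 m) oU
    (g := fun Z => partial (rshift n.+1 m) (fun Z => v_ Z j) Z) _ Zi) => [|W Wi];
    last by rewrite partial_re_aff_re // partial_im_aff_im.
  rewrite (partial_eq_on (rshift n.+1 m) oU
    (g := fun Z => -1 * partial (lshift n.+1 m) (fun Z => v_ Z j) Z) _ Zi) => [|W Wi];
    last by rewrite partial_im_aff_re // partial_re_aff_im // mulN1r opprK.
  rewrite (partialZ _ _ (smooth_on_partial _ (smooth_aff _)) Zi).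
  rewrite mulN1r (partialC (lshift n.+1 m) (rshift n.+1 m) oU (smooth_aff _ 2%N) Zi).
  exact: subrr.
rewrite (partial_eq_on (lshift n.+1 m) oU
  (g := fun Z => -1 * partial (rshift n.+1 m) (fun Z => u_ Z j) Z) _ Zi) => [|W Wi];
  last by rewrite partial_re_aff_im // partial_im_aff_re // mulN1r.
rewrite (partial_eq_on (rshift n.+1 m) oU
  (g := fun Z => partial (lshift n.+1 m) (fun Z => u_ Z j) Z) _ Zi) => [|W Wi];
  last by rewrite partial_re_aff_re // partial_im_aff_im.
rewrite (partialZ _ _ (smooth_on_partial _ (smooth_aff _)) Zi).
rewrite mulN1r (partialC (lshift n.+1 m) (rshift n.+1 m) oU (smooth_aff _ 2%N) Zi).
exact: addNr.
Qed.

Lemma dot_grad Z j l : chart_dom Z ->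
  \sum_m (grad_re Z j m * grad_re Z l m + grad_im Z j m * grad_im Z l m) =
  ((j == l)%:R + u_ Z j * u_ Z l + v_ Z j * v_ Z l) / zabs2 i Z.
Proof.
move=> Zi; rewrite (bigD1_ord i)//= /grad_re /grad_im.
under eq_bigr => m _.
  rewrite !(inj_eq lift_inj) (eq_sym (lift i m) i) (negbTE (neq_lift i m)).
  rewrite !mulr0 !subr0 !addr0.
  rewrite (_ : _ + _ = (zabs2 i Z)^-1 * ((m == j)%:R * (m == l)%:R)).
    over.
  by move: Zi; rewrite /chart_dom/= /zabs2 => Zi; field.
rewrite -mulr_sumr.
have -> : \sum_(m < n) (m == j)%:R * (m == l)%:R = (j == l)%:R :> R.
  rewrite (bigD1 j)//= eqxx mul1r big1 ?addr0 // => m mj.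
  by rewrite (negbTE mj) mul0r.
rewrite !(negbTE (neq_lift _ _)) eqxx.
move: Zi; rewrite /chart_dom/=; move: (u_ Z j) (u_ Z l) (v_ Z j) (v_ Z l) => a b c d.
by rewrite /zabs2 => Zi; field.
Qed.

Lemma cross_grad Z j l : chart_dom Z ->
  \sum_m (grad_im Z j m * grad_re Z l m - grad_re Z j m * grad_im Z l m) =
  (u_ Z j * v_ Z l - v_ Z j * u_ Z l) / zabs2 i Z.
Proof.
move=> Zi; rewrite (bigD1_ord i)//= /grad_re /grad_im.
rewrite [X in _ + X]big1 => [|m _]; last first.
  rewrite !(inj_eq lift_inj) (eq_sym (lift i m) i) (negbTE (neq_lift i m)).
  by rewrite !mulr0; ring.
rewrite !(negbTE (neq_lift _ _)) eqxx.
move: Zi; rewrite /chart_dom/=; move: (u_ Z j) (u_ Z l) (v_ Z j) (v_ Z l) => a b c d.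
by rewrite /zabs2 => Zi; field.
Qed.

Lemma rotate_re (x : 'rV[R]_(n + n)) j : rotate x 0 (lshift n j) = x 0 (rshift n j).
Proof.
rewrite rotateE big_split_ord/=.
under eq_bigr do rewrite mxE block_mxEul mxE mulr0.
under [X in _ + X]eq_bigr do rewrite mxE block_mxEur mxE.
rewrite big1 // add0r (bigD1 j)//= eqxx mulr1 big1 ?addr0 // => l lj.
by rewrite eq_sym (negbTE lj) mulr0.
Qed.

Lemma rotate_im (x : 'rV[R]_(n + n)) j : rotate x 0 (rshift n j) = - x 0 (lshift n j).
Proof.
rewrite rotateE big_split_ord/=.
under eq_bigr do rewrite mxE block_mxEdl !mxE.
under [X in _ + X]eq_bigr do rewrite mxE block_mxEdr mxE mulr0.
rewrite [X in _ + X]big1 // addr0 (bigD1 j)//= eqxx mulrN1 big1 ?addr0 // => l lj.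
by rewrite eq_sym (negbTE lj) oppr0 mulr0.
Qed.

Lemma grad_aff Z a b : chart_dom Z ->
  \sum_k partial k (fun Z => aff i Z 0 a) Z * partial k (fun Z => aff i Z 0 b) Z =
  ((a == b)%:R + aff i Z 0 a * aff i Z 0 b
   + rotate (aff i Z) 0 a * rotate (aff i Z) 0 b) / zabs2 i Z.
Proof.
move=> Zi; rewrite big_split_ord/= -big_split/=.
case: (split_ordP a) => j ->; case: (split_ordP b) => l ->.
- under eq_bigr do rewrite !partial_re_aff_re // !partial_im_aff_re //.
  by rewrite dot_grad // eq_lshift !rotate_re.
- under eq_bigr do rewrite partial_re_aff_re // partial_im_aff_re //
    partial_re_aff_im // partial_im_aff_im //.
  rewrite eq_lrshift rotate_re rotate_im /=.
  have -> : \sum_m (grad_re Z j m * - grad_im Z l m + grad_im Z j m * grad_re Z l m)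
     = \sum_m (grad_im Z j m * grad_re Z l m - grad_re Z j m * grad_im Z l m).
    by apply: eq_bigr => m _; ring.
  by rewrite cross_grad //; move: (aff i Z) => A; congr (_ / _); ring.
- under eq_bigr do rewrite partial_re_aff_re // partial_im_aff_re //
    partial_re_aff_im // partial_im_aff_im //.
  rewrite eq_rlshift rotate_re rotate_im /=.
  have -> : \sum_m (- grad_im Z j m * grad_re Z l m + grad_re Z j m * grad_im Z l m)
     = \sum_m (grad_im Z l m * grad_re Z j m - grad_re Z l m * grad_im Z j m).
    by apply: eq_bigr => m _; ring.
  by rewrite cross_grad //; move: (aff i Z) => A; congr (_ / _); ring.
- under eq_bigr do rewrite !partial_re_aff_im // !partial_im_aff_im //.
  rewrite eq_rshift !rotate_im.
  have -> : \sum_m (- grad_im Z j m * - grad_im Z l m + grad_re Z j m * grad_re Z l m)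
     = \sum_m (grad_re Z j m * grad_re Z l m + grad_im Z j m * grad_im Z l m).
    by apply: eq_bigr => m _; ring.
  by rewrite dot_grad //; move: (aff i Z) => A; congr (_ / _); ring.
Qed.

(** The affine coordinates are holomorphic, hence harmonic, and the Gram matrix of
    their gradients is a multiple of the inverse metric: the flat Laplacian of a
    function of these coordinates is a multiple of the Fubini-Study one. *)
Lemma lap_lift (f : 'rV[R]_(n + n) -> R) Z : smooth_on setT f -> chart_dom Z ->
  norm2 Z * lap (fun Z => f (aff i Z)) Z = 2 * FSlap f (aff i Z).
Proof.
move=> Cf Zi; rewrite (lap_comp open_chart_dom smooth_aff Cf Zi).
rewrite [X in _ * (_ + X)]big1 ?addr0 => [|b _]; last by rewrite lap_aff // mul0r.
rewrite (norm2_aff Zi) /FSlap mulrA [2 * (_ / 2)]mulrC divfK ?pnatr_eq0 //.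
rewrite [_ * rho _]mulrC -mulrA; congr (_ * _).
rewrite mulr_sumr; apply: eq_bigr => a _; rewrite mulr_sumr; apply: eq_bigr => b _.
by rewrite grad_aff // mulrA; congr (_ * _); rewrite mulrC divfK.
Qed.

End ChartLaplacian.

Arguments chart_dom {R n} i.

(** * Homogeneous functions and a Liouville theorem *)

Section Homogeneous.
Variables (R : realType) (N : nat).
Implicit Types (F G : 'rV[R]_N -> R) (Z W : 'rV[R]_N).
Local Notation e_ i := (delta_mx 0 i : 'rV[R]_N).

Definition punctured : set 'rV[R]_N := [set Z | Z != 0].

(** Homogeneity of degree [p - q] under all nonzero real scalars; negative
    degrees are written without division. *)
Definition homog (p q : nat) G : Prop := forall (t : R) Z, t != 0 -> Z != 0 ->
  t ^+ q * G (t *: Z) = t ^+ p * G Z.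

Lemma is_derive_norm2 Z k : is_derive Z (e_ k) (@norm2 R N) (2 * Z 0 k).
Proof.
rewrite (_ : @norm2 R N = fun Z => \sum_j Z 0 j * Z 0 j); last first.
  by apply/funext => W; apply: eq_bigr => j _; rewrite expr2.
have dx j : is_derive Z (e_ k) (fun Z : 'rV[R]_N => Z 0 j) (k == j)%:R.
  by apply: (is_derive_eqF (is_derive_coord _ _ _)); rewrite mxE eqxx eq_sym.
apply: (is_derive_eqF (is_derive_sumF (fun j => is_deriveMF (dx j) (dx j)))).
rewrite (bigD1 k)//= eqxx mul1r mulr1 big1 ?addr0 => [|j jk]; first by ring.
by rewrite eq_sym (negbTE jk) mul0r mulr0 addr0.
Qed.

Lemma smooth_norm2 U : open U -> smooth_on U (@norm2 R N).
Proof.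
move=> oU; rewrite (_ : @norm2 R N = fun Z => \sum_j Z 0 j * Z 0 j); last first.
  by apply/funext => W; apply: eq_bigr => j _; rewrite expr2.
by apply: smooth_on_sum => // j; apply: smooth_onM => //; exact: smooth_on_coord.
Qed.

Lemma norm2_scale (t : R) Z : norm2 (t *: Z) = t ^+ 2 * norm2 Z.
Proof.
by rewrite /norm2 mulr_sumr; apply: eq_bigr => k _; rewrite mxE exprMn.
Qed.

Lemma continuous_norm2 : continuous (@norm2 R N).
Proof. by move=> Z; exact: (smooth_on_continuous (smooth_norm2 openT) I). Qed.

Lemma open_punctured : open punctured.
Proof.
rewrite (_ : punctured = @norm2 R N @^-1` [set r | r != 0]).
  by apply: open_comp => // Z _; exact: continuous_norm2.
by apply/seteqP; split=> Z; rewrite /punctured/= norm2_eq0.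
Qed.

Lemma partial_norm2 Z k : partial k (@norm2 R N) Z = 2 * Z 0 k.
Proof. exact: is_partial (is_derive_norm2 Z k). Qed.

Lemma lap_norm2 Z : lap (@norm2 R N) Z = 2 * N%:R.
Proof.
rewrite /lap -[N in RHS]card_ord -sum1_card natr_sum mulr_sumr.
apply: eq_bigr => k _.
rewrite (_ : partial k (@norm2 R N) = fun Z => 2 * Z 0 k); last first.
  by apply/funext => W; exact: partial_norm2.
apply: is_partial; apply: (is_derive_eqF (is_deriveMF (is_derive_cstF _ _ _)
  (is_derive_coord _ _ _))).
by rewrite mxE !eqxx mul0r add0r.
Qed.

(** Differentiation lowers the degree by one. *)
Lemma homog_partial p q G i : smooth_on punctured G -> homog p q G ->
  homog p q.+1 (partial i G).
Proof.
move=> CG hG t Z t0 Z0; have oU := open_punctured.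
have H : is_derive Z (e_ i) (fun Y => t ^+ q * G (t *: Y))
   (t ^+ q * (partial i G (t *: Z) * t)).
  have UV (Y : 'rV[R]_N) : punctured Y -> punctured (t *: Y).
    by rewrite /punctured/= => Y0; rewrite scaler_eq0 negb_or t0.
  have dp j : is_derive Z (e_ i) (fun Y => (t *: Y : 'rV[R]_N) 0 j) (t * (j == i)%:R).
    rewrite (_ : (fun Y => _) = fun Y : 'rV[R]_N => t * Y 0 j); last first.
      by apply/funext => Y; rewrite mxE.
    apply: (is_derive_eqF (is_deriveMF (is_derive_cstF _ _ _)
      (is_derive_coord _ _ _))).
    by rewrite mxE eqxx/= mul0r add0r.
  apply: (is_derive_eqF (is_deriveMF (is_derive_cstF _ _ _)
    (is_derive_comp_rV UV oU (CG 1%N) Z0 dp))).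
  rewrite mul0r add0r; congr (_ * _); rewrite (bigD1 i)//= eqxx mulr1 big1 ?addr0 //.
  by move=> j ji; rewrite (negbTE ji) !mulr0.
have -> : t ^+ q.+1 * partial i G (t *: Z) = t ^+ q * (partial i G (t *: Z) * t).
  by rewrite exprS -mulrA mulrC -mulrA.
rewrite -(is_partial H) -(partialZ _ _ CG Z0).
exact: (partial_eq_on i oU (fun Y Y0 => hG t Y t0 Y0) Z0).
Qed.

Lemma is_derive_exp1 (m : nat) :
  is_derive (1 : R) (1 : R) (fun s : R => s ^+ m) m%:R.
Proof.
have := @is_deriveX R R id m 1 1 1 (is_derive_id _ _).
rewrite (_ : (id ^+ m : R -> R) = fun s => s ^+ m); last first.
  by apply/funext => s; elim: m => [//|m IH]; rewrite !exprS -IH.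
by move=> H; apply: (is_derive_eqF H); rewrite expr1n mulr1 [_ *: _]mulr1.
Qed.

Lemma euler p q G Z : smooth_on punctured G -> homog p q G -> Z != 0 ->
  \sum_i Z 0 i * partial i G Z = (p%:R - q%:R) * G Z.
Proof.
move=> CG hG Z0; have oU := open_punctured.
have H : is_derive (1 : R) 1 (fun s : R => G (s *: Z)) (\sum_i partial i G Z * Z 0 i).
  have -> : \sum_i partial i G Z * Z 0 i = \sum_i partial i G ((1 : R) *: Z) * Z 0 i.
    by rewrite scale1r.
  apply: (@chain_rule _ _ G (fun s : R => s *: Z)); rewrite ?scale1r.
  - apply: filterS (open_nbhs_nbhs (conj oU Z0)) => Y Y0 i.
    exact: (Ck_on_derivable (CG 1%N) Y0).
  - by move=> i; exact: (smooth_on_continuous (smooth_on_partial i CG) Z0).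
  - move=> j; rewrite (_ : (fun s : R => _) = fun s : R => s * Z 0 j); last first.
      by apply/funext => s; rewrite mxE.
    apply: (is_derive_eqF (is_deriveMF (is_derive_id _ _) (is_derive_cstF _ _ _))).
    by rewrite mulr0 addr0 mul1r.
have H1 := is_deriveMF (is_derive_exp1 q) H.
have H2 := is_deriveMF (is_derive_exp1 p) (is_derive_cstF (1:R) (1:R) (G Z)).
have nz : \forall s \near (1 : R), s ^+ q * G (s *: Z) = s ^+ p * G Z.
  near=> s; apply: hG => //.
  near: s; have := @cvgrPdist_lt _ _ _ (nbhs (1:R)) _ id 1.
  move=> -[/(_ (@cvg_id _ _) 1 ltr01) + _].
  by apply: filterS => s; apply: contraTneq => ->; rewrite subr0 normr1 ltxx.
have := near_eq_is_derive nz H1.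
move=> [_]; have [_ ->] := H2.
rewrite !expr1n !scale1r !mul1r addr0 => E.
rewrite mulrBl E addrAC subrr add0r.
by apply: eq_bigr => i _; rewrite mulrC.
Unshelve. all: by end_near. Qed.

(** A harmonic function of degree $-1$ on the punctured space vanishes when
    $N > 3$: at a maximum of the degree $0$ function $|Z|^2 G^2$ the Laplacian of
    this function is at least $(2N-6)G^2$. *)
Lemma harmonic_deg_opp1 G : (3 < N)%N -> smooth_on punctured G -> homog 0 1 G ->
  (forall Z, Z != 0 -> lap G Z = 0) -> forall Z, Z != 0 -> G Z = 0.
Proof.
move=> N3 CG hG lG; have oU := open_punctured.
have nS : [set Z : 'rV[R]_N | norm2 Z = 1] !=set0.
  exists (e_ (Ordinal (ltn_trans (isT : (0 < 3)%N) N3))).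
  rewrite /= /norm2 (bigD1 (Ordinal (ltn_trans (isT : (0 < 3)%N) N3)))//=.
  rewrite mxE !eqxx expr1n big1 ?addr0 // => j jk.
  by rewrite mxE eqxx (negbTE jk) expr0n.
have cS : compact [set Z : 'rV[R]_N | norm2 Z = 1].
  apply: bounded_closed_compact.
    exists 1; split; first exact: num_real.
    move=> r r1 Z /= Z1; apply: le_trans (ltW r1).
    rewrite /Num.Def.normr/= mx_normrE (bigmax_le _ ler01)//= => -[a b] _ /=.
    rewrite ord1 -sqrtr_sqr -[leRHS]sqrtr1 ler_wsqrtr // -Z1 /norm2 (bigD1 b)//=.
    by rewrite lerDl sumr_ge0 // => j _; exact: sqr_ge0.
  rewrite (_ : mkset _ = @norm2 R N @^-1` [set 1]) //.
  apply: closed_comp => [Z _|]; first exact: continuous_norm2.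
  exact: closed_eq.
have [|p] := @EVT_max_rV R N (fun Z => G Z * G Z) _ nS cS.
  apply: continuous_in_subspaceT => Z; rewrite inE/= => Z1.
  have Z0 : punctured Z by rewrite /punctured/= -norm2_eq0 Z1 oner_eq0.
  exact: (smooth_on_continuous (smooth_onM oU CG CG) Z0).
rewrite inE/= => p1 pmax.
have p0 : p != 0 by rewrite -norm2_eq0 p1 oner_eq0.
have Hmax Z : Z != 0 -> norm2 Z * (G Z * G Z) <= G p * G p.
  move=> Z0; pose t := (Num.sqrt (norm2 Z))^-1.
  have s0 : 0 < Num.sqrt (norm2 Z) by rewrite sqrtr_gt0 norm2_gt0.
  have t0 : t != 0 by rewrite invr_eq0 gt_eqF.
  have t2 : norm2 Z = t ^- 2.
    by rewrite /t exprVn invrK sqr_sqrtr // norm2_ge0.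
  have := hG t Z t0 Z0; rewrite expr1 expr0 mul1r => <-.
  rewrite t2 (_ : _ * _ = G (t *: Z) * G (t *: Z)).
    apply: pmax; rewrite inE/= norm2_scale t2 mulfV // expf_eq0/=.
    exact/negP/negP.
  by move: (G (t *: Z)) => g; field.
pose H Z := norm2 Z * (G Z * G Z).
have CH : smooth_on punctured H.
  by apply: smooth_onM => //; [exact: smooth_norm2|exact: smooth_onM].
have lH : lap H p <= 0.
  apply: sumr_le0 => k _; apply: (partial2_max k oU (CH 2%N) p0) => Z Z0.
  by rewrite /H p1 mul1r; exact: Hmax.
have pG2 k : partial k (fun Z => G Z * G Z) p = 2 * G p * partial k G p.
  apply: is_partial; have d := smooth_on_is_derive k CG p0.
  apply: (is_derive_eqF (is_deriveMF d d)).
  by move: (partial k G p) => g; ring.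
have E : lap H p = (2 * N%:R - 8) * (G p * G p) + 2 * \sum_k partial k G p ^+ 2.
  rewrite /H (lapM oU (smooth_norm2 oU) (smooth_onM oU CG CG) p0).
  rewrite lap_norm2 p1 mul1r (lapM oU CG CG p0) lG // mulr0 !add0r.
  under [X in _ + 2 * X]eq_bigr do rewrite partial_norm2 pG2.
  have -> : \sum_i 2 * p 0 i * (2 * G p * partial i G p) =
      4 * G p * \sum_i p 0 i * partial i G p.
    by rewrite mulr_sumr; apply: eq_bigr => k _; move: (partial k G p) => g; ring.
  rewrite (euler CG hG p0).
  under [X in 2 * X + _ + _]eq_bigr do rewrite -expr2.
  by move: (\sum_i _) (G p) => a b; ring.
have sq : 0 <= (\sum_k partial k G p ^+ 2) - G p * G p.
  have -> : (\sum_k partial k G p ^+ 2) - G p * G p =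
      \sum_k (partial k G p + G p * p 0 k) ^+ 2.
    have -> : \sum_k (partial k G p + G p * p 0 k) ^+ 2 =
      (\sum_k partial k G p ^+ 2) + 2 * G p * (\sum_k p 0 k * partial k G p)
       + G p * G p * (norm2 p).
      rewrite /norm2 !mulr_sumr -!big_split/=; apply: eq_bigr => k _.
      by move: (partial k G p) => g; ring.
    rewrite (euler CG hG p0) p1; move: (\sum_i _) (G p) => a b; ring.
  by apply: sumr_ge0 => k _; exact: sqr_ge0.
have Gp : G p * G p <= 0.
  have N4 : 4 <= N%:R :> R by rewrite (ler_nat _ 4).
  have Gp0 : 0 <= G p * G p by rewrite -expr2 sqr_ge0.
  move: lH sq; rewrite E; move: (\sum_k _) (G p * G p) N%:R Gp0 N4.
  by clear; move=> a b c; nra.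
move=> Z Z0; have := Hmax Z Z0; rewrite -expr2 => HZ.
apply/eqP; rewrite -sqrf_eq0 eq_le sqr_ge0 andbT.
by rewrite -(pmulr_rle0 _ (_ : 0 < norm2 Z)) ?norm2_gt0 //; exact: le_trans HZ Gp.
Qed.

(** The punctured space is convex up to pairs of points on a line through the
    origin, and these have equal values by homogeneity. *)
Lemma constant_of_partials G : smooth_on punctured G -> homog 0 0 G ->
  (forall i Z, Z != 0 -> partial i G Z = 0) ->
  forall Z W, Z != 0 -> W != 0 -> G Z = G W.
Proof.
move=> CG hG dG Z W Z0 W0; have oU := open_punctured.
have [[t [t0 WE]]|nt] := pselect (exists t : R, t != 0 /\ W = t *: Z).
  by have := hG t Z t0 Z0; rewrite !expr0 !mul1r -WE.
(* The segment from Z to W avoids the origin. *)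
have c0 (s : R) : Z + s *: (W - Z) != 0.
  have [->|s0] := eqVneq s 0; first by rewrite scale0r addr0.
  have [->|s1] := eqVneq s 1; first by rewrite scale1r addrCA subrr addr0.
  apply/eqP => E; apply: nt; exists (- ((1 - s) / s)); split.
    by rewrite oppr_eq0 mulf_neq0 ?invr_eq0 // subr_eq0 eq_sym.
  have E2 : s *: W = - ((1 - s) *: Z).
    apply/eqP; rewrite -addr_eq0 -[X in _ == X]E scalerBl scale1r scalerBr.
    by apply/eqP; rewrite addrCA; congr (_ + _); rewrite addrC.
  by rewrite -[LHS](scalerK s0) E2 scalerN scaleNr scalerA mulrC.
have -> : G Z = G (Z + (0 : R) *: (W - Z)) by rewrite scale0r addr0.
have -> : G W = G (Z + (1 : R) *: (W - Z)) by rewrite scale1r addrCA subrr addr0.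
apply: (@is_derive_0_is_cst R (fun s : R => G (Z + s *: (W - Z)))) => s.
apply: (is_derive_eqF
  (a := \sum_j partial j G (Z + s *: (W - Z)) * (W - Z) 0 j)); last first.
  by rewrite big1 // => j _; rewrite dG // mul0r.
apply: (@chain_rule _ _ G (fun s : R => Z + s *: (W - Z))).
- apply: filterS (open_nbhs_nbhs (conj oU (c0 s))) => Y Y0 i.
  exact: (Ck_on_derivable (CG 1%N) Y0).
- by move=> i; exact: (smooth_on_continuous (smooth_on_partial i CG) (c0 s)).
- move=> j; apply: (proj1 (is_derive_line (fun Y : 'rV[R]_N => Y 0 j) Z (W - Z) s _)).
  exact: is_derive_coord.
Qed.

Lemma homogS p q G : homog p.+1 q.+1 G -> homog p q G.
Proof.
by move=> H t Z t0 Z0; have := H t Z t0 Z0; rewrite !exprS -!mulrA => /(mulfI t0).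
Qed.

Lemma lap_partial_eq0 G i : smooth_on punctured G ->
  (forall Z, Z != 0 -> lap G Z = 0) -> forall Z, Z != 0 -> lap (partial i G) Z = 0.
Proof.
move=> CG lG Z Z0; have oU := open_punctured.
rewrite -(partial_lap i oU CG Z0).
rewrite (partial_eq_on i oU (g := fun=> 0) lG Z0).
exact: (is_partial (is_derive_cstF _ _ _)).
Qed.

(** A harmonic function of degree 2 is a quadratic form: its third derivatives
    are harmonic of degree -1, hence vanish. *)
Lemma harmonic_deg2 Q : (3 < N)%N -> smooth_on punctured Q -> homog 2 0 Q ->
  (forall Z, Z != 0 -> lap Q Z = 0) ->
  exists B : 'M[R]_N, forall Z, Z != 0 ->
    Q Z = \sum_a \sum_b B a b * (Z 0 a * Z 0 b).
Proof.
move=> N3 CQ hQ lQ.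
have C1 a := smooth_on_partial a CQ.
have C2 a b := smooth_on_partial b (C1 a).
have C3 a b c := smooth_on_partial c (C2 a b).
have h1 a := homog_partial a CQ hQ.
have h2 a b := homog_partial b (C1 a) (h1 a).
have h3 a b c := homog_partial c (C2 a b) (h2 a b).
have l1 a := lap_partial_eq0 a CQ lQ.
have l2 a b := lap_partial_eq0 b (C1 a) (l1 a).
have l3 a b c := lap_partial_eq0 c (C2 a b) (l2 a b).
have z3 a b c := harmonic_deg_opp1 N3 (C3 a b c) (homogS (homogS (h3 a b c))) (l3 a b c).
have cst2 a b := constant_of_partials (C2 a b) (homogS (homogS (h2 a b)))
  (fun c => z3 a b c).
pose o : 'I_N := Ordinal (ltn_trans (isT : (0 < 3)%N) N3).
have e0 : e_ o != 0.
  by apply/eqP => /rowP/(_ o)/eqP; rewrite !mxE !eqxx oner_eq0.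
exists (\matrix_(a, b) (2^-1 * partial b (partial a Q) (e_ o))) => Z Z0.
have E1 := euler CQ hQ Z0.
have E2 a := euler (C1 a) (h1 a) Z0.
have -> : Q Z = 2^-1 * \sum_a Z 0 a * partial a Q Z.
  by rewrite E1; field.
rewrite mulr_sumr; apply: eq_bigr => a _.
have -> : partial a Q Z = \sum_b Z 0 b * partial b (partial a Q) Z.
  by rewrite E2; move: (partial a Q Z) => g; ring.
rewrite !mulr_sumr; apply: eq_bigr => b _; rewrite mxE (cst2 a b _ _ Z0 e0).
by move: (partial b _ _) => g; ring.
Qed.

(** The equation W (W + 2N) F = 0, with W = |Z|^2 lap, for functions of degree 0:
    |Z|^2 W F is then harmonic of degree 2, hence a quadratic form, and F + W F / 2N
    is harmonic of degree 0, hence constant because its partial derivatives are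
    harmonic of degree -1. *)
Lemma classification F : (3 < N)%N -> smooth_on punctured F -> homog 0 0 F ->
  (forall Z, Z != 0 -> norm2 Z * lap (fun Y => norm2 Y * lap F Y) Z
      + 2 * N%:R * (norm2 Z * lap F Z) = 0) ->
  exists B : 'M[R]_N, forall Z, Z != 0 ->
    F Z = (\sum_a \sum_b B a b * (Z 0 a * Z 0 b)) / norm2 Z.
Proof.
move=> N3 CF hF HF; have oU := open_punctured.
have sn := smooth_norm2 oU.
have [V VE] : {V | V = fun Z => norm2 Z * lap F Z} by exists (fun Z => norm2 Z * lap F Z).
have CV : smooth_on punctured V.
  by rewrite VE; apply: smooth_onM => //; exact: smooth_on_lap.
have hV t Z : t != 0 -> Z != 0 -> V (t *: Z) = V Z.
  move=> t0 Z0; rewrite VE norm2_scale.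
  suff <- : t ^+ 2 * lap F (t *: Z) = lap F Z by rewrite mulrAC mulrC.
  rewrite /lap mulr_sumr; apply: eq_bigr => k _.
  have := homog_partial k (smooth_on_partial k CF) (homog_partial k CF hF).
  by move=> /(_ t Z t0 Z0); rewrite expr0 mul1r.
have hV0 : homog 0 0 V by move=> t Z t0 Z0; rewrite hV.
have {}HF Z : Z != 0 -> norm2 Z * lap V Z + 2 * N%:R * V Z = 0.
  by move=> Z0; rewrite VE; exact: HF Z0.
have {}hF t Z : t != 0 -> Z != 0 -> F (t *: Z) = F Z.
  by move=> t0 Z0; have := hF t Z t0 Z0; rewrite !expr0 !mul1r.
have N0 : 2 * N%:R != 0 :> R.
  by rewrite mulf_neq0 ?pnatr_eq0 // -lt0n (ltn_trans _ N3).
pose Q Z := norm2 Z * V Z.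
have CQ : smooth_on punctured Q by exact: smooth_onM.
have hQ : homog 2 0 Q.
  by move=> t Z t0 Z0; rewrite expr0 mul1r /Q norm2_scale hV // mulrA.
have lQ Z : Z != 0 -> lap Q Z = 0.
  move=> Z0; rewrite /Q (lapM oU sn CV Z0) lap_norm2.
  have -> : \sum_k partial k (@norm2 R N) Z * partial k V Z =
      2 * \sum_k Z 0 k * partial k V Z.
    by rewrite mulr_sumr; apply: eq_bigr => k _; rewrite partial_norm2 mulrA.
  rewrite (euler CV hV0 Z0) subrr mul0r !mulr0 addr0 [V Z * _]mulrC.
  exact: HF.
have [B HB] := harmonic_deg2 N3 CQ hQ lQ.
pose C Z := F Z + (2 * N%:R)^-1 * V Z.
have CC : smooth_on punctured C by apply: smooth_onD => //; exact: smooth_onZ.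
have hC : homog 0 0 C by move=> t Z t0 Z0; rewrite /C hF // hV.
have lC Z : Z != 0 -> lap C Z = 0.
  move=> Z0; rewrite /C (lapD oU CF (smooth_onZ _ oU CV) Z0) (lapZ _ oU CV Z0).
  have n0 : norm2 Z != 0 by rewrite norm2_eq0.
  apply: (mulfI n0); apply: (mulfI N0).
  have EV : V Z = norm2 Z * lap F Z by rewrite VE.
  rewrite !mulr0 -[RHS](HF Z Z0) EV.
  move: N0; move: (2 * N%:R : R) (lap V Z) (lap F Z) (norm2 Z) => c a b m c0.
  by field.
have dC k Z : Z != 0 -> partial k C Z = 0.
  exact: (harmonic_deg_opp1 N3 (smooth_on_partial k CC) (homog_partial k CC hC)
    (lap_partial_eq0 k CC lC)).
have cC := constant_of_partials CC hC dC.
pose o : 'I_N := Ordinal (ltn_trans (isT : (0 < 3)%N) N3).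
have e0 : e_ o != 0.
  by apply/eqP => /rowP/(_ o)/eqP; rewrite !mxE !eqxx oner_eq0.
exists ((C (e_ o))%:M - (2 * N%:R)^-1 *: B) => Z Z0.
have n0 : norm2 Z != 0 by rewrite norm2_eq0.
have -> : \sum_a \sum_b ((C (e_ o))%:M - (2 * N%:R)^-1 *: B) a b * (Z 0 a * Z 0 b) =
   C (e_ o) * norm2 Z - (2 * N%:R)^-1 * \sum_a \sum_b B a b * (Z 0 a * Z 0 b).
  rewrite /norm2 !mulr_sumr -sumrB; apply: eq_bigr => a _.
  rewrite mulr_sumr (_ : C (e_ o) * Z 0 a ^+ 2 =
     \sum_b (C (e_ o))%:M a b * (Z 0 a * Z 0 b)); last first.
    rewrite (bigD1 a)//= mxE eqxx mulr1n expr2 big1 ?addr0 // => b ba.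
    by rewrite mxE eq_sym (negbTE ba) mulr0n mul0r.
  by rewrite -sumrB; apply: eq_bigr => b _; rewrite !mxE; ring.
rewrite -HB // -(cC _ _ Z0 e0) /C /Q.
by move: N0; move: (V Z) (F Z) (2 * N%:R : R) => v f c c0; field; apply/andP.
Qed.

End Homogeneous.

Arguments punctured {R N}.

(** * The kernel of LL on projective space *)

Section KernelLL.
Variables (R : realType) (n : nat).
Local Notation Pn := (projective_space R n).
Local Notation M := (n.+1 + n.+1)%N.
Implicit Types (f : Pn -> R) (Z W : 'rV[R]_M) (i : 'I_n.+1) (a b k l : 'I_n.+1).

Definition lifted f Z : R := f (class Z).

#[local] Opaque lap FSlap.

Lemma lifted_chart f i Z : chart_dom i Z ->
  (f \o affine_chart i) (aff i Z) = lifted f Z.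
Proof. by move=> Zi; rewrite /lifted (class_aff Zi). Qed.

Lemma homog_lifted f : homog 0 0 (lifted f).
Proof. by move=> t Z t0 Z0; rewrite /lifted class_scaleR. Qed.

Lemma chart_dom_punctured i Z : chart_dom i Z -> punctured Z.
Proof. exact: zabs2_neq0. Qed.

Lemma smooth_on_cover (I : Type) (V : I -> set 'rV[R]_M) (U : set 'rV[R]_M) F :
  (forall Z, U Z -> exists m, V m Z) -> (forall m, smooth_on (V m) F) -> smooth_on U F.
Proof.
move=> UV CF k; elim: k F CF => [|k IH] F CF.
  by split=> // Z UZ; have [m Vm] := UV Z UZ; exact: (smooth_on_continuous (CF m) Vm).
split=> [Z UZ|j].
  by have [m Vm] := UV Z UZ; exact: (smooth_on_continuous (CF m) Vm).
split=> [Z UZ|].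
  by have [m Vm] := UV Z UZ; exact: (Ck_on_derivable (CF m 1%N) Vm).
by apply: IH => m; exact: smooth_on_partial (CF m).
Qed.

Lemma smooth_lifted f : smooth_on_Pn f -> smooth_on punctured (lifted f).
Proof.
move=> Cf; apply: (@smooth_on_cover _ (fun i => chart_dom i)) => [Z /ex_zabs2//|i].
have oU := @open_chart_dom R n i.
apply: (smooth_on_ext oU (fun Z => @lifted_chart f i Z)).
apply: (smooth_on_comp oU (@smooth_aff R n i)).
exact/smoothE.
Qed.

(** With W = |Z|^2 lap acting on lifted functions, LL becomes -W(W + 2N)/8, where
    N = 2n + 2 is the real dimension of the space of vectors. *)
Lemma lifted_LL f i Z : smooth_on_Pn f -> chart_dom i Z ->
  norm2 Z * lap (fun Y => norm2 Y * lap (lifted f) Y) Z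
    + 2 * M%:R * (norm2 Z * lap (lifted f) Z) =
  - 8 * LL (@FS_metric R n i) (f \o affine_chart i) (aff i Z).
Proof.
move=> Cf Zi; have oU := @open_chart_dom R n i.
have /smoothE := Cf i; have := @lifted_chart f i.
move: (f \o affine_chart i) => phi lc Cphi.
have CL := smooth_on_FSlap Cphi.
pose F1 Y := phi (aff i Y); pose F2 Y := 2 * FSlap phi (aff i Y).
have E1 Y : chart_dom i Y -> norm2 Y * lap (lifted f) Y = F2 Y.
  move=> Yi; apply: etrans (lap_lift Cphi Yi).
  exact: (congr1 (fun r => norm2 Y * r)
    (@lap_eq_on _ _ _ (lifted f) F1 oU (fun Z H => esym (lc Z H)) Y Yi)).
have E2 : norm2 Z * lap (fun Y => norm2 Y * lap (lifted f) Y) Z =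
    4 * FSlap (FSlap phi) (aff i Z).
  rewrite (@lap_eq_on _ _ _ (fun Y => norm2 Y * lap (lifted f) Y) F2 oU E1 Z Zi).
  rewrite (lapZ 2 oU (smooth_on_comp oU (@smooth_aff R n i) CL) Zi).
  by rewrite mulrCA (lap_lift CL Zi) mulrA -natrM.
have E3 := E1 Z Zi; have E4 := LLE i (aff i Z) Cphi.
apply: etrans (congr2 (fun u v => u + 2 * M%:R * v) E2 E3) _; rewrite E4 /F2.
move: (FSlap (FSlap phi) (aff i Z)) (FSlap phi (aff i Z)) => A B.
have -> : M%:R = 2 * (n%:R + 1) :> R by rewrite addnn -muln2 natrM -natr1 mulrC.
by clear; field.
Qed.

(** The model is a Hermitian form divided by |Z|^2; the constancy of the Laplacian
    of the numerator is what makes LL vanish. *)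
Definition quadratic_fun f := exists q : 'rV[R]_M -> R,
  [/\ smooth_on setT q, exists c, forall Z, lap q Z = c
    & forall Z, Z != 0 -> f (class Z) = q Z / norm2 Z].

Lemma quadratic_funD f g : quadratic_fun f -> quadratic_fun g ->
  quadratic_fun (fun p => f p + g p).
Proof.
move=> [q [Cq [c lq] fq]] [r [Cr [d lr] gr]]; exists (fun Z => q Z + r Z); split.
- by apply: smooth_onD => //; exact: openT.
- by exists (c + d) => Z; rewrite (lapD openT Cq Cr I) lq lr.
- by move=> Z Z0; rewrite fq // gr // mulrDl.
Qed.

Lemma quadratic_funZ (a : R) f : quadratic_fun f -> quadratic_fun (fun p => a * f p).
Proof.
move=> [q [Cq [c lq] fq]]; exists (fun Z => a * q Z); split.
- by apply: smooth_onZ => //; exact: openT.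
- by exists (a * c) => Z; rewrite (lapZ a openT Cq I) lq.
- by move=> Z Z0; rewrite fq // mulrA.
Qed.

Lemma quadratic_fun_cst (a : R) : quadratic_fun (fun=> a).
Proof.
exists (fun Z => a * norm2 Z); split.
- by apply: smooth_onZ; [exact: openT|exact: smooth_norm2 openT].
- exists (a * (2 * M%:R)) => Z.
  by rewrite (lapZ a openT (smooth_norm2 openT) I) lap_norm2.
- by move=> Z Z0; rewrite mulfK // norm2_eq0.
Qed.

Lemma smooth_hom i (q : 'rV[R]_M -> R) : smooth_on setT q ->
  smooth_on setT (fun x => q (hom i x)).
Proof.
move=> Cq; apply: (smooth_on_comp openT) => // a.
case: (split_ordP a) => k ->.
  under eq_fun do rewrite -/(zre _ _) zre_hom.
  case: (unlift i k) => [j|]; first exact: smooth_on_coord openT.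
  exact: smooth_on_cst openT.
under eq_fun do rewrite -/(zim _ _) zim_hom.
case: (unlift i k) => [j|]; first exact: smooth_on_coord openT.
exact: smooth_on_cst openT.
Qed.

Lemma norm2_hom i (x : 'rV[R]_(n + n)) : norm2 (hom i x) = rho x.
Proof.
by rewrite (@norm2_aff _ _ i) ?zabs2_hom ?oner_eq0 // mul1r aff_hom.
Qed.

(** On such a function F of degree 0, W F = c - 2NF, so that (W + 2N)F is constant
    and is annihilated by W. *)
Lemma ker_LL_quadratic f : quadratic_fun f -> ker_LL f.
Proof.
move=> [q [Cq [c lq] fq]].
have Cf : smooth_on_Pn f.
  move=> i; apply/smoothE.
  rewrite (_ : f \o affine_chart i = fun x => q (hom i x) * (norm2 (hom i x))^-1).
    apply: smooth_onM; [exact: openT|exact: smooth_hom|].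
    apply: smooth_onV; first exact: openT.
      by move=> x _; rewrite norm2_hom rho_neq0.
    exact: smooth_hom (smooth_norm2 openT).
  by apply/funext => x /=; rewrite affine_chartE fq // hom_neq0.
split=> // i x.
have oU := @open_punctured R M.
have CF := smooth_lifted Cf.
have hF := @homog_lifted f.
have F1 Z : Z != 0 -> norm2 Z * lap (lifted f) Z = c - 2 * M%:R * lifted f Z.
  move=> Z0; rewrite -(lq Z).
  have qE Y : punctured Y -> q Y = norm2 Y * lifted f Y.
    by move=> Y0; rewrite /lifted fq // mulrCA mulfV ?mulr1 // norm2_eq0.
  rewrite (lap_eq_on oU qE Z0) (lapM oU (smooth_norm2 oU) CF Z0) lap_norm2.
  have -> : \sum_k partial k (@norm2 R M) Z * partial k (lifted f) Z =
      2 * \sum_k Z 0 k * partial k (lifted f) Z.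
    by rewrite mulr_sumr; apply: eq_bigr => k _; rewrite partial_norm2 mulrA.
  rewrite (euler CF hF Z0); move: (lap (lifted f) Z) (lifted f Z) (norm2 Z) => A B C.
  by ring.
have Zi : chart_dom i (hom i x) by rewrite /chart_dom/= zabs2_hom oner_eq0.
have Z0 := chart_dom_punctured Zi.
have := lifted_LL Cf Zi; rewrite aff_hom.
have F2 Y : punctured Y -> norm2 Y * lap (lifted f) Y = c + (- (2 * M%:R)) * lifted f Y.
  by move=> Y0; rewrite F1 // mulNr.
rewrite (lap_eq_on oU F2 Z0).
rewrite (lapD oU (smooth_on_cst c oU) (smooth_onZ _ oU CF) Z0) (lapZ _ oU CF Z0).
rewrite lap_cst add0r => E; apply/eqP; have : - 8 != 0 :> R by rewrite oppr_eq0 pnatr_eq0.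
move=> /mulfI/inj_eq <-; rewrite mulr0 -E; apply/eqP.
by move: (lap (lifted f) _) (norm2 _) => A B; ring.
Qed.

(** ** Hermitian forms *)

Definition herm_re a b Z : R := zre Z a * zre Z b + zim Z a * zim Z b.
Definition herm_im a b Z : R := zim Z a * zre Z b - zre Z a * zim Z b.

(** The real and imaginary parts of the entries of the Hermitian matrix
    $Z^* Z$, each taken once. *)
Definition herm a b Z : R := if (a <= b)%N then herm_re a b Z else herm_im a b Z.

(** A choice of homogeneous coordinates, on which the values of [eta] below do not
    depend. *)
Definition rep (p : Pn) : 'rV[R]_M := s2val (cid2 (class_surj p)).

Lemma rep_neq0 p : rep p != 0.
Proof. exact: (s2valP (cid2 (class_surj p))). Qed.

Lemma class_rep p : class (rep p) = p.
Proof. by rewrite -(s2valP' (cid2 (class_surj p))). Qed.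

Definition eta a b (p : Pn) : R := herm a b (rep p) / norm2 (rep p).

Lemma eta_class a b Z : Z != 0 -> eta a b (class Z) = herm a b Z / norm2 Z.
Proof.
move=> Z0; rewrite /eta; set W := rep (class Z).
have W0 : W != 0 by exact: rep_neq0.
have : cvec W \in <[cvec Z]>%VS.
  by rewrite -(val_class Z0) -(class_rep (class Z)) val_class // memv_line.
move=> /vlineP[[al be] E].
have wr k : zre W k = al * zre Z k - be * zim Z k.
  by have /rowP/(_ k) := E; rewrite cvecE mxE cvecE => -[-> _].
have wi k : zim W k = al * zim Z k + be * zre Z k.
  by have /rowP/(_ k) := E; rewrite cvecE mxE cvecE => -[_ ->].
have hW : herm a b W = (al ^+ 2 + be ^+ 2) * herm a b Z.
  by rewrite /herm /herm_re /herm_im !wr !wi; case: ifP => _; ring.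
have nW : norm2 W = (al ^+ 2 + be ^+ 2) * norm2 Z.
  rewrite !norm2E mulr_sumr; apply: eq_bigr => k _.
  by rewrite /zabs2 wr wi; ring.
have nW0 : norm2 W != 0 by rewrite norm2_eq0.
have nZ0 : norm2 Z != 0 by rewrite norm2_eq0.
have c0 : al ^+ 2 + be ^+ 2 != 0.
  by apply: contra nW0 => /eqP c0; rewrite nW c0 mul0r.
by rewrite hW nW invfM mulrACA mulfV // mul1r.
Qed.

Lemma lap_coordM (k l : 'I_M) Z :
  lap (fun Z : 'rV[R]_M => Z 0 k * Z 0 l) Z = 2 * (k == l)%:R.
Proof.
have Cc (j : 'I_M) := @smooth_on_coord R M setT j openT.
rewrite (lapM openT (Cc k) (Cc l) I) !lap_coord !mulr0 !add0r; congr (_ * _).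
under eq_bigr do rewrite !partial_coord.
rewrite (bigD1 k)//= eqxx mul1r big1 ?addr0 => [|j jk]; first by rewrite eq_sym.
by rewrite eq_sym (negbTE jk) mul0r.
Qed.

Lemma quadratic_eta a b : quadratic_fun (eta a b).
Proof.
have Cc (j : 'I_M) := @smooth_on_coord R M setT j openT.
have CM (j : 'I_M) (l : 'I_M) := smooth_onM openT (Cc j) (Cc l).
have [Cq lq] : smooth_on setT (herm a b) /\ exists c, forall Z, lap (herm a b) Z = c.
  have [ab|ab] := boolP (a <= b)%N.
    have -> : herm a b = herm_re a b by apply/funext => Z; rewrite /herm ab.
    have C1 := CM (lshift _ a) (lshift _ b); have C2 := CM (rshift _ a) (rshift _ b).
    split; first exact: smooth_onD openT C1 C2.
    by eexists => Z; rewrite (lapD openT C1 C2 I) !lap_coordM; reflexivity.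
  have C1 := CM (rshift _ a) (lshift _ b); have C2 := CM (lshift _ a) (rshift _ b).
  have -> : herm a b = fun Z => zim Z a * zre Z b + (-1) * (zre Z a * zim Z b).
    by apply/funext => Z; rewrite /herm (negbTE ab) mulN1r.
  have C3 := smooth_onZ (-1) openT C2.
  split; first exact: smooth_onD openT C1 C3.
  by eexists => Z; rewrite (lapD openT C1 C3 I) (lapZ (-1) openT C2 I) !lap_coordM;
    reflexivity.
by exists (herm a b); split=> // Z Z0; exact: eta_class.
Qed.

(** Folds a double sum onto the pairs $a \le b$. *)
Lemma sum_upper (G : 'I_n.+1 -> 'I_n.+1 -> R) : \sum_(a < n.+1) \sum_(b < n.+1) G a b =
  \sum_(a < n.+1) \sum_(b < n.+1) (if (a < b)%N then G a b + G b a
                 else if a == b then G a b else 0).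
Proof.
have split3 (H : 'I_n.+1 -> 'I_n.+1 -> R) : \sum_(a < n.+1) \sum_(b < n.+1) H a b =
    \sum_(a < n.+1) \sum_(b < n.+1) (if (a < b)%N then H a b else 0) +
    \sum_(a < n.+1) \sum_(b < n.+1) (if a == b then H a b else 0) +
    \sum_(a < n.+1) \sum_(b < n.+1) (if (b < a)%N then H a b else 0).
  rewrite -!big_split/=; apply: eq_bigr => a _; rewrite -!big_split/=.
  apply: eq_bigr => b _; rewrite -val_eqE/=.
  by case: ltngtP => _; rewrite ?addr0 ?add0r.
rewrite split3 [X in _ + X]exchange_big/= -!big_split/=; apply: eq_bigr => a _.
rewrite -!big_split/=; apply: eq_bigr => b _; rewrite -val_eqE/=.
by case: ltngtP => _; rewrite ?addr0 ?add0r.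
Qed.

Lemma sum_herm (S T : 'I_n.+1 -> 'I_n.+1 -> R) Z :
  \sum_(a < n.+1) \sum_(b < n.+1) (S a b * herm_re a b Z + T a b * herm_im a b Z) =
  \sum_(a < n.+1) \sum_(b < n.+1)
    (if (a < b)%N then S a b + S b a else if a == b then S a b
     else T a b - T b a) * herm a b Z.
Proof.
under eq_bigr do rewrite big_split/=.
rewrite big_split/= sum_upper [X in _ + X]exchange_big/= [X in _ + X]sum_upper.
rewrite [X in _ + X]exchange_big/= -big_split/=; apply: eq_bigr => a _.
rewrite -big_split/=; apply: eq_bigr => b _; rewrite /herm -!val_eqE/=.
case: ltngtP => ab; rewrite ?add0r ?addr0.
- by rewrite /herm_re; ring.
- by rewrite /herm_im; ring.
- rewrite (_ : b = a); last exact/val_inj.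
  by rewrite /herm_im; ring.
Qed.

(** The classification gives a real quadratic form in 2n + 2 variables; averaging it
    with its composition with [rot90], which leaves the function unchanged, makes it
    Hermitian. *)
Lemma ker_LL_span f : (0 < n)%N -> ker_LL f ->
  exists c : 'I_n.+1 -> 'I_n.+1 -> R, forall p, f p = \sum_a \sum_b c a b * eta a b p.
Proof.
move=> n0 [Cf LLf].
have M3 : (3 < M)%N by lia.
have [|B HB] := classification M3 (smooth_lifted Cf) (@homog_lifted f).
  move=> Z /ex_zabs2[i Zi].
  by rewrite (lifted_LL Cf (Zi : chart_dom i Z)) LLf mulr0.
have spl (q : 'rV[R]_M) : \sum_k \sum_l B k l * (q 0 k * q 0 l) =
    \sum_a \sum_b (B (lshift _ a) (lshift _ b) * (zre q a * zre q b)
     + B (lshift _ a) (rshift _ b) * (zre q a * zim q b)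
     + B (rshift _ a) (lshift _ b) * (zim q a * zre q b)
     + B (rshift _ a) (rshift _ b) * (zim q a * zim q b)).
  rewrite big_split_ord/= -big_split/=; apply: eq_bigr => a _.
  by rewrite !big_split_ord/= !big_split/= !addrA.
pose S a b : R := 2^-1 * (B (lshift _ a) (lshift _ b) + B (rshift _ a) (rshift _ b)).
pose T a b : R := 2^-1 * (B (rshift _ a) (lshift _ b) - B (lshift _ a) (rshift _ b)).
eexists; apply: lift_class_eq => Z Z0.
have n2r : norm2 (rot90 Z) = norm2 Z.
  rewrite !norm2E; apply: eq_bigr => k _.
  by rewrite /zabs2 zre_rot90 zim_rot90; ring.
have r0 : rot90 Z != 0 by rewrite -norm2_eq0 n2r norm2_eq0.
have E : lifted f Z =
    (\sum_a \sum_b (S a b * herm_re a b Z + T a b * herm_im a b Z)) / norm2 Z.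
  have -> : lifted f Z = 2^-1 * (lifted f Z + lifted f (rot90 Z)).
    by rewrite /lifted class_rot90; field.
  rewrite (HB _ Z0) (HB _ r0) n2r -mulrDl mulrA; congr (_ / _).
  rewrite !spl -big_split/= mulr_sumr; apply: eq_bigr => a _.
  rewrite -big_split/= mulr_sumr; apply: eq_bigr => b _.
  rewrite !zre_rot90 !zim_rot90 /S /T /herm_re /herm_im.
  by move: (B _ _) (B _ _) (B _ _) (B _ _) => *; field.
rewrite -[f _]/(lifted f Z) E sum_herm mulr_suml; apply: eq_bigr => a _.
rewrite mulr_suml; apply: eq_bigr => b _.
by rewrite eta_class // mulrA; reflexivity.
Qed.

End KernelLL.

(** * Iterated integrals of rapidly decaying functions *)

Section RealLine.
Variable R : realType.
Local Notation mu := (@lebesgue_measure R).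
Implicit Types (f : R -> R) (s t h r : R).

Lemma integral_oneDsqrT : (\int[mu]_x (oneDsqr x)^-1%:E = (pi : R)%:E)%E.
Proof.
rewrite (@ge0_symfun_integralT R (fun x => (oneDsqr x)^-1)).
- rewrite -set_itvcy integral0y_oneDsqr -EFinM; congr (_%:E).
  by rewrite mulrCA divff ?mulr1 // pnatr_eq0.
- by move=> x; rewrite invr_ge0 (le_trans ler01).
- exact: continuous_oneDsqrV.
- by move=> x /=; rewrite /oneDsqr sqrrN.
Qed.

Lemma is_derive_affine r h t : is_derive t 1 (fun x : R => r * x + h) r.
Proof.
apply: (is_derive_eqF (is_deriveDF (is_deriveMF (is_derive_cstF _ _ r)
  (is_derive_id _ _)) (is_derive_cstF _ _ h))).
by rewrite mul0r add0r mulr1 addr0.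
Qed.

Lemma integral_affine f r h : 0 < r -> continuous f -> (forall x, 0 <= f x) ->
  (\int[mu]_x (f x)%:E = \int[mu]_x (f (r * x + h)%R * r)%:E)%E.
Proof.
move=> r0 cf f0; pose F x := r * x + h.
have dF x : derive1 F x = r by rewrite derive1E; have [_ ->] := is_derive_affine r h x.
have dFE : derive1 F = cst r by apply/funext => x; exact: dF.
rewrite (@increasing_ge0_integration_by_substitutionT R F f) //.
- by apply: eq_integral => x _; rewrite /= dFE.
- by move=> x y xy; rewrite ltrD2r ltr_pM2l.
- by rewrite dFE; exact: cst_continuous.
- by rewrite dFE; exact: is_cvg_cst.
- by rewrite dFE; exact: is_cvg_cst.
- apply/cvgrNyPle => A; exists ((A - h) / r); split; first exact: num_real.
  by move=> x; rewrite ltr_pdivlMr // mulrC ltrBrDr => /ltW.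
- apply/cvgryPge => A; exists ((A - h) / r); split; first exact: num_real.
  by move=> x; rewrite ltr_pdivrMr // mulrC ltrBlDr => /ltW.
Qed.

(** The dominating functions; their integrals are explicit, and so are those of the
    functions obtained by integrating out one variable. *)
Definition bump s t : R := (s + t ^+ 2)^-1.

Lemma bump_den s t : 0 < s -> 0 < s + t ^+ 2.
Proof. by move=> s0; rewrite ltr_wpDr // sqr_ge0. Qed.

Lemma bump_gt0 s t : 0 < s -> 0 < bump s t.
Proof. by move=> s0; rewrite invr_gt0 bump_den. Qed.

Lemma bump_scale (q t : R) : 0 < q ->
  (1 + (q^-1 * t) ^+ 2)^-1 * q^-1 = q * (q ^+ 2 + t ^+ 2)^-1.
Proof.
move=> q0; have d0 : 0 < q ^+ 2 + t ^+ 2 by rewrite ltr_wpDr ?sqr_ge0 ?exprn_gt0.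
by field; rewrite !gt_eqF.
Qed.

Lemma continuous_bump s : 0 < s -> continuous (bump s).
Proof.
move=> s0 t; apply: cvgV; first by rewrite gt_eqF // bump_den.
apply: cvgD; first exact: cvg_cst.
exact: exprn_continuous.
Qed.

Lemma integral_bump s : 0 < s ->
  (\int[mu]_t (bump s t)%:E = (pi / Num.sqrt s)%:E)%E.
Proof.
move=> s0; pose r := (Num.sqrt s)^-1.
have q0 : 0 < Num.sqrt s by rewrite sqrtr_gt0.
have r0 : 0 < r by rewrite invr_gt0.
have s2 : s = Num.sqrt s ^+ 2 by rewrite sqr_sqrtr // ltW.
have p0 (x : R) : 0 <= (oneDsqr x)^-1 by rewrite invr_ge0 (le_trans ler01).
have := integral_oneDsqrT; rewrite (integral_affine 0 r0 (@continuous_oneDsqrV R) p0).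
under eq_integral => t _.
  rewrite (_ : _ * _ = Num.sqrt s * bump s t); last first.
    by rewrite addr0 /bump {2}s2 -bump_scale.
  rewrite EFinM.
  over.
have mB : measurable_fun setT (fun t : R => (bump s t)%:E).
  apply/measurable_EFinP; apply: continuous_measurable_fun.
  exact: continuous_bump.
have B0 (t : R) : setT t -> (0 <= (bump s t)%:E)%E.
  by move=> _; rewrite lee_fin ltW // bump_gt0.
have -> : (\int[mu]_t ((Num.sqrt s)%:E * (bump s t)%:E) =
    (Num.sqrt s)%:E * \int[mu]_t (bump s t)%:E)%E.
  by apply: ge0_integralZl => //; rewrite lee_fin ltW.
move=> E.
have -> : (\int[mu]_t (bump s t)%:E)%E
   = ((r%:E) * ((Num.sqrt s)%:E * \int[mu]_t (bump s t)%:E))%E.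
  by rewrite muleA -EFinM mulVf ?gt_eqF // mul1e.
by rewrite E -EFinM mulrC.
Qed.

Lemma integrable_bump s : 0 < s -> mu.-integrable setT (EFin \o bump s).
Proof.
move=> s0; apply/integrableP; split.
  apply/measurable_EFinP; apply: continuous_measurable_fun.
  exact: continuous_bump.
under eq_integral => t _ do rewrite /= ger0_norm ?(ltW (bump_gt0 _ _)) //.
by rewrite integral_bump // ltry.
Qed.

Lemma integrable_dom f s C : 0 < s -> continuous f ->
  (forall t, `|f t| <= C * bump s t) -> mu.-integrable setT (EFin \o f).
Proof.
move=> s0 cf fC.
have := @integrableZl _ _ _ mu setT measurableT C _ (integrable_bump s0).
apply: le_integrable => //.
  by apply/measurable_EFinP; exact: continuous_measurable_fun.
by move=> t _ /=; rewrite lee_fin (le_trans (fC t)) // ler_norm.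
Qed.

Lemma Rintegral_dom_le f s C : 0 < s -> continuous f ->
  (forall t, `|f t| <= C * bump s t) ->
  `|\int[mu]_t f t| <= C * (pi / Num.sqrt s).
Proof.
move=> s0 cf fC.
have If := integrable_dom s0 cf fC.
apply: le_trans (le_normr_Rintegral measurableT If) _.
have -> : C * (pi / Num.sqrt s) = \int[mu]_t (C * bump s t).
  rewrite (RintegralZl C measurableT (integrable_bump s0)).
  by rewrite /Rintegral integral_bump.
have cB : continuous (fun t => C * bump s t).
  by move=> t; apply: cvgM; [exact: cvg_cst|exact: continuous_bump].
apply: le_Rintegral => //.
- by apply: (@integrable_dom _ s C) => // [t|t]; [apply: cvg_norm; exact: cf|
    rewrite normr_id].
- apply: (@integrable_dom _ s C) => // t.
  by rewrite ger0_norm // (le_trans _ (fC t)).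
Qed.

Lemma Rintegral_cvg_dom (f_ : nat -> R -> R) f s C : 0 < s ->
  (forall m, continuous (f_ m)) -> continuous f ->
  (forall m t, `|f_ m t| <= C * bump s t) ->
  (forall t, f_ m t @[m --> \oo] --> f t) ->
  \int[mu]_t f_ m t @[m --> \oo] --> \int[mu]_t f t.
Proof.
move=> s0 cf_ cf fC ff.
have fCf t : `|f t| <= C * bump s t.
  have H : (fun m => `|f_ m t|) @ \oo --> `|f t| by apply: cvg_norm; exact: ff.
  by apply: (cvgr_to_le H); apply: nearW => m; exact: fC.
have If := integrable_dom s0 cf fCf.
have meas (g : R -> R) : continuous g -> measurable_fun setT (EFin \o g : R -> \bar R).
  by move=> cg; apply/measurable_EFinP; exact: continuous_measurable_fun.
have [] := @dominated_convergence _ _ _ mu setT measurableT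
  (fun m => EFin \o f_ m) (EFin \o f) (fun t => C%:E * (bump s t)%:E)%E.
- by move=> m; apply: meas; exact: cf_.
- exact: meas.
- by apply: aeW => t _; apply: cvg_EFin; [exact: nearW|exact: ff].
- exact: (@integrableZl _ _ _ mu setT measurableT C _ (integrable_bump s0)).
- by apply: aeW => t m _; rewrite /= lee_fin; exact: fC.
move=> _ _ H; apply: fine_cvg; rewrite fineK; first exact: H.
exact: integrable_fin_num.
Qed.

(** Substitution is available for nonnegative functions; adding a multiple of the
    bump makes [f] nonnegative. *)
Lemma Rintegral_translate f s C h : 0 < s -> continuous f ->
  (forall t, `|f t| <= C * bump s t) ->
  \int[mu]_t f (t + h) = \int[mu]_t f t.
Proof.
move=> s0 cf fC.
have cB : continuous (fun t => C * bump s t).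
  by move=> t; apply: cvgM; [exact: cvg_cst|exact: continuous_bump].
have B0 t : 0 <= C * bump s t by exact: le_trans (fC t).
have IB : mu.-integrable setT (EFin \o (fun t => C * bump s t)).
  by apply: (@integrable_dom _ s C) => // t; rewrite ger0_norm.
have If := integrable_dom s0 cf fC.
have csh (g : R -> R) : continuous g -> continuous (fun t => g (t + h)).
  move=> cg t; have H : (fun t => t + h) @ t --> t + h.
    by apply: cvgD; [exact: cvg_id|exact: cvg_cst].
  exact: (cvg_comp _ _ H (cg (t + h))).
have sh (g : R -> R) : continuous g -> (forall t, 0 <= g t) ->
    mu.-integrable setT (EFin \o g) ->
    mu.-integrable setT (EFin \o (fun t => g (t + h))) /\
    \int[mu]_t g (t + h) = \int[mu]_t g t.
  move=> cg g0 Ig.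
  have E : (\int[mu]_t (g (t + h))%:E = \int[mu]_t (g t)%:E)%E.
    rewrite [RHS](@integral_affine _ 1 h) //.
    by apply: eq_integral => t _; rewrite mul1r mulr1.
  split; last by rewrite /Rintegral E.
  apply/integrableP; split.
    by apply/measurable_EFinP; apply: continuous_measurable_fun; exact: csh.
  under eq_integral => t _ do rewrite /= ger0_norm ?g0 //.
  rewrite E; move/integrableP : Ig => [_].
  by under eq_integral => t _ do rewrite /= ger0_norm ?g0 //.
pose g t := f t + C * bump s t.
have cg : continuous g by move=> t; apply: cvgD; [exact: cf|exact: cB].
have g0 t : 0 <= g t.
  have := fC t; rewrite ler_norml => /andP[+ _].
  by rewrite /g -subr_ge0 opprK.
have Ig : mu.-integrable setT (EFin \o g).
  have := integrableD measurableT If IB; apply: eq_integrable => //.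
have [Igh Eg] := sh g cg g0 Ig.
have [IBh EB] := sh _ cB B0 IB.
have -> : \int[mu]_t f t = \int[mu]_t (g t - C * bump s t).
  by apply: eq_Rintegral => t _; rewrite /g addrK.
have -> : \int[mu]_t f (t + h) = \int[mu]_t (g (t + h) - C * bump s (t + h)).
  by apply: eq_Rintegral => t _; rewrite /g addrK.
by rewrite !RintegralB // Eg EB.
Qed.

Lemma Rintegral_gt0 f : continuous f -> mu.-integrable setT (EFin \o f) ->
  (forall t, 0 < f t) -> 0 < \int[mu]_t f t.
Proof.
move=> cf If f0.
have [|c _ fc] := @EVT_min R f 0 1 ler01; first exact: continuous_subspaceT.
rewrite /Rintegral -lte_fin fineK; last exact: integrable_fin_num.
apply: (@lt_le_trans _ _ (\int[mu]_(x in `[0%R, 1%R]) (f c)%:E)%E).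
  rewrite integral_cst //= lebesgue_measure_itv/= lte01 oppr0 adde0 mule1.
  by rewrite lte_fin.
apply: (@le_trans _ _ (\int[mu]_(x in `[0%R, 1%R]) (f x)%:E)%E).
  apply: ge0_le_integral => //=.
  - by move=> x _; rewrite lee_fin ltW.
  - by apply/measurable_EFinP/measurable_funTS; exact: continuous_measurable_fun.
apply: ge0_subset_integral => //=.
- by apply/measurable_EFinP; exact: continuous_measurable_fun.
- by move=> x _; rewrite lee_fin ltW.
Qed.

End RealLine.

Section IteratedIntegral.
Variable R : realType.
Local Notation mu := (@lebesgue_measure R).

(** Functions of size O(|x|^-k) at infinity. The shift [s] absorbs the
    coordinates that have already been fixed when integrating one variable at a
    time. *)
Definition decay (N : nat) (s : R) (k : nat) (C : R) (f : 'rV[R]_N -> R) : Prop :=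
  continuous f /\ forall x, `|f x| <= C / Num.sqrt (s + norm2 x) ^+ k.

Definition slice (N : nat) (t : R) (f : 'rV[R]_N.+1 -> R) (y : 'rV[R]_N) : R :=
  f (row_mx (t%:M : 'rV[R]_1) y).

Definition cons_rV (N : nat) (t : R) (y : 'rV[R]_N) : 'rV[R]_N.+1 :=
  row_mx (t%:M : 'rV[R]_1) y.

Lemma iterated_integralS N (f : 'rV[R]_N.+1 -> R) :
  iterated_integral f = \int[mu]_t iterated_integral (slice t f).
Proof. by []. Qed.

Lemma cons_rV0 N t (y : 'rV[R]_N) : cons_rV t y 0 ord0 = t.
Proof.
by rewrite mxE; case: splitP => // i _; rewrite ord1 mxE eqxx.
Qed.

Lemma cons_rVS N t (y : 'rV[R]_N) j : cons_rV t y 0 (lift ord0 j) = y 0 j.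
Proof.
rewrite mxE; case: splitP => [i|i /eqP]; first by case: i => -[].
by rewrite /= /bump add1n eqSS => /eqP/val_inj ->.
Qed.

Lemma norm2_cons N t (y : 'rV[R]_N) : norm2 (cons_rV t y) = t ^+ 2 + norm2 y.
Proof.
rewrite /norm2 big_ord_recl cons_rV0; congr (_ + _).
by apply: eq_bigr => j _; rewrite cons_rVS.
Qed.

Lemma cvg_cons_rV (T : Type) (F : set_system T) {FF : Filter F} N
    (u : T -> R) (v : T -> 'rV[R]_N) t (y : 'rV[R]_N) :
  u @ F --> t -> v @ F --> y -> (fun a => cons_rV (u a) (v a)) @ F --> cons_rV t y.
Proof.
move=> ut vy; apply: cvg_rV => j.
case: (unliftP ord0 j) => [l ->|->].
  rewrite cons_rVS; under eq_fun do rewrite cons_rVS.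
  exact: (cvg_comp _ _ vy (@coord_continuous R 1 N 0 l y)).
by rewrite cons_rV0; under eq_fun do rewrite cons_rV0.
Qed.

Lemma sqrt_den_gt0 N s (x : 'rV[R]_N) : 0 < s -> 0 < Num.sqrt (s + norm2 x).
Proof. by move=> s0; rewrite sqrtr_gt0 ltr_wpDr // norm2_ge0. Qed.

Lemma decay_C_ge0 N s k C (f : 'rV[R]_N -> R) : 0 < s -> decay s k C f -> 0 <= C.
Proof.
move=> s0 [_ /(_ 0) H]; have := le_trans (normr_ge0 _) H.
by rewrite pmulr_lge0 // invr_gt0 exprn_gt0 // sqrt_den_gt0.
Qed.

Lemma decay_slice N s k C (f : 'rV[R]_N.+1 -> R) t :
  decay s k C f -> decay (s + t ^+ 2) k C (slice t f).
Proof.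
move=> [cf fC]; split; last first.
  by move=> y; have := fC (cons_rV t y); rewrite norm2_cons addrA.
move=> y; have H : (fun y : 'rV[R]_N => cons_rV t y) @ y --> cons_rV t y.
  by apply: (@cvg_cons_rV _ (nbhs y)); [exact: cvg_cst|exact: cvg_id].
exact: (cvg_comp _ _ H (cf (cons_rV t y))).
Qed.

Lemma decay_mono N s s' k C (f : 'rV[R]_N -> R) : 0 < s -> s <= s' ->
  decay s' k C f -> decay s k C f.
Proof.
move=> s0 ss' Df; have C0 := decay_C_ge0 (lt_le_trans s0 ss') Df.
case: Df => cf fC; split=> // x; apply: le_trans (fC x) _.
apply: ler_wpM2l => //; rewrite lef_pV2 ?posrE ?exprn_gt0 ?sqrt_den_gt0 //.
  apply: lerXn2r; rewrite ?nnegrE ?sqrtr_ge0 //.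
  by rewrite ler_wsqrtr // lerD2r.
exact: lt_le_trans ss'.
Qed.

Lemma decay_lin N s k C D (f g : 'rV[R]_N -> R) a : decay s k C f -> decay s k D g ->
  decay s k (`|a| * C + D) (fun x => a * f x + g x).
Proof.
move=> [cf fC] [cg gD]; split.
  by move=> x; exact: (cvgD (cvgM (cvg_cst a) (cf x)) (cg x)).
move=> x; apply: le_trans (ler_normD _ _) _; rewrite mulrDl normrM -mulrA.
by apply: lerD; [apply: ler_wpM2l|].
Qed.

(** The tail bound used at each integration: with $j \ge 2$ one factor
    $(s+t^2)^{-1}$ is integrable, the others are at most $s^{-1/2}$. *)
Lemma bump_bound (s t : R) (j : nat) : 0 < s ->
  (Num.sqrt (s + t ^+ 2) ^+ j.+2)^-1 <= (Num.sqrt s ^+ j)^-1 * bump s t.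
Proof.
move=> s0; have q0 : 0 < Num.sqrt s by rewrite sqrtr_gt0.
have d0 := bump_den t s0.
have qd : Num.sqrt s <= Num.sqrt (s + t ^+ 2).
  by rewrite ler_wsqrtr // lerDl sqr_ge0.
rewrite -[j.+2]addn2 (exprD _ j 2) sqr_sqrtr ?(ltW d0) // invfM ler_wpM2r //.
  by rewrite ltW // bump_gt0.
rewrite lef_pV2 ?posrE ?exprn_gt0 ?(lt_le_trans q0 qd) //.
by apply: lerXn2r; rewrite ?nnegrE ?sqrtr_ge0.
Qed.

(** The bound, linearity, dominated convergence and positivity are proved together
    by induction on [N], because each of them for [N.+1] variables needs continuity
    and domination of the inner integrals, that is, the bound and dominated
    convergence for [N] variables. *)
Definition integral_props (N : nat) : Prop :=
  forall k, (N < k)%N -> forall s : R, 0 < s ->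
  [/\ forall C f, decay s k C f ->
        `|@iterated_integral R N f| <= C * pi ^+ N / Num.sqrt s ^+ (k - N),
      forall C D f g a, decay s k C f -> decay s k D g ->
        @iterated_integral R N (fun x => a * f x + g x) =
          a * iterated_integral f + iterated_integral g,
      forall C (f_ : nat -> 'rV[R]_N -> R) f, (forall m, decay s k C (f_ m)) ->
        decay s k C f -> (forall x, f_ m x @[m --> \oo] --> f x) ->
        iterated_integral (f_ m) @[m --> \oo] --> iterated_integral f
    & forall C f, decay s k C f -> (forall x, 0 < f x) ->
        0 < @iterated_integral R N f].

(** The outer integration falls under the one-variable results above. *)
Lemma inner_props N k (s : R) : integral_props N -> (N.+1 < k)%N -> 0 < s ->
  forall C (f : 'rV[R]_N.+1 -> R), decay s k C f ->
  continuous (fun t => iterated_integral (slice t f)) /\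
  forall t, `|iterated_integral (slice t f)| <=
    C * pi ^+ N / Num.sqrt s ^+ (k - N.+2) * bump s t.
Proof.
move=> IH Nk s0 C f Df.
have Nk' : (N < k)%N := ltn_trans (ltnSn N) Nk.
have kj : (k - N = (k - N.+2).+2)%N by lia.
have st (t : R) : 0 < s + t ^+ 2 := bump_den t s0.
have pi0 : 0 <= (pi : R) by rewrite ltW // pi_gt0.
split=> t; last first.
  have [B _ _ _] := IH k Nk' _ (st t).
  apply: le_trans (B _ _ (decay_slice t Df)) _; rewrite kj -[leRHS]mulrA.
  apply: ler_wpM2l; last exact: bump_bound.
  by rewrite mulr_ge0 ?exprn_ge0 //; exact: decay_C_ge0 Df.
apply/(@cvg_nbhsP _ R^o) => w wt.
have [_ _ L _] := IH k Nk' _ s0.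
have ds r : decay s k C (slice r f).
  apply: decay_mono (decay_slice r Df) => //.
  by rewrite lerDl sqr_ge0.
apply: (L C (fun m => slice (w m) f) (slice t f)) => // y.
have H : (fun m => cons_rV (w m) y) @ \oo --> cons_rV t y.
  by apply: cvg_cons_rV => //; exact: cvg_cst.
exact: (cvg_comp _ _ H (Df.1 (cons_rV t y))).
Qed.

Lemma iterated_integral_props N : integral_props N.
Proof.
elim: N => [|N IH] k Nk s s0.
  have n0 (x : 'rV[R]_0) : norm2 x = 0 by rewrite /norm2 big_ord0.
  split=> [C f [_ fC]|C D f g a _ _|C f_ f _ _ H|C f _ f0] /=.
  - by have := fC 0; rewrite n0 addr0 expr0 mulr1 subn0.
  - by [].
  - exact: H.
  - exact: f0.
have Nk' : (N < k)%N := ltn_trans (ltnSn N) Nk.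
have kj1 : (k - N.+1 = (k - N.+2).+1)%N by lia.
have st (t : R) : 0 < s + t ^+ 2 := bump_den t s0.
have Gc C (f : 'rV[R]_N.+1 -> R) (Df : decay s k C f) :=
  (inner_props IH Nk s0 Df).1.
have Gb C (f : 'rV[R]_N.+1 -> R) (Df : decay s k C f) :=
  (inner_props IH Nk s0 Df).2.
have Gi C (f : 'rV[R]_N.+1 -> R) : decay s k C f ->
    mu.-integrable setT (EFin \o (fun t => iterated_integral (slice t f))).
  by move=> Df; exact: (integrable_dom s0 (Gc _ _ Df) (Gb _ _ Df)).
split.
- move=> C f Df; rewrite iterated_integralS.
  apply: le_trans (Rintegral_dom_le s0 (Gc _ _ Df) (Gb _ _ Df)) _.
  rewrite kj1 exprS [Num.sqrt s ^+ _.+1]exprS le_eqVlt; apply/orP; left; apply/eqP.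
  have q0 : Num.sqrt s != 0 by rewrite gt_eqF // sqrtr_gt0.
  have qj0 : Num.sqrt s ^+ (k - N.+2) != 0 by rewrite expf_neq0.
  move: q0 qj0; move: (Num.sqrt s ^+ (k - N.+2)) (Num.sqrt s) => q q' *.
  by field; apply/andP.
- move=> C D f g a Df Dg; rewrite !iterated_integralS.
  have -> : \int[mu]_t iterated_integral (slice t (fun x => a * f x + g x)) =
      \int[mu]_t (a * iterated_integral (slice t f) + iterated_integral (slice t g)).
    apply: eq_Rintegral => t _; have [_ L _ _] := IH k Nk' _ (st t).
    exact: (L _ _ _ _ a (decay_slice t Df) (decay_slice t Dg)).
  rewrite RintegralD //; last 2 first.
  + have := @integrableZl _ _ _ mu setT measurableT a _ (Gi _ _ Df).
    by apply: eq_integrable.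
  + exact: Gi Dg.
  by rewrite RintegralZl //; exact: Gi Df.
- move=> C f_ f Df_ Df ff; rewrite iterated_integralS.
  apply: (Rintegral_cvg_dom s0 (fun m => Gc _ _ (Df_ m)) (Gc _ _ Df)
    (fun m => Gb _ _ (Df_ m))) => t.
  have [_ _ L _] := IH k Nk' _ (st t).
  apply: (L C (fun m => slice t (f_ m))); last by move=> y; exact: ff.
    by move=> m; exact: decay_slice.
  exact: decay_slice.
- move=> C f Df f0; rewrite iterated_integralS.
  apply: Rintegral_gt0; [exact: Gc Df|exact: Gi Df|] => t.
  have [_ _ _ P] := IH k Nk' _ (st t).
  by apply: (P C) => [|y]; [exact: decay_slice|exact: f0].
Qed.

Lemma iterated_integral_lin N k (s : R) C D (f g : 'rV[R]_N -> R) a :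
  (N < k)%N -> 0 < s ->
  decay s k C f -> decay s k D g ->
  iterated_integral (fun x => a * f x + g x) =
  a * iterated_integral f + iterated_integral g.
Proof.
by move=> Nk s0 Df Dg; have [_ L _ _] := iterated_integral_props Nk s0; exact: L Df Dg.
Qed.

Lemma iterated_integral_cvg N k (s : R) C (f_ : nat -> 'rV[R]_N -> R) f :
  (N < k)%N -> 0 < s ->
  (forall m, decay s k C (f_ m)) -> decay s k C f ->
  (forall x, f_ m x @[m --> \oo] --> f x) ->
  iterated_integral (f_ m) @[m --> \oo] --> iterated_integral f.
Proof.
by move=> Nk s0 Df Dg; have [_ _ L _] := iterated_integral_props Nk s0; exact: L Df Dg.
Qed.

Lemma iterated_integral_gt0 N k (s : R) C (f : 'rV[R]_N -> R) : (N < k)%N -> 0 < s ->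
  decay s k C f -> (forall x, 0 < f x) -> 0 < iterated_integral f.
Proof.
by move=> Nk s0 Df; have [_ _ _ P] := iterated_integral_props Nk s0; exact: P Df.
Qed.

Lemma sliceE N t (f : 'rV[R]_N.+1 -> R) y : slice t f y = f (cons_rV t y).
Proof. by []. Qed.

Lemma cons_rV_shift0 N t (y : 'rV[R]_N) h :
  cons_rV t y + h *: delta_mx 0 ord0 = cons_rV (t + h) y.
Proof.
apply/rowP => l; rewrite [LHS]mxE [X in _ + X]mxE [X in _ + _ * X]mxE.
case: (unliftP ord0 l) => [l' ->|->].
  by rewrite !cons_rVS eq_sym (negbTE (neq_lift _ _)) andbF mulr0 addr0.
by rewrite !cons_rV0 !eqxx mulr1.
Qed.

Lemma cons_rV_shiftS N t (y : 'rV[R]_N) h b :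
  cons_rV t y + h *: delta_mx 0 (lift ord0 b) = cons_rV t (y + h *: delta_mx 0 b).
Proof.
apply/rowP => l; rewrite [LHS]mxE [X in _ + X]mxE [X in _ + _ * X]mxE.
case: (unliftP ord0 l) => [l' ->|->].
  by rewrite !cons_rVS !mxE (inj_eq lift_inj).
by rewrite !cons_rV0 (negbTE (neq_lift _ _)) andbF mulr0 addr0.
Qed.

Lemma iterated_integral_translate N (a : 'I_N) (h : R) : forall k (s C : R) f,
  (N < k)%N -> 0 < s -> decay s k C f ->
  iterated_integral (fun x => f (x + h *: delta_mx 0 a)) = @iterated_integral R N f.
Proof.
elim: N a => [|N IH] a k s C f; first by case: a.
move=> Nk s0 Df; rewrite !iterated_integralS.
have Nk' : (N < k)%N := ltn_trans (ltnSn N) Nk.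
case: (unliftP ord0 a) => [b ->|->].
  apply: eq_Rintegral => t _.
  rewrite -(IH b k (s + t ^+ 2) C _ Nk' (bump_den t s0) (decay_slice t Df)).
  congr iterated_integral; apply/funext => y.
  by rewrite !sliceE cons_rV_shiftS.
pose G t := iterated_integral (slice t f).
have -> : \int[mu]_t iterated_integral (slice t (fun x => f (x + h *: delta_mx 0 ord0)))
   = \int[mu]_t G (t + h).
  apply: eq_Rintegral => t _; rewrite /G; congr iterated_integral.
  by apply/funext => y; rewrite !sliceE cons_rV_shift0.
have [cG GD] := inner_props (@iterated_integral_props N) Nk s0 Df.
exact: (Rintegral_translate h s0 cG GD).
Qed.

End IteratedIntegral.

(** * Averages over projective space *)

Section DivergenceTheorem.
Variables (R : realType) (N : nat).
Local Notation e_ a := (delta_mx 0 a : 'rV[R]_N).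

Lemma norm2_shift (x : 'rV[R]_N) a (h : R) : `|h| <= 1 ->
  1 + norm2 x <= 3 * (1 + norm2 (x + h *: e_ a)).
Proof.
move=> h1.
have -> : norm2 (x + h *: e_ a) = norm2 x + 2 * h * x 0 a + h ^+ 2.
  rewrite /norm2 (bigD1 a)//= [X in _ = X + _ + _](bigD1 a)//= !mxE !eqxx mulr1.
  rewrite (eq_bigr (fun k => x 0 k ^+ 2)) => [|k ka]; first by ring.
  by rewrite !mxE (negbTE ka) mulr0 addr0.
have xa : x 0 a ^+ 2 <= norm2 x.
  by rewrite /norm2 (bigD1 a)//= lerDl sumr_ge0 // => k _; exact: sqr_ge0.
have h2 : h ^+ 2 <= 1.
  by rewrite -[leRHS](expr1n _ 2) -real_normK ?num_real // lerXn2r ?nnegrE.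
have := sqr_ge0 (x 0 a + 3 / 2 * h).
move: (norm2 x) (x 0 a) xa h2; clear => s y xa h2 H; nra.
Qed.

Lemma decay_translate k C f a (h : R) : `|h| <= 1 -> decay 1 k C f ->
  decay 1 k (C * Num.sqrt 3 ^+ k) (fun x => f (x + h *: e_ a)).
Proof.
move=> h1 Df; have C0 := decay_C_ge0 ltr01 Df; case: Df => cf fC; split.
  move=> x; have H : (fun y => y + h *: e_ a) @ x --> x + h *: e_ a.
    by apply: (@cvgD _ _ _ (nbhs x)); [exact: cvg_id|exact: cvg_cst].
  exact: (cvg_comp _ _ H (cf _)).
move=> x; apply: le_trans (fC _) _; rewrite -mulrA; apply: ler_wpM2l => //.
have q0 (y : 'rV[R]_N) := sqrt_den_gt0 y (ltr01 : 0 < 1 :> R).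
rewrite ler_pdivlMr ?exprn_gt0 // mulrC ler_pdivrMr ?exprn_gt0 //.
rewrite -exprMn -sqrtrM ?ler0n //.
apply: lerXn2r; rewrite ?nnegrE ?sqrtr_ge0 //.
by rewrite ler_wsqrtr // norm2_shift.
Qed.

Lemma harmonic_dnbhs : @harmonic R @ \oo --> (0 : R)^'.
Proof.
move=> A HA.
have H : \forall m \near \oo, @harmonic R m != 0 -> A (@harmonic R m).
  exact: (@cvg_harmonic R _ HA).
rewrite nbhs_simpl/=; apply: filterS H => m; apply.
by change (m.+1%:R^-1 != 0 :> R); rewrite invr_eq0 pnatr_eq0.
Qed.

(** By translation invariance the difference quotients have integral zero, and they
    are dominated by the mean value theorem. *)
Lemma iterated_integral_partial a k C D (f : 'rV[R]_N -> R) : (N < k)%N ->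
  (forall x, derivable f x (e_ a)) -> decay 1 k C f -> decay 1 k D (partial a f) ->
  iterated_integral (partial a f) = 0.
Proof.
move=> Nk df Df Dp; pose r (m : nat) : R := m.+1%:R.
have r0 m : r m != 0 by rewrite pnatr_eq0.
have h1 m : `|(r m)^-1| <= 1.
  by rewrite ger0_norm ?invr_ge0 ?ler0n // invf_le1 ?ltr0n // ler1n.
pose q m x := r m * f (x + (r m)^-1 *: e_ a) + (- r m * f x + 0).
have D0 : decay 1 k 0 (fun _ : 'rV[R]_N => 0 : R).
  by split=> [x|x]; [exact: cst_continuous|rewrite normr0 mul0r].
have DN m := decay_lin (- r m) Df D0.
have Dsh m := decay_translate a (h1 m) Df.
have Iq m : iterated_integral (q m) = 0.
  rewrite (iterated_integral_lin (r m) Nk ltr01 (Dsh m) (DN m)).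
  rewrite (iterated_integral_lin (- r m) Nk ltr01 Df D0).
  rewrite (iterated_integral_translate a _ Nk ltr01 Df).
  have -> : iterated_integral (fun _ : 'rV[R]_N => 0 : R) = 0.
    have := iterated_integral_lin 1 Nk ltr01 D0 D0.
    rewrite (_ : (fun x : 'rV[R]_N => 1 * 0 + 0) = fun=> 0); last first.
      by apply/funext => x; rewrite mulr0 addr0.
    by move/eqP; rewrite mul1r -subr_eq subrr eq_sym => /eqP.
  by rewrite addr0 mulNr subrr.
have qE m x : exists2 s : R, `|s| <= 1 & q m x = partial a f (x + s *: e_ a).
  have [s _|s sh E] := @partial_MVT _ _ f x a (r m)^-1; first exact: df.
  exists s; first exact: le_trans sh (h1 m).
  by rewrite /q addr0 mulNr -mulrBr E mulVKf.
have Dq m : decay 1 k (D * Num.sqrt 3 ^+ k) (q m).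
  split; first exact: (decay_lin (r m) (Dsh m) (DN m)).1.
  by move=> x; have [s s1 ->] := qE m x; exact: (decay_translate a s1 Dp).2.
have Dp' : decay 1 k (D * Num.sqrt 3 ^+ k) (partial a f).
  have n0 : `|0 : R| <= 1 by rewrite normr0.
  have := decay_translate a n0 Dp; rewrite (_ : (fun x => _) = partial a f) //.
  by apply/funext => x; rewrite scale0r addr0.
have qcv x : q m x @[m --> \oo] --> partial a f x.
  have [H _] := is_derive_partial (df x).
  have := cvg_comp _ _ harmonic_dnbhs H.
  rewrite (_ : _ \o _ = q^~ x) //; apply/funext => m /=.
  by rewrite /q addr0 mulNr -mulrBr /r /harmonic/= invrK [_ + x]addrC.
have := iterated_integral_cvg Nk ltr01 Dq Dp' qcv.
rewrite (_ : (fun m => _) = fun=> 0); last by apply/funext => m; exact: Iq.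
move=> /cvg_lim <- //; exact: lim_cst.
Qed.

End DivergenceTheorem.

Section Averages.
Variables (R : realType) (n : nat).
Local Notation N := (n + n)%N.
Implicit Types (f g : 'rV[R]_N -> R) (x : 'rV[R]_N).

(** The least decay exponent to which the results on [iterated_integral] apply. *)
Definition integrable_rV f := exists C, decay 1 N.+1 C f.

Lemma rho_norm2 x : rho x = 1 + norm2 x. Proof. by []. Qed.

Lemma integrable_rV0 : integrable_rV (fun=> 0).
Proof.
by exists 0; split=> x; [exact: cst_continuous|rewrite normr0 mul0r].
Qed.

Lemma integrable_rV_lin a f g : integrable_rV f -> integrable_rV g ->
  integrable_rV (fun x => a * f x + g x).
Proof. by move=> [C Df] [D Dg]; eexists; exact: decay_lin Df Dg. Qed.

Lemma integral_lin a f g : integrable_rV f -> integrable_rV g ->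
  iterated_integral (fun x => a * f x + g x) =
  a * iterated_integral f + iterated_integral g.
Proof.
by move=> [C Df] [D Dg]; exact: (iterated_integral_lin a (ltnSn N) ltr01 Df Dg).
Qed.

Lemma integral_rV0 : iterated_integral (fun _ : 'rV[R]_N => 0 : R) = 0.
Proof.
have := integral_lin 1 integrable_rV0 integrable_rV0.
rewrite (_ : (fun x : 'rV[R]_N => 1 * 0 + 0) = fun=> 0); last first.
  by apply/funext => x; rewrite mulr0 addr0.
by move/eqP; rewrite mul1r -subr_eq subrr eq_sym => /eqP.
Qed.

Lemma integrable_rVD f g : integrable_rV f -> integrable_rV g ->
  integrable_rV (fun x => f x + g x).
Proof.
move=> If Ig; rewrite (_ : (fun x => _) = fun x => 1 * f x + g x).
  exact: integrable_rV_lin.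
by apply/funext => x; rewrite mul1r.
Qed.

Lemma integral_rVD f g : integrable_rV f -> integrable_rV g ->
  iterated_integral (fun x => f x + g x) = iterated_integral f + iterated_integral g.
Proof.
move=> If Ig; rewrite -[iterated_integral f]mul1r -integral_lin //.
by congr iterated_integral; apply/funext => x; rewrite mul1r.
Qed.

Lemma integrable_rVZ a f : integrable_rV f -> integrable_rV (fun x => a * f x).
Proof.
move=> If; rewrite (_ : (fun x => _) = fun x => a * f x + 0).
  exact: (integrable_rV_lin a If integrable_rV0).
by apply/funext => x; rewrite addr0.
Qed.

Lemma integral_rVZ a f : integrable_rV f ->
  iterated_integral (fun x => a * f x) = a * iterated_integral f.
Proof.
move=> If; have := integral_lin a If integrable_rV0.
rewrite integral_rV0 addr0 => <-.
by congr iterated_integral; apply/funext => x; rewrite addr0.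
Qed.

Lemma integrable_rV_sum (I : finType) (F : I -> 'rV[R]_N -> R) :
  (forall i, integrable_rV (F i)) -> integrable_rV (fun x => \sum_i F i x) /\
  iterated_integral (fun x => \sum_i F i x) = \sum_i iterated_integral (F i).
Proof.
move=> IF; elim: (index_enum I) => [|i s [IH1 IH2]].
  rewrite (_ : (fun x => _) = fun=> 0); last by apply/funext => x; rewrite big_nil.
  by rewrite big_nil integral_rV0; split=> //; exact: integrable_rV0.
rewrite (_ : (fun x => _) = fun x => F i x + \sum_(j <- s) F j x); last first.
  by apply/funext => x; rewrite big_cons.
by rewrite integral_rVD // IH2 big_cons; split=> //; exact: integrable_rVD.
Qed.

Local Notation w_ m := (fun x : 'rV[R]_N => (rho x)^-1 ^+ m).

Lemma rho_ge1 x : 1 <= rho x.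
Proof. by rewrite rho_norm2 lerDl norm2_ge0. Qed.

Lemma sqrt_rho_ge1 x : 1 <= Num.sqrt (rho x).
Proof. by rewrite -[leLHS]sqrtr1 ler_wsqrtr // rho_ge1. Qed.

Lemma coord_le_rho x a : `|x 0 a| <= Num.sqrt (rho x).
Proof.
rewrite -sqrtr_sqr ler_wsqrtr // rho_norm2 /norm2 (bigD1 a)//= addrCA lerDl.
by rewrite addr_ge0 // sumr_ge0 // => k _; exact: sqr_ge0.
Qed.

(** For polynomials [p] of degree at most [e]. *)
Lemma integrable_rV_rational (p : 'rV[R]_N -> R) c e m : continuous p ->
  (forall x, `|p x| <= c * Num.sqrt (rho x) ^+ e) -> (N.+1 + e <= m.*2)%N ->
  integrable_rV (fun x => p x * (rho x)^-1 ^+ m).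
Proof.
move=> cp pc em; exists c; split.
  have sm : smooth_on setT (fun x : 'rV[R]_N => (rho x)^-1 ^+ m).
    apply: smooth_onX; first exact: openT.
    apply: smooth_onV; [exact: openT|by move=> y _; exact: rho_neq0|].
    apply: smooth_onD; [exact: openT|exact: smooth_on_cst openT|].
    exact: smooth_norm2 openT.
  move=> x; exact: (cvgM (cp x) (smooth_on_continuous sm (I : setT x))).
move=> x; have s0 : 0 < Num.sqrt (rho x) by exact: lt_le_trans (sqrt_rho_ge1 x).
have c0 : 0 <= c.
  by have := le_trans (normr_ge0 _) (pc x); rewrite pmulr_lge0 ?exprn_gt0.
rewrite normrM [`|_ ^+ m|]ger0_norm; last first.
  by rewrite exprn_ge0 // invr_ge0 ltW // rho_gt0.
have -> : (rho x)^-1 ^+ m = (Num.sqrt (rho x) ^+ m.*2)^-1.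
  by rewrite exprVn -mul2n exprM sqr_sqrtr // ltW // rho_gt0.
rewrite ler_pdivrMr ?exprn_gt0 // -mulrA -rho_norm2; apply: le_trans (pc x) _.
apply: ler_wpM2l => //; rewrite ler_pdivlMl ?exprn_gt0 // -exprD.
by apply: ler_weXn2l => //; exact: sqrt_rho_ge1.
Qed.

Lemma integrable_rho : integrable_rV (w_ n.+1).
Proof.
rewrite (_ : w_ n.+1 = fun x => 1 * (rho x)^-1 ^+ n.+1).
  apply: (@integrable_rV_rational (fun=> 1) 1 0) => [x|x|]; last by lia.
    exact: cst_continuous.
  by rewrite normr1 mul1r.
by apply/funext => x; rewrite mul1r.
Qed.

Lemma integrable_coord a : integrable_rV (fun x => x 0 a * (rho x)^-1 ^+ n.+1).
Proof.
apply: (@integrable_rV_rational (fun x => x 0 a) 1 1) => [x|x|]; last by lia.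
  exact: coord_continuous.
by rewrite mul1r expr1 coord_le_rho.
Qed.

Lemma integrable_coord2 a : integrable_rV (fun x => x 0 a * (rho x)^-1 ^+ n.+2).
Proof.
apply: (@integrable_rV_rational (fun x => x 0 a) 1 1) => [x|x|]; last by lia.
  exact: coord_continuous.
by rewrite mul1r expr1 coord_le_rho.
Qed.

Lemma integrable_coordM a b :
  integrable_rV (fun x => x 0 a * x 0 b * (rho x)^-1 ^+ n.+2).
Proof.
apply: (@integrable_rV_rational (fun x => x 0 a * x 0 b) 1 2) => [x|x|]; last by lia.
  exact: (cvgM (@coord_continuous R 1 N 0 a x) (@coord_continuous R 1 N 0 b x)).
by rewrite mul1r normrM expr2 ler_pM // coord_le_rho.
Qed.

Lemma integral_divergence a f d : (forall x, is_derive x (delta_mx 0 a) f (d x)) ->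
  integrable_rV f -> integrable_rV d -> iterated_integral d = 0.
Proof.
move=> fd [C Df] [D Dd].
have dE : partial a f = d by apply/funext => x; exact: is_partial.
rewrite -dE in Dd *.
by apply: (iterated_integral_partial (ltnSn N) _ Df Dd) => x; have [] := fd x.
Qed.

Lemma integral_coord a : iterated_integral (fun x => x 0 a * (rho x)^-1 ^+ n.+2) = 0.
Proof.
have c0 : - (2 * n.+1%:R) != 0 :> R by rewrite oppr_eq0 mulf_neq0 ?pnatr_eq0.
apply: (mulfI c0); rewrite -integral_rVZ; last exact: integrable_coord2.
rewrite mulr0; apply: (@integral_divergence a (w_ n.+1)).
- move=> x; apply: (is_derive_eqF (is_derive_rhoVX x a n.+1)).
  by rewrite -mulNr -mulrA.
- exact: integrable_rho.
- by apply: integrable_rVZ; exact: integrable_coord2.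
Qed.

(** The volume of projective space up to the factor $2^n$. *)
Definition volume : R := iterated_integral (w_ n.+1).

Lemma volume_gt0 : 0 < volume.
Proof.
have [C D] := integrable_rho.
apply: (iterated_integral_gt0 (ltnSn N) ltr01 D) => x.
by rewrite exprn_gt0 // invr_gt0 rho_gt0.
Qed.

(** Integrate the partial derivative in direction [a] of $x_b\rho^{-n-1}$. *)
Lemma integral_coordM a b :
  iterated_integral (fun x => x 0 a * x 0 b * (rho x)^-1 ^+ n.+2) =
  (a == b)%:R * volume / (2 * n.+1%:R).
Proof.
have c0 : 2 * n.+1%:R != 0 :> R by rewrite mulf_neq0 ?pnatr_eq0.
have I1 := integrable_rho; have I2 := integrable_coordM a b.
have H : iterated_integral (fun x => (a == b)%:R * (rho x)^-1 ^+ n.+1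
    + (- (2 * n.+1%:R)) * (x 0 a * x 0 b * (rho x)^-1 ^+ n.+2)) = 0.
  apply: (@integral_divergence a (fun x => x 0 b * (rho x)^-1 ^+ n.+1)).
  - move=> x; apply: (is_derive_eqF (is_deriveMF (is_derive_x x a b)
      (is_derive_rhoVX x a n.+1))).
    by move: (_ ^+ n.+1) (_ ^+ n.+2) => r1 r2; ring.
  - exact: integrable_coord.
  - by apply: integrable_rVD; exact: integrable_rVZ.
rewrite integral_rVD in H; try exact: integrable_rVZ.
rewrite !integral_rVZ // -/volume in H.
apply: (canRL (mulfK c0)); rewrite mulrC.
by move/eqP: H; rewrite mulNr subr_eq0 eq_sym => /eqP.
Qed.

(** From $\rho^{-n-2} = \rho^{-n-1} - |x|^2\rho^{-n-2}$. *)
Lemma integral_rho2 : iterated_integral (w_ n.+2) = volume / n.+1%:R.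
Proof.
have n0 : n.+1%:R != 0 :> R by rewrite pnatr_eq0.
have E : w_ n.+2 = fun x => (rho x)^-1 ^+ n.+1
    + (-1) * \sum_a x 0 a * x 0 a * (rho x)^-1 ^+ n.+2.
  apply/funext => x; rewrite -mulr_suml sum_xx exprS.
  by have := rho_neq0 x => ?; move: (_ ^+ n.+1) => u; field.
have [I1 I2] := integrable_rV_sum (fun a => integrable_coordM a a).
rewrite E integral_rVD; [|exact: integrable_rho|exact: integrable_rVZ].
rewrite integral_rVZ // I2 -/volume.
under eq_bigr do rewrite integral_coordM eqxx mul1r.
rewrite sumr_const card_ord -[_ *+ (n + n)]mulr_natr natrD -natr1.
move: n0; rewrite -natr1 => n0; move: volume => v.
by field.
Qed.

(** On average over projective space the matrix $Z^* Z/|Z|^2$ is scalar. *)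
Lemma integral_herm a b :
  integrable_rV (fun x => herm a b (hom ord0 x) * (rho x)^-1 ^+ n.+2) /\
  iterated_integral (fun x => herm a b (hom ord0 x) * (rho x)^-1 ^+ n.+2) =
  (a == b)%:R * volume / n.+1%:R.
Proof.
have n0 : n.+1%:R != 0 :> R by rewrite pnatr_eq0.
have IM := integrable_coordM; have Ic := integrable_coord2.
have E0 x : zre (hom ord0 x) ord0 = 1 /\ zim (hom ord0 x) ord0 = 0.
  by rewrite zre_hom zim_hom unlift_none.
have EL x (j : 'I_n) : zre (hom ord0 x) (lift ord0 j) = x 0 (lshift n j) /\
    zim (hom ord0 x) (lift ord0 j) = x 0 (rshift n j).
  by rewrite zre_hom zim_hom liftK.
case: (unliftP ord0 a) => [i ->|->]; case: (unliftP ord0 b) => [j ->|->].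
- rewrite (inj_eq lift_inj); have [ij|ij] := boolP (i <= j)%N.
    rewrite (_ : (fun x => _) = fun x =>
      x 0 (lshift n i) * x 0 (lshift n j) * (rho x)^-1 ^+ n.+2 +
      x 0 (rshift n i) * x 0 (rshift n j) * (rho x)^-1 ^+ n.+2).
      split; first exact: integrable_rVD.
      rewrite integral_rVD // !integral_coordM eq_lshift eq_rshift.
      by move: volume (i == j)%:R => v d; field.
    apply/funext => x; rewrite /herm /= /bump leq_add2l ij /herm_re.
    by have [-> ->] := EL x i; have [-> ->] := EL x j; rewrite mulrDl.
  rewrite (_ : (fun x => _) = fun x =>
      x 0 (rshift n i) * x 0 (lshift n j) * (rho x)^-1 ^+ n.+2 +
      (-1) * (x 0 (lshift n i) * x 0 (rshift n j) * (rho x)^-1 ^+ n.+2)).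
    split; first by apply: integrable_rVD => //; exact: integrable_rVZ.
    rewrite integral_rVD //; last exact: integrable_rVZ.
    rewrite integral_rVZ // !integral_coordM eq_lrshift eq_rlshift.
    rewrite (_ : (i == j) = false); last by apply: contraNF ij => /eqP ->.
    by rewrite !mul0r mulr0 addr0.
  apply/funext => x; rewrite /herm /= /bump leq_add2l (negbTE ij) /herm_im.
  by have [-> ->] := EL x i; have [-> ->] := EL x j; ring.
- rewrite (_ : (fun x => _) = fun x => x 0 (rshift n i) * (rho x)^-1 ^+ n.+2).
    by rewrite integral_coord eq_sym (negbTE (neq_lift _ _)) !mul0r.
  apply/funext => x; rewrite /herm /= /herm_im.
  by have [-> ->] := EL x i; have [-> ->] := E0 x; ring.
- rewrite (_ : (fun x => _) = fun x => x 0 (lshift n j) * (rho x)^-1 ^+ n.+2).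
    by rewrite integral_coord (negbTE (neq_lift _ _)) !mul0r.
  apply/funext => x; rewrite /herm /= /herm_re.
  by have [-> ->] := EL x j; have [-> ->] := E0 x; ring.
- rewrite (_ : (fun x => _) = w_ n.+2).
    split; last by rewrite integral_rho2 eqxx mul1r.
    rewrite (_ : w_ n.+2 = fun x => 1 * (rho x)^-1 ^+ n.+2).
      apply: (@integrable_rV_rational (fun=> 1) 1 0) => [x|x|]; last by lia.
        exact: cst_continuous.
      by rewrite normr1 mul1r.
    by apply/funext => x; rewrite mul1r.
  apply/funext => x; rewrite /herm /= /herm_re.
  by have [-> ->] := E0 x; ring.
Qed.

Lemma Pn_integral_herm (c : 'I_n.+1 -> 'I_n.+1 -> R) :
  Pn_integral (fun p : projective_space R n => \sum_a \sum_b c a b * eta a b p) =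
  2 ^+ n * (volume / n.+1%:R * \sum_a c a a).
Proof.
pose h a b x := herm a b (hom ord0 x) * (rho x)^-1 ^+ n.+2.
have Ih a b : integrable_rV (h a b) := (integral_herm a b).1.
have E : (fun x => (\sum_a \sum_b c a b * eta a b (affine_chart ord0 x)) *
      vol_density (@FS_metric R n ord0) x) =
    fun x => 2 ^+ n * \sum_a \sum_b c a b * h a b x.
  apply/funext => x; rewrite vol_densityE mulr_suml mulr_sumr.
  apply: eq_bigr => a _; rewrite mulr_suml mulr_sumr; apply: eq_bigr => b _.
  rewrite affine_chartE eta_class ?hom_neq0 // norm2_hom /h.
  rewrite [_^-1 ^+ n.+2]exprSr exprVn; move: (rho x ^+ n.+1)^-1 (rho x)^-1 => u r.
  by ring.
rewrite /Pn_integral E.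
have I1 a b := integrable_rVZ (c a b) (Ih a b).
have S1 a := integrable_rV_sum (I1 a).
have [S2 S3] := integrable_rV_sum (fun a => (S1 a).1).
rewrite (integral_rVZ _ S2) S3; congr (_ * _); rewrite mulr_sumr.
apply: eq_bigr => a _; rewrite (S1 a).2 (bigD1 a)//= big1 => [|b ba].
  rewrite (integral_rVZ _ (Ih a a)) (integral_herm a a).2 eqxx mul1r addr0.
  by rewrite mulrC.
rewrite (integral_rVZ _ (Ih a b)) (integral_herm a b).2 eq_sym (negbTE ba).
by rewrite !mul0r mulr0.
Qed.

Lemma Pn_integral1 :
  Pn_integral (fun _ : projective_space R n => 1) = 2 ^+ n * volume.
Proof.
rewrite /Pn_integral.
rewrite (_ : (fun x => _) = fun x => 2 ^+ n * (rho x)^-1 ^+ n.+1).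
  by rewrite integral_rVZ //; exact: integrable_rho.
by apply/funext => x; rewrite vol_densityE mul1r exprVn.
Qed.

Lemma mean_herm (c : 'I_n.+1 -> 'I_n.+1 -> R) :
  mean (fun p : projective_space R n => \sum_a \sum_b c a b * eta a b p) =
  (\sum_a c a a) / n.+1%:R.
Proof.
rewrite /mean Pn_integral_herm Pn_integral1.
have v0 : volume != 0 by rewrite gt_eqF // volume_gt0.
have p0 : (2 : R) ^+ n != 0 by rewrite expf_neq0 // pnatr_eq0.
have n0 : n.+1%:R != 0 :> R by rewrite pnatr_eq0.
move: v0 p0 n0; move: volume (2 ^+ n) n.+1%:R (\sum_a _) => v p m s v0 p0 m0.
by field; rewrite v0 p0 m0.
Qed.

End Averages.

(** * Points that detect Hermitian forms *)

Section Configuration.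
Variables (R : realType) (n : nat).
Local Notation Pn := (projective_space R n).
Local Notation M := (n.+1 + n.+1)%N.
Local Notation T := 'I_n.+1.
Implicit Types (c : T -> T -> R) (Z : 'rV[R]_M).

Definition herm_val c Z : R := \sum_a \sum_b c a b * herm a b Z.
Definition herm_fun c (p : Pn) : R := \sum_a \sum_b c a b * eta a b p.

Lemma herm_fun_class c Z : Z != 0 -> herm_fun c (class Z) = herm_val c Z / norm2 Z.
Proof.
move=> Z0; rewrite /herm_val mulr_suml; apply: eq_bigr => a _.
rewrite mulr_suml; apply: eq_bigr => b _.
by rewrite eta_class // mulrA.
Qed.

(** The vector $e_a + (\alpha + \sqrt{-1}\beta) e_b$. *)
Definition edge (a b : T) (al be : R) : 'rV[R]_M :=
  \row_k match fintype.split k with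
    | inl l => (l == a)%:R + al * (l == b)%:R | inr l => be * (l == b)%:R end.

Lemma zre_edge a b al be l : zre (edge a b al be) l = (l == a)%:R + al * (l == b)%:R.
Proof. by rewrite /zre mxE (unsplitK (inl l)). Qed.

Lemma zim_edge a b al be l : zim (edge a b al be) l = be * (l == b)%:R.
Proof. by rewrite /zim mxE (unsplitK (inr l)). Qed.

Lemma edge_neq0 (a b : T) al be : a != b -> edge a b al be != 0.
Proof.
move=> ab; apply/eqP => E; have := zre_edge a b al be a.
by rewrite E zre0 eqxx (negbTE ab) mulr0 addr0 => /esym/eqP; rewrite oner_eq0.
Qed.

Lemma sum_two (a b : T) (F : T -> R) : a != b ->
  (forall k, k != a -> k != b -> F k = 0) -> \sum_k F k = F a + F b.
Proof.
move=> ab F0; rewrite (bigD1 a)//= (bigD1 b) 1?eq_sym//=.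
by rewrite big1 ?addr0 // => k /andP[ka kb]; exact: F0.
Qed.

Lemma herm_val_edge c (a b : T) al be : (a < b)%N -> herm_val c (edge a b al be) =
  c a a + al * c a b + (al ^+ 2 + be ^+ 2) * c b b + be * c b a.
Proof.
move=> ab; have nab : a != b by rewrite neq_ltn ab.
have zr k : k != a -> k != b -> zre (edge a b al be) k = 0.
  by move=> ka kb; rewrite zre_edge (negbTE ka) (negbTE kb) mulr0 addr0.
have zi k : k != b -> zim (edge a b al be) k = 0.
  by move=> kb; rewrite zim_edge (negbTE kb) mulr0.
have h0 k l : k != a -> k != b ->
    herm k l (edge a b al be) = 0 /\ herm l k (edge a b al be) = 0.
  move=> ka kb; rewrite /herm /herm_re /herm_im !(zr k) // !(zi k) //.
  by rewrite !mulr0 !mul0r !addr0 subr0 !if_same.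
rewrite /herm_val (sum_two nab) => [|k ka kb]; last first.
  by rewrite big1 // => l _; rewrite (h0 k l ka kb).1 mulr0.
rewrite !(sum_two nab) => [|k ka kb|k ka kb]; last 2 first.
- by rewrite (h0 k b ka kb).2 mulr0.
- by rewrite (h0 k a ka kb).2 mulr0.
have nba : (b == a) = false by rewrite eq_sym (negbTE nab).
have ra : zre (edge a b al be) a = 1 by rewrite zre_edge eqxx (negbTE nab) mulr0 addr0.
have rb : zre (edge a b al be) b = al by rewrite zre_edge eqxx nba mulr1 add0r.
have ia : zim (edge a b al be) a = 0 by rewrite zim_edge (negbTE nab) mulr0.
have ib : zim (edge a b al be) b = be by rewrite zim_edge eqxx mulr1.
rewrite /herm !leqnn (ltnW ab) leqNgt ab /= /herm_re /herm_im ra rb ia ib.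
by move: (c _ _) (c _ _) (c _ _) (c _ _) => *; ring.
Qed.

(** For each pair of indices $a < b$ the four points below form a tetrahedron in the
    projective line through $e_a$ and $e_b$, a round sphere, with the centre of the
    sphere in its interior. Ordered pairs carry two points each, which makes the
    index type a product. *)
Definition config (t : T * 'I_n * bool) : 'rV[R]_M :=
  let a := t.1.1 in let b := lift a t.1.2 in
  if (a < b)%N then edge a b (if t.2 then 0 else 2) 0
  else edge b a (-1) (if t.2 then 1 else -1).

(** Weights for which the centre of the sphere is the centre of mass of each
    tetrahedron, once they are multiplied by $|Z|^2$. *)
Definition config_weight (t : T * 'I_n * bool) : R :=
  if (t.1.1 < lift t.1.1 t.1.2)%N && t.2 then 5 else 1.

Lemma configE a j e : config (a, j, e) =
  if (a < lift a j)%N then edge a (lift a j) (if e then 0 else 2) 0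
  else edge (lift a j) a (-1) (if e then 1 else -1).
Proof. by []. Qed.

Lemma config_weightE a j e :
  config_weight (a, j, e) = if (a < lift a j)%N && e then 5 else 1.
Proof. by []. Qed.

Lemma config_neq0 t : config t != 0.
Proof.
rewrite /config; have := neq_lift t.1.1 t.1.2.
by case: ifP => _; move=> ab; apply: edge_neq0 => //; rewrite eq_sym.
Qed.

Lemma config_weight_gt0 t : 0 < config_weight t.
Proof. by rewrite /config_weight; case: ifP => _; rewrite ?ltr0n ?ltr01. Qed.

(** A 2 by 2 Hermitian form has four real coefficients, and its values at the four
    points of a nondegenerate tetrahedron determine them. *)
Lemma config_detects c : (0 < n)%N -> (forall t, herm_val c (config t) = 0) ->
  forall a b, c a b = 0.
Proof.
move=> n0 H.
have key (a b : T) : (a < b)%N ->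
    [/\ c a a = 0, c a b = 0, c b a = 0 & c b b = 0].
  move=> ab; have nab : a != b by rewrite neq_ltn ab.
  have [j bj] := unlift_some nab; have [i ai] : exists i, a = lift b i.
    by rewrite eq_sym in nab; have [i ->] := unlift_some nab; exists i.
  have E t := H t; have := E (a, j, true); have := E (a, j, false).
  have := E (b, i, true); have := E (b, i, false).
  rewrite !configE -ai -bj ab ltnNge (ltnW ab) /= !herm_val_edge //.
  by move: (c a a) (c a b) (c b a) (c b b) => x y z w *; split; lra.
have diag a : c a a = 0.
  have [->|a0] := eqVneq a ord0.
    by have [] := @key ord0 ord_max n0.
  by have [] := @key ord0 a; rewrite // lt0n.
move=> a b; have [ab|ab|ab] := ltngtP a b.
- by have [] := key _ _ ab.
- by have [] := key _ _ ab.
- by rewrite (val_inj ab : a = b) diag.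
Qed.

Lemma sum_lift (a : T) (F : T -> R) : \sum_(j < n) F (lift a j) = \sum_b F b - F a.
Proof. by rewrite [\sum_b F b](bigD1_ord a)//= addrAC subrr add0r. Qed.

(** Each tetrahedron contributes $8(c_{aa} + c_{bb})$; the antisymmetric [s] accounts
    for the difference between this and an even split over the two ordered pairs. In
    particular forms of trace zero are balanced. *)
Lemma config_sum c : \sum_t config_weight t * herm_val c (config t) =
  8 * n%:R * \sum_a c a a.
Proof.
pose s (a b : T) : R := if (a < b)%N then c a a + c a b
  else if (b < a)%N then - (c b b + c b a) else 0.
have sN a b : s b a = - s a b.
  by rewrite /s; case: ltngtP => _; rewrite ?opprK ?oppr0.
have s0 : \sum_a \sum_b s a b = 0.
  have : \sum_a \sum_b s a b = - \sum_a \sum_b s a b.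
    rewrite [LHS]exchange_big/= -sumrN; apply: eq_bigr => a _.
    by rewrite -sumrN; apply: eq_bigr => b _; rewrite sN.
  by move/eqP; rewrite -addr_eq0 -mulr2n mulrn_eq0/= => /eqP.
have saa a : s a a = 0 by rewrite /s ltnn.
rewrite -(pair_bigA _ (fun aj e =>
  config_weight (aj, e) * herm_val c (config (aj, e))))/=.
rewrite -(pair_bigA _ (fun a j => \sum_e
  config_weight ((a, j), e) * herm_val c (config ((a, j), e))))/=.
transitivity (\sum_a \sum_(j < n)
    (4 * (c a a + c (lift a j) (lift a j)) + 2 * s a (lift a j))).
  apply: eq_bigr => a _; apply: eq_bigr => j _.
  rewrite big_bool !configE !config_weightE.
  have := neq_lift a j; rewrite neq_ltn /s; move: (lift a j) => b.
  case: (ltngtP a b) => //= ab _.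
  - rewrite !herm_val_edge //; move: (c _ _) (c _ _) (c _ _) (c _ _) => *; ring.
  - rewrite !herm_val_edge //; move: (c _ _) (c _ _) (c _ _) (c _ _) => *; ring.
transitivity (\sum_a (4 * (n%:R * c a a + (\sum_b c b b - c a a))
    + 2 * \sum_b s a b)).
  apply: eq_bigr => a _; rewrite big_split/= -!mulr_sumr; congr (_ * _ + _ * _).
    by rewrite big_split/= (sum_lift a (fun b => c b b)) sumr_const card_ord mulr_natl.
  by rewrite (sum_lift a (s a)) saa subr0.
rewrite big_split/= -!mulr_sumr s0 mulr0 addr0 big_split/= sumrB -mulr_sumr.
rewrite sumr_const card_ord -mulr_natr -natr1.
by move: (\sum_a _) => S; ring.
Qed.

Lemma quadratic_herm_fun c : quadratic_fun (herm_fun c).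
Proof.
have qsum (I : finType) (F : I -> Pn -> R) : (forall i, quadratic_fun (F i)) ->
    quadratic_fun (fun p => \sum_i F i p).
  move=> QF; elim: (index_enum I) => [|i s IH].
    rewrite (_ : (fun p => _) = fun=> 0); first exact: quadratic_fun_cst.
    by apply/funext => p; rewrite big_nil.
  rewrite (_ : (fun p => _) = fun p => F i p + \sum_(j <- s) F j p).
    exact: quadratic_funD.
  by apply/funext => p; rewrite big_cons.
apply: (qsum _ (fun a p => \sum_b c a b * eta a b p)) => a.
apply: (qsum _ (fun b p => c a b * eta a b p)) => b.
exact: quadratic_funZ (@quadratic_eta R n a b).
Qed.

Lemma ker_LL_herm_fun c : ker_LL (herm_fun c).
Proof. exact: ker_LL_quadratic (quadratic_herm_fun c). Qed.

Lemma herm_fun_eq0 c : (0 < n)%N -> (forall t, herm_fun c (class (config t)) = 0) ->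
  forall a b, c a b = 0.
Proof.
move=> n0 H; apply: config_detects => // t; have := H t.
rewrite herm_fun_class ?config_neq0 // => /eqP; rewrite mulf_eq0 invr_eq0.
by rewrite norm2_eq0 (negbTE (config_neq0 t)) orbF => /eqP.
Qed.

Lemma herm_fun_id p : herm_fun (fun a b => (a == b)%:R) p = 1.
Proof.
have [Z Z0 ->] := class_surj p.
rewrite herm_fun_class //.
have -> : herm_val (fun a b => (a == b)%:R) Z = norm2 Z.
  rewrite norm2E; apply: eq_bigr => a _; rewrite (bigD1 a)//= eqxx mul1r.
  rewrite big1 ?addr0 => [|b ba]; last by rewrite eq_sym (negbTE ba) mul0r.
  by rewrite /herm leqnn /herm_re /zabs2 !expr2.
by rewrite mulfV // norm2_eq0.
Qed.

Lemma herm_fun_sum (I : finType) (u : I -> R) (C : I -> T -> T -> R) p :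
  \sum_i u i * herm_fun (C i) p = herm_fun (fun a b => \sum_i u i * C i a b) p.
Proof.
under eq_bigr do rewrite mulr_sumr.
rewrite exchange_big/=; apply: eq_bigr => a _.
under eq_bigr do rewrite mulr_sumr.
rewrite exchange_big/=; apply: eq_bigr => b _.
by rewrite mulr_suml; apply: eq_bigr => i _; rewrite mulrA.
Qed.

End Configuration.

(** The change of basis matrices are inverse to each other. *)
Lemma basis_size_unique (R : realType) (X : Type) (n1 n2 : nat)
    (f : 'I_n1 -> X -> R) (g : 'I_n2 -> X -> R) :
  (forall u, (forall p, \sum_i u i * f i p = 0) -> forall i, u i = 0) ->
  (forall u, (forall p, \sum_i u i * g i p = 0) -> forall i, u i = 0) ->
  (forall i, exists u, forall p, f i p = \sum_j u j * g j p) ->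
  (forall j, exists u, forall p, g j p = \sum_i u i * f i p) -> n1 = n2.
Proof.
have half (m1 m2 : nat) (h : 'I_m1 -> X -> R) (k : 'I_m2 -> X -> R) :
  (forall u, (forall p, \sum_i u i * h i p = 0) -> forall i, u i = 0) ->
  (forall i, exists u, forall p, h i p = \sum_j u j * k j p) ->
  (forall j, exists u, forall p, k j p = \sum_i u i * h i p) -> (m1 <= m2)%N.
  move=> ih /choice[A HA] /choice[B HB].
  pose A' : 'M[R]_(m1, m2) := \matrix_(i, j) A i j.
  pose B' : 'M[R]_(m2, m1) := \matrix_(j, i) B j i.
  suff AB : A' *m B' = 1%:M by exact: mulmx1_min AB.
  apply/matrixP => i l; apply/eqP; rewrite -subr_eq0; apply/eqP.
  move: l; apply: ih => p.
  under eq_bigr do rewrite mulrBl.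
  rewrite sumrB (bigD1 i (F := fun l => 1%:M i l * h l p))//= mxE eqxx mul1r.
  rewrite [X in _ - (_ + X)]big1 ?addr0 => [|l li]; last first.
    by rewrite mxE eq_sym (negbTE li) mul0r.
  apply/eqP; rewrite subr_eq0; apply/eqP; rewrite HA.
  under eq_bigr do rewrite mxE mulr_suml.
  rewrite exchange_big/=; apply: eq_bigr => j _.
  rewrite HB mulr_sumr; apply: eq_bigr => l _.
  by rewrite !mxE mulrA.
move=> If Ig fg gf; apply/eqP; rewrite eqn_leq.
by apply/andP; split; [exact: half If fg gf|exact: half Ig gf fg].
Qed.

(** * Adapted bases and balanced configurations *)

Section AdaptedBasis.
Variables (R : realType) (n : nat) (n_gt0 : (0 < n)%N).
Local Notation Pn := (projective_space R n).
Local Notation T := 'I_n.+1.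
Implicit Types (c : T -> T -> R).

Lemma herm_fun_inj c : (forall p, herm_fun c p = 0) -> forall a b, c a b = 0.
Proof. by move=> H; apply: (herm_fun_eq0 n_gt0) => t; exact: H. Qed.

Lemma mean_herm_fun_eq0 c : mean (herm_fun c) = 0 <-> \sum_a c a a = 0.
Proof.
rewrite /herm_fun mean_herm; split=> [/eqP|->]; last by rewrite mul0r.
by rewrite mulf_eq0 invr_eq0 pnatr_eq0 orbF => /eqP.
Qed.

Lemma bij_from_ord (S : finType) (x0 : S) k : #|S| = k.+1 ->
  exists2 s : 'I_k.+1 -> S, bijective s & s ord0 = x0.
Proof.
move=> E; exists (fun i => enum_val (cast_ord (esym E)
    (tperm ord0 (cast_ord E (enum_rank x0)) i))).
  exists (fun t => tperm ord0 (cast_ord E (enum_rank x0)) (cast_ord E (enum_rank t))).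
    by move=> i; rewrite enum_valK cast_ordKV tpermK.
  by move=> t; rewrite tpermK cast_ordK enum_rankK.
by rewrite tpermL cast_ordK enum_rankK.
Qed.

Local Notation o := ((ord0, ord0) : T * T).

(** Removing the trace gives mean zero; the identity, which stands for the constant
    function 1, takes the place of the first matrix unit. *)
Definition basis_mx (t : T * T) a b : R :=
  if t == o then (a == b)%:R
  else ((a, b) == t)%:R - (t.1 == t.2)%:R / n.+1%:R * (a == b)%:R.

Definition diag_part (w : T * T -> R) : R :=
  \sum_(t | t != o) w t * ((t.1 == t.2)%:R / n.+1%:R).

Lemma basis_mx_sum (w : T * T -> R) a b : \sum_t w t * basis_mx t a b =
  (w o - diag_part w) * (a == b)%:R + (if (a, b) == o then 0 else w (a, b)).
Proof.
rewrite (bigD1 o)//= {1}/basis_mx eqxx mulrBl -addrA; congr (_ + _).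
transitivity (\sum_(t | t != o) (w t * ((a, b) == t)%:R -
    w t * ((t.1 == t.2)%:R / n.+1%:R) * (a == b)%:R)).
  by apply: eq_bigr => t /negbTE t0; rewrite /basis_mx t0 mulrBr mulrA.
rewrite sumrB addrC -mulr_suml; congr (_ + _); case: ifPn => ab.
  rewrite big1 // => t t0; rewrite (eqP ab) eq_sym (negbTE t0).
  by rewrite mulr0.
rewrite (bigD1 (a, b))//= eqxx mulr1 big1 ?addr0 // => t /andP[_ tab].
by rewrite eq_sym (negbTE tab) mulr0.
Qed.

Lemma basis_mx_free (w : T * T -> R) :
  (forall a b, \sum_t w t * basis_mx t a b = 0) -> forall t, w t = 0.
Proof.
move=> H; have K0 : w o - diag_part w = 0.
  by have := H ord0 ord0; rewrite basis_mx_sum !eqxx mulr1 addr0.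
have w0 t : t != o -> w t = 0.
  case: t => a b t0; have := H a b.
  by rewrite basis_mx_sum K0 mul0r add0r (negbTE t0).
move=> t; have [->|/w0//] := eqVneq t o.
move: K0; rewrite /diag_part big1 ?subr0 // => s /w0 ->.
by rewrite mul0r.
Qed.

Lemma basis_mx_span c : exists w : T * T -> R,
  forall a b, c a b = \sum_t w t * basis_mx t a b.
Proof.
pose w' t := c t.1 t.2 - (t.1 == t.2)%:R * c ord0 ord0.
exists (fun t => if t == o then c ord0 ord0 + diag_part w' else w' t) => a b.
rewrite basis_mx_sum eqxx.
have -> : diag_part (fun t => if t == o then c ord0 ord0 + diag_part w' else w' t) =
    diag_part w' by apply: eq_bigr => t /negbTE ->.
rewrite addrK; have [[-> ->]|_] := eqVneq (a, b) o; first by rewrite eqxx mulr1 addr0.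
by rewrite /w'/= mulrC addrC subrK.
Qed.

Lemma basis_mx_trace t : t != o -> \sum_a basis_mx t a a = 0.
Proof.
move=> /negbTE t0; rewrite /basis_mx t0 sumrB; apply/eqP; rewrite subr_eq0; apply/eqP.
under [RHS]eq_bigr do rewrite eqxx mulr1.
rewrite sumr_const card_ord -[_ *+ n.+1]mulr_natr mulfVK ?pnatr_eq0 //.
case: t {t0} => a b /=; rewrite (bigD1 a)//= xpair_eqE eqxx/= big1 ?addr0 // => k ka.
by rewrite xpair_eqE (negbTE ka).
Qed.

Lemma card_pairs : #|{: T * T}| = (n ^ 2 + 2 * n).+1.
Proof. by rewrite card_prod card_ord -mulnn; lia. Qed.

Lemma adapted_basis_exists :
  exists xi : 'I_(n ^ 2 + 2 * n).+1 -> Pn -> R, is_adapted_basis xi.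
Proof.
have [s [s' sK s'K] s0] := bij_from_ord o card_pairs.
have sumE (u : 'I_(n ^ 2 + 2 * n).+1 -> R) a b :
    \sum_i u i * basis_mx (s i) a b = \sum_t u (s' t) * basis_mx t a b.
  rewrite [RHS](reindex s)/=; first by apply: eq_bigr => i _; rewrite sK.
  by exists s' => i _; [exact: sK|exact: s'K].
exists (fun i => herm_fun (basis_mx (s i))); split=> [|p|i].
- split=> [i|u H i|f].
  + exact: ker_LL_herm_fun.
  + have {}H : forall p, herm_fun (fun a b => \sum_i u i * basis_mx (s i) a b) p = 0.
      by move=> p; rewrite -(herm_fun_sum u (fun i => basis_mx (s i))).
    rewrite -(sK i); apply: (basis_mx_free (w := fun t => u (s' t))) => a b.
    by rewrite -sumE; exact: herm_fun_inj H a b.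
  + move=> /(ker_LL_span n_gt0)[c fE]; have [w cE] := basis_mx_span c.
    exists (fun i => w (s i)) => p; rewrite fE.
    rewrite (herm_fun_sum (fun i => w (s i)) (fun i => basis_mx (s i))).
    apply: eq_bigr => a _; apply: eq_bigr => b _; congr (_ * _).
    by rewrite cE sumE; apply: eq_bigr => t _; rewrite s'K.
- rewrite s0 -[RHS](herm_fun_id p); apply: eq_bigr => a _; apply: eq_bigr => b _.
  by rewrite /basis_mx eqxx.
- apply/mean_herm_fun_eq0/basis_mx_trace; rewrite -s0 (can_eq sK).
  by rewrite eq_sym neq_lift.
Qed.

Variables (d : nat) (xi : 'I_d.+1 -> Pn -> R) (xiP : is_adapted_basis xi).

Lemma adapted_basis_herm : exists C : 'I_d.+1 -> T -> T -> R,
  forall i p, xi i p = herm_fun (C i) p.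
Proof.
have [[kxi _ _] _ _] := xiP.
have /choice[C CE] i : exists c, forall p, xi i p = herm_fun c p.
  exact: ker_LL_span n_gt0 (kxi i).
by exists C.
Qed.

Lemma adapted_basis_size : d = (n ^ 2 + 2 * n)%N.
Proof.
have [[kxi ixi sxi] _ _] := xiP.
have [xi' [[kxi' ixi' sxi'] _ _]] := adapted_basis_exists.
apply/succn_inj; apply: (basis_size_unique ixi ixi') => i.
- exact: sxi' (kxi i).
- exact: sxi (kxi' i).
Qed.

Let m := #|{: T * 'I_n * bool}|.
Let pt (j : 'I_m) : Pn := class (config R (enum_val j)).

(** A combination of the basis functions that vanishes on the configuration is a
    Hermitian function with vanishing coefficients. *)
Lemma evaluation_config_free : row_free (evaluation_mx xi pt).
Proof.
have [C CE] := adapted_basis_herm; have [[_ ixi _] _ _] := xiP.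
rewrite -kermx_eq0; apply/rowV0P => u /sub_kermxP uM.
pose u' i : R := if unlift ord0 i is Some k then u 0 k else 0.
have uE p : \sum_i u' i * xi i p = \sum_(k < d) u 0 k * xi (lift ord0 k) p.
  rewrite big_ord_recl /u' unlift_none mul0r add0r.
  by apply: eq_bigr => k _; rewrite liftK.
have uC p : \sum_i u' i * xi i p = herm_fun (fun a b => \sum_i u' i * C i a b) p.
  by rewrite -herm_fun_sum; apply: eq_bigr => i _; rewrite CE.
have C0 a b : \sum_i u' i * C i a b = 0.
  move: a b; apply: (herm_fun_eq0 n_gt0) => t; rewrite -uC uE.
  have /rowP/(_ (enum_rank t)) := uM; rewrite !mxE => E; rewrite -[RHS]E.
  by apply: eq_bigr => k _; rewrite mxE /pt enum_rankK.
have u0 : forall i, u' i = 0.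
  apply: ixi => p; rewrite uC; apply: big1 => a _; apply: big1 => b _.
  by rewrite C0 mul0r.
by apply/rowP => k; rewrite mxE; have := u0 (lift ord0 k); rewrite /u' liftK.
Qed.

(** Clearing the denominators of the Hermitian functions turns the weights of
    the configuration into a positive relation between its points. *)
Lemma config_positive_kernel : positive_kernel xi pt
  (\row_j (config_weight R (enum_val j) * norm2 (config R (enum_val j)))).
Proof.
have [C CE] := adapted_basis_herm; have [_ _ mxi] := xiP.
split=> [j|].
  rewrite mxE mulr_gt0 ?config_weight_gt0 // lt_def norm2_eq0 config_neq0.
  exact: norm2_ge0.
apply/colP => i; rewrite !mxE.
have tr0 : \sum_a C (lift ord0 i) a a = 0.
  apply/mean_herm_fun_eq0; rewrite -[RHS](mxi i); congr mean.
  by apply/funext => p; rewrite CE.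
transitivity (\sum_t config_weight R t * herm_val (C (lift ord0 i)) (config R t)).
  rewrite [RHS](reindex (@enum_val _ (mem {: T * 'I_n * bool})))/=; last first.
    by exists enum_rank => t _; [exact: enum_valK|exact: enum_rankK].
  apply: eq_bigr => j _; rewrite !mxE /pt CE herm_fun_class ?config_neq0 //.
  have := config_neq0 R (enum_val j); rewrite -norm2_eq0.
  by move: (herm_val _ _) (norm2 _) (config_weight _ _) => A B W B0; field.
by rewrite config_sum tr0 mulr0.
Qed.

Lemma card_config : m = (2 * n * (n + 1))%N.
Proof. by rewrite /m !card_prod !card_ord card_bool; lia. Qed.

Lemma admissible_config : admissible xi m.
Proof.
have m_ge : (d.+1 <= m)%N by rewrite adapted_basis_size card_config -mulnn; nia.
split=> //; exists pt; split; first exact/eqP/evaluation_config_free.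
have m1 : (1 < m.+1)%N by rewrite ltnS (leq_trans _ m_ge).
apply/eqP; rewrite -lt0n; apply: (bigop.bigmax_sup (Ordinal m1)) => //.
apply/asboolP; have := config_positive_kernel; move: (\row_j _) => v vK.
exists v => [|i]; last first.
  by suff -> : row i v = v by []; apply/rowP => j; rewrite mxE ord1.
rewrite /row_free rank_rV; suff -> : v != 0 by [].
apply/eqP => v0; have := vK.1 (Ordinal (leq_trans (ltn0Sn d) m_ge)).
by rewrite v0 mxE ltxx.
Qed.

End AdaptedBasis.

Theorem lemma1p3 (R : realType) (n : nat) (n_gt0 : (0 < n)%N) :
  (exists xi : 'I_(n ^ 2 + 2 * n).+1 -> projective_space R n -> R,
     is_adapted_basis xi) /\
  (forall (d : nat) (xi : 'I_d.+1 -> projective_space R n -> R),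
     is_adapted_basis xi ->
     d = (n ^ 2 + 2 * n)%N /\
     exists m0 : nat, is_m0 xi m0 /\ (m0 <= 2 * n * (n + 1))%N).
Proof.
split=> [|d xi xiP]; first exact: adapted_basis_exists.
split; first exact: adapted_basis_size xiP.
have adm := admissible_config n_gt0 xiP.
have ex : exists m, `[< admissible xi m >] by eexists; apply/asboolP; exact: adm.
case: (ex_minnP ex) => m0 /asboolP am0 m0_min; exists m0; split.
  by split=> // m am; apply: m0_min; exact/asboolP.
by have := m0_min _ (asboolT adm); rewrite card_config.
Qed.
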